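(* Let $p$ be a prime, let $\alpha\in\mathbb{N}$ with $\alpha\ge 2$, and let $t\in\mathbb{N}_0$. There exist constants $U_{k,\alpha,t}>0$ ($k\in\mathbb{N}$), depending only on $k,\alpha,t$ and $p$, such that the following holds. Let $s\in\mathbb{N}$, $1\le q,r\le\infty$, let $\boldsymbol{\gamma}=(\gamma_u)_{u\subseteq\{1,\ldots,s\}}$ be non-negative weights, and let $\mathcal{S}$ be an order $\alpha$ digital $(t,s)$-sequence over $\mathbb{F}_p$ such that, for every $m\in\mathbb{N}$, the first $p^m$ points have precision at most $\alpha m$, i.e. the generating matrices $C_j=(c^{(j)}_{k,l})_{k,l\in\mathbb{N}}$ satisfy $c^{(j)}_{k,l}=0$ whenever $k>\alpha l$. Let $m\in\mathbb{N}$ with $\alpha m>t$. For $f\in W_{s,\alpha,q,r}$ put $$I^{(1)}_{m+i}(f)=I\bigl(f;P^{[(m+i)\times(m+i)]}\bigr)\quad (0\le i<\alpha),$$ and recursively, for $1\le\tau<\alpha$, $$I^{(\tau+1)}_{m+i}(f)=\frac{p^{\tau}I^{(\tau)}_{m+i+1}(f)-I^{(\tau)}_{m+i}(f)}{p^{\tau}-1}\quad (0\le i<\alpha-\tau).$$ Then, with $N=p^m+p^{m+1}+\cdots+p^{m+\alpha-1}$ (the total number of function evaluations used by $I^{(\alpha)}_m(f)$), $$\sup_{\substack{f\in W_{s,\alpha,q,r}\\ \|f\|_{s,\alpha,q,r}\le 1}}\left|I(f)-I^{(\alpha)}_m(f)\right|\le\sum_{\emptyset\ne u\subseteq\{1,\ldots,s\}}\gamma_u\,U_{|u|,\alpha,t}\,\frac{(\log_p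 N)^{\alpha|u|}}{N^{\alpha}}.$$
   Context: Notation: $\mathbb{N}$ is the set of positive integers, $\mathbb{N}_0=\mathbb{N}\cup\{0\}$; $\mathbb{F}_p$ is the field with $p$ elements, identified with $\{0,\ldots,p-1\}$. For $\boldsymbol{x}\in\mathbb{R}^s$ and $u\subseteq\{1,\ldots,s\}$, $\boldsymbol{x}_u=(x_j)_{j\in u}$ and $-u=\{1,\ldots,s\}\setminus u$. $I(f)=\int_{[0,1)^s}f(\boldsymbol{x})\,d\boldsymbol{x}$. Function space. For $f:[0,1)^s\to\mathbb{R}$ having partial mixed derivatives up to order $\alpha$ in each variable, define $$\|f\|^r_{s,\alpha,q,r}=\sum_{u\subseteq\{1,\ldots,s\}}\Bigl(\gamma_u^{-q}\sum_{v\subseteq u}\sum_{\boldsymbol{\tau}_{u\setminus v}\in\{1,\ldots,\alpha\}^{|u\setminus v|}}\int_{[0,1)^{|v|}}\Bigl|\int_{[0,1)^{s-|v|}}f^{(\boldsymbol{\tau}_{u\setminus v},\boldsymbol{\alpha}_v,\boldsymbol{0})}(\boldsymbol{x})\,d\boldsymbol{x}_{-v}\Bigr|^q d\boldsymbol{x}_v\Bigr)^{r/q},$$ with the obvious modification if $q$ or $r$ is infinite. Here $f^{(\boldsymbol{\tau}_{u\setminus v},\boldsymbol{\alpha}_v,\boldsymbol{0})}$ is the partial mixed derivative of order $\beta_j=\tau_j$ in $x_j$ for $j\in u\setminus v$, $\beta_j=\alpha$ for $j\in v$, $\beta_j=0$ otherwise. If $\gamma_u=0$, the corresponding inner double sum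 is assumed to be $0$ and $0/0=0$. $W_{s,\alpha,q,r}=\{f:\|f\|_{s,\alpha,q,r}<\infty\}$. Functions in this space are identified with their pointwise representation $f(\boldsymbol{x})=\sum_{u}f_u(\boldsymbol{x}_u)$, where $$f_u(\boldsymbol{x}_u)=\sum_{v\subseteq u}(-1)^{(\alpha+1)|v|}\sum_{\boldsymbol{\tau}_{u\setminus v}\in\{1,\ldots,\alpha\}^{|u\setminus v|}}\prod_{j\in u\setminus v}b_{\tau_j}(x_j)\int_{[0,1)^s}f^{(\boldsymbol{\tau}_{u\setminus v},\boldsymbol{\alpha}_v,\boldsymbol{0})}(\boldsymbol{y})\prod_{j\in v}\tilde b_\alpha(y_j-x_j)\,d\boldsymbol{y},$$ $b_\tau(x)=B_\tau(x)/\tau!$ with $B_\tau$ the Bernoulli polynomial of degree $\tau$, and $\tilde b_\alpha$ is the one-periodic extension of $b_\alpha|_{[0,1)}$. Digital nets. For $m,n\in\mathbb{N}$ and $C_1,\ldots,C_s\in\mathbb{F}_p^{n\times m}$, the digital net with these generating matrices is the family $\{\boldsymbol{x}_h:0\le h<p^m\}\subset[0,1)^s$ (counted with multiplicity): if $h=\eta_0+\eta_1p+\cdots+\eta_{m-1}p^{m-1}$ in base $p$, then $x_{h,j}=\sum_{i=1}^n\xi_{h,j,i}p^{-i}$ with $(\xi_{h,j,1},\ldots,\xi_{h,j,n})=(\eta_0,\ldots,\eta_{m-1})C_j^\top$ over $\mathbb{F}_p$. Its dual net is $$P^\perp=\{\boldsymbol{k}\in\mathbb{N}_0^s: C_1^\top\nu_n(k_1)+\cdots+C_s^\top\nu_n(k_s)=\boldsymbol{0}\in\mathbb{F}_p^m\},$$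 where $\nu_n(k)=(\kappa_0,\ldots,\kappa_{n-1})^\top$ for $k=\kappa_0+\kappa_1p+\cdots$ in base $p$. These definitions also apply with $n=\infty$ when all but finitely many rows of each $C_j$ vanish. Digital sequences. A digital sequence over $\mathbb{F}_p$ is generated by $C_1,\ldots,C_s\in\mathbb{F}_p^{\mathbb{N}\times\mathbb{N}}$, each with finitely supported columns, by the same rule applied to all $h\in\mathbb{N}_0$: $(\xi_{h,j,1},\xi_{h,j,2},\ldots)=(\eta_0,\eta_1,\ldots)C_j^\top$. Its first $p^m$ points form the digital net generated by the first $m$ columns of each $C_j$. Weight function. For $k=\kappa_1p^{c_1-1}+\cdots+\kappa_vp^{c_v-1}$ with $\kappa_i\in\{1,\ldots,p-1\}$, $c_1>\cdots>c_v>0$, set $\mu_\alpha(k)=\sum_{i=1}^{\min(\alpha,v)}c_i$, $\mu_\alpha(0)=0$, and $\mu_\alpha(k_1,\ldots,k_s)=\sum_j\mu_\alpha(k_j)$. An order $\alpha$ digital $(t,m,s)$-net over $\mathbb{F}_p$, with integer $0\le t\le\alpha m$, is a digital net $P$ over $\mathbb{F}_p$ with $p^m$ points in $[0,1)^s$ satisfying $\min_{\boldsymbol{k}\in P^\perp\setminus\{\boldsymbol{0}\}}\mu_\alpha(\boldsymbol{k})>\alpha m-t$. An order $\alpha$ digital $(t,s)$-sequence over $\mathbb{F}_p$ is a digital sequence whose first $p^m$ points form an order $\alpha$ digital $(t,m,s)$-net for every $m$ with $\alpha m>t$. For the sequence $\mathcal{S}$ with generating matrices $C_1,\ldots,C_s$,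 $P^{[n\times m]}$ denotes the digital net generated by the upper-left $n\times m$ submatrices of $C_1,\ldots,C_s$ (equivalently, the first $p^m$ points of $\mathcal{S}$ with every coordinate truncated to its first $n$ base-$p$ digits). For a family $P$ of $M$ points (with multiplicity), $I(f;P)=\frac1M\sum_{\boldsymbol{x}\in P}f(\boldsymbol{x})$. *)

(* Defs.v *)
From HB Require Import structures.
From mathcomp Require Import all_boot all_order all_algebra.
From mathcomp Require Import all_classical all_reals all_analysis ess_sup_inf.

Set Implicit Arguments.
Unset Strict Implicit.
Unset Printing Implicit Defensive.
Import Order.TTheory GRing.Theory Num.Theory.
Import numFieldNormedType.Exports.
Local Open Scope classical_set_scope.
Local Open Scope ring_scope.

Section UnitInterval.
Context {R : realType}.

Definition unit_interval : set (measurableTypeR R) := `[0%R, 1%R[%classic.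

Lemma measurable_unit_interval : measurable unit_interval.
Proof. exact: measurable_itv. Qed.

Definition unit_measure : set (measurableTypeR R) -> \bar R :=
  mrestr lebesgue_measure measurable_unit_interval.

HB.instance Definition _ := Measure.on unit_measure.

Let unit_measureT : unit_measure setT = 1%E.
Proof.
by rewrite /unit_measure /mrestr setTI lebesgue_measure_itv/= lte_fin ltr01 sube0.
Qed.

HB.instance Definition _ :=
  Measure_isProbability.Build _ _ _ unit_measure unit_measureT.

End UnitInterval.

(* A point of R^s.  Coordinates live in [measurableTypeR R], i.e. R with its
   Borel sigma-algebra, so that [s.-tuple] carries the product one. *)
Definition vecR (R : realType) (s : nat) := s.-tuple (measurableTypeR R).

Definition coord (R : realType) (s : nat) (x : vecR R s) (j : 'I_s) : R :=
  tnth x j.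

Section Cube.
Context {R : realType}.

Definition point_cons (s : nat) (z : measurableTypeR R * vecR R s) :
  vecR R s.+1 := [the s.+1.-tuple _ of z.1 :: z.2].

Lemma measurable_point_cons (s : nat) : measurable_fun setT (@point_cons s).
Proof. exact: measurable_cons. Qed.

HB.instance Definition _ (s : nat) :=
  isMeasurableFun.Build _ _ _ _ (@point_cons s) (@measurable_point_cons s).

(* Lebesgue measure on R^s restricted to [0,1)^s, as an s-fold product. *)
Fixpoint cube_measure (s : nat) : probability (vecR R s) R :=
  if s is s'.+1
  then distribution (unit_measure \x cube_measure s')%E (@point_cons s')
  else dirac [tuple].

End Cube.

(* The product formula on boxes, which characterizes the measure. *)
Lemma cube_measure_box (R : realType) (s : nat)
    (A : 'I_s -> set (measurableTypeR R)) :
  (forall j, measurable (A j)) ->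
  cube_measure s [set x : vecR R s | forall j, A j (coord x j)] =
  (\prod_(j < s) lebesgue_measure (A j `&` `[0%R, 1%R[%classic))%E.
Proof.
elim: s A => [|s IHs] A mA; first by rewrite big_ord0 /= diracE mem_set// => -[].
rewrite big_ord_recl -IHs// -(product_measure1E unit_measure (cube_measure s))//.
  rewrite /= /distribution /pushforward; congr (_ _).
  apply/seteqP; split => -[z x] /=.
    move=> H; split; first exact: (H ord0).
    by move=> j; have := H (lift ord0 j); rewrite /coord /point_cons tnthS.
  move=> [H0 H] j; case: (unliftP ord0 j) => [i ->|->]; last exact: H0.
  by rewrite /coord /point_cons tnthS; exact: H.
rewrite (_ : [set x | _] = \bigcap_j ((fun x : vecR R s =>
    tnth x j) @^-1` A (lift ord0 j))).
  apply: fin_bigcap_measurable => // j _.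
  by rewrite -[X in measurable X]setTI; exact: measurable_tnth.
by apply/seteqP; split => x /= H j; [move=> _|]; exact: H.
Qed.

Definition cube (R : realType) (s : nat) : set (vecR R s) :=
  [set x | forall j, 0 <= coord x j < 1].
Arguments cube : clear implicits.

(* [cube_measure s] is concentrated on [0,1)^s, so integrals over the cube are
   taken over the whole type. *)
Definition cube_int (R : realType) (s : nat) (f : vecR R s -> R) : R :=
  \int[cube_measure s]_x f x.

Definition cube_integrable (R : realType) (s : nat) (f : vecR R s -> R) : Prop :=
  (cube_measure s).-integrable setT (EFin \o f).

Section WeakDerivatives.
Context {R : realType} {s : nat}.

Definition partial (j : 'I_s) (phi : 'rV[R]_s -> R) : 'rV[R]_s -> R :=
  fun x => 'D_(delta_mx 0 j) phi x.

Definition smooth (phi : 'rV[R]_s -> R) : Prop :=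
  forall js : seq 'I_s,
    continuous (foldr partial phi js) /\
    forall (j : 'I_s) (x : 'rV[R]_s),
      derivable (foldr partial phi js) x (delta_mx 0 j).

Definition test_function (phi : 'rV[R]_s -> R) : Prop :=
  smooth phi /\
  exists K : set 'rV[R]_s,
    [/\ compact K,
        K `<=` [set x | forall j, 0 < x 0 j < 1] &
        forall x, ~ K x -> phi x = 0].

Definition test_at (phi : 'rV[R]_s -> R) (x : vecR R s) : R :=
  phi (\row_j coord x j).

Variable alpha : nat.
Implicit Types (beta : {ffun 'I_s -> 'I_alpha.+1}) (f g : vecR R s -> R).

Definition mixed_partial beta (phi : 'rV[R]_s -> R) : 'rV[R]_s -> R :=
  foldr (fun j => iter (beta j) (partial j)) phi (enum 'I_s).

Definition weak_derivative beta f g : Prop :=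
  cube_integrable g /\
  forall phi, test_function phi ->
    cube_int (fun x => f x * test_at (mixed_partial beta phi) x) =
    (-1) ^+ (\sum_j beta j) * cube_int (fun x => g x * test_at phi x).

(* The derivative f^(beta), unique up to null sets when it exists. *)
Definition deriv_mixed beta f : vecR R s -> R :=
  xget (fun=> 0) [set g | weak_derivative beta f g].

Definition has_mixed_derivatives f : Prop :=
  cube_integrable f /\ forall beta, exists g, weak_derivative beta f g.

End WeakDerivatives.

(* The Bernoulli numbers B_0, ..., B_n, with B_1 = -1/2. *)
Fixpoint bernoulli_numbers (R : fieldType) (n : nat) : seq R :=
  if n is n'.+1 then
    let B := bernoulli_numbers R n' in
    rcons B (- (\sum_(k < n) 'C(n.+1, k)%:R * B`_k) / n.+1%:R)
  else [:: 1].

Definition bernoulli_poly (R : fieldType) (n : nat) : {poly R} :=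
  \poly_(k < n.+1) ('C(n, k)%:R * (bernoulli_numbers R n)`_(n - k)).

Definition b_fun (R : fieldType) (tau : nat) (x : R) : R :=
  (bernoulli_poly R tau).[x] / tau`!%:R.

Definition b_per (R : realType) (alpha : nat) (x : R) : R :=
  b_fun alpha (x - (Num.floor x)%:~R).

Section FunctionSpace.
Context {R : realType} {s : nat}.
Variable alpha : nat.
Implicit Types (f g : vecR R s -> R) (u v : {set 'I_s}) (q r : \bar R).

(* For v \subset u these are the multi-indices (tau_{u\v}, alpha_v, 0) with
   tau_{u\v} ranging over {1, ..., alpha}^(u\v). *)
Definition orders u v : {set {ffun 'I_s -> 'I_alpha.+1}} :=
  [set beta : {ffun 'I_s -> 'I_alpha.+1} |
    [forall j, if j \in v then beta j == alpha :> nat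
               else if j \in u then (0 < beta j)%N
               else beta j == 0%N :> nat]].

Definition splice v (x y : vecR R s) : vecR R s :=
  [tuple (if j \in v then tnth x j else tnth y j) | j < s].

(* The integral of g over the coordinates outside v, at x_v.  The coordinates
   y_v and x_{-v} are dummies: since the unit cube has measure 1, integrating
   over them as well leaves all the integrals and essential suprema below
   unchanged. *)
Definition partial_int v g (x : vecR R s) : R :=
  cube_int (fun y => g (splice v x y)).

(* x / c for nonnegative x and c, with 0/0 = 0 and x/0 = +oo for x > 0. *)
Definition weight_div (x : \bar R) (c : R) : \bar R :=
  if c == 0 then (if x == 0%E then 0%E else +oo%E) else (x * (c^-1)%:E)%E.

Definition inner_sum (q : R) f u : \bar R :=
  (\sum_(v in powerset u) \sum_(beta in orders u v)
     \int[cube_measure s]_x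
       (`|partial_int v (deriv_mixed beta f) x| `^ q)%:E)%E.

Definition inner_sup f u : \bar R :=
  \big[maxe/0%E]_(v in powerset u) \big[maxe/0%E]_(beta in orders u v)
    ess_sup (cube_measure s)
      (fun x => (`|partial_int v (deriv_mixed beta f) x|)%:E).

Variable gamma : {set 'I_s} -> R.

Definition block_norm q f u : \bar R :=
  match q with
  | q'%:E => (weight_div (inner_sum q' f u) (gamma u `^ q') `^ q'^-1)%E
  | _ => weight_div (inner_sup f u) (gamma u)
  end.

Definition sobolev_norm q r f : \bar R :=
  match r with
  | r'%:E => ((\sum_(u : {set 'I_s}) block_norm q f u `^ r') `^ r'^-1)%E
  | _ => \big[maxe/0%E]_(u : {set 'I_s}) block_norm q f u
  end.

Definition component f u (x : vecR R s) : R :=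
  \sum_(v in powerset u) (-1) ^+ (alpha.+1 * #|v|) *
    \sum_(beta in orders u v)
      (\prod_(j in u :\: v) b_fun (beta j) (coord x j)) *
      cube_int (fun y => deriv_mixed beta f y *
        \prod_(j in v) b_per alpha (coord y j - coord x j)).

(* Point values are those of the representation f = sum_u f_u. *)
Definition sobolev_space q r : set (vecR R s -> R) :=
  [set f | [/\ has_mixed_derivatives alpha f,
               (sobolev_norm q r f < +oo)%E &
               forall x, cube R s x ->
                 f x = \sum_(u : {set 'I_s}) component f u x]].

End FunctionSpace.

Definition digit (p k i : nat) : nat := ((k %/ p ^ i) %% p)%N.

(* Positions c_1 > ... > c_v (numbered from 1) of the nonzero digits of k. *)
Definition digit_positions (p k : nat) : seq nat :=
  [seq i.+1 | i <- rev (iota 0 k) & digit p k i != 0%N].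

Definition digit_weight (p alpha k : nat) : nat :=
  sumn (take alpha (digit_positions p k)).

Section DigitalNets.
Context {p s : nat}.

(* [C j i l] is the entry in row i and column l of the j-th generating matrix,
   with rows and columns numbered from 0. *)
Definition gen_matrices := 'I_s -> nat -> nat -> 'F_p.
Implicit Types (C : gen_matrices) (k : 'I_s -> nat).

(* The h-th point of the net generated by the upper-left n x m submatrices. *)
Definition net_point (R : realType) (n m : nat) C (h : nat) : vecR R s :=
  [tuple (\sum_(i < n)
     (nat_of_ord (\sum_(l < m) C j i l * (digit p h l)%:R))%:R / p%:R ^+ i.+1 : R)
   | j < s].

Definition qmc_rule (R : realType) (n m : nat) C (f : vecR R s -> R) : R :=
  (\sum_(h < p ^ m) f (net_point R n m C h)) / (p ^ m)%:R.

(* Dual net for the first m columns with all their rows.  The infinite sum over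
   the row index i stops at i < k j, because digit p (k j) i = 0 for i >= k j. *)
Definition dual_net (m : nat) C k : Prop :=
  forall l, (l < m)%N ->
    \sum_j \sum_(i < k j) C j i l * (digit p (k j) i)%:R = 0.

Definition order_digital_net (alpha t m : nat) C : Prop :=
  (t <= alpha * m)%N /\
  forall k, dual_net m C k -> (exists j, k j != 0%N) ->
    (alpha * m - t < \sum_j digit_weight p alpha (k j))%N.

Definition digital_sequence C : Prop :=
  forall j l, exists n, forall i, (n <= i)%N -> C j i l = 0.

Definition order_digital_sequence (alpha t : nat) C : Prop :=
  digital_sequence C /\
  forall m, (t < alpha * m)%N -> order_digital_net alpha t m C.

(* The first p^m points have precision at most alpha * m, for every m. *)
Definition bounded_precision (alpha : nat) C : Prop :=
  forall j (i l : nat), (alpha * l.+1 < i.+1)%N -> C j i l = 0.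

(* [extrapolation C f tau m] is I^(tau+1)_m(f). *)
Fixpoint extrapolation (R : realType) C (f : vecR R s -> R) (tau m : nat) : R :=
  if tau is tau'.+1 then
    (p%:R ^+ tau * extrapolation C f tau' m.+1 - extrapolation C f tau' m)
      / (p%:R ^+ tau - 1)
  else qmc_rule m m C f.

End DigitalNets.
Arguments gen_matrices : clear implicits.

Definition total_evaluations (p alpha m : nat) : nat :=
  (\sum_(i < alpha) p ^ (m + i))%N.

Definition log_base (R : realType) (p : nat) (x : R) : R := ln x / ln p%:R.

(* Main.v *)
(* Each component of f is a signed sum of integrals over y of a mixed
   derivative g(y) against kappa(x, y), a product of Bernoulli polynomials
   in x_j for j in u \ v and periodic Bernoulli functions of y_j - x_j for j
   in v. All kappa(., y) with u nonempty have integral 0, so the quadrature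
   error of f is minus the integral of g(y) E(y), where E(y) is the
   extrapolated rule applied to kappa(., y). Since E depends on y only
   through y_v, this is at most sup |E| times the L^1 norm of the partial
   integral of g, which the Sobolev norm bounds by gamma_u.

   To bound E(y), expand the product kappa(., y), sampled on the grid of
   step p^(-n) that carries the net, in the finite Walsh system of Z/p^n.
   The average over the net is the sum of the Walsh coefficients over the
   dual net. Summation by parts over the leading digits bounds the
   coefficient at k by a multiple of p^(-mu_alpha(k)), and a count of the
   dual net by leading digits bounds the sum over k <> 0 by a multiple of
   n^(alpha |u|) p^(-alpha n). The coefficient at k = 0 is a product of
   means over the grid. By the multiplication theorem it is a multiple of
   p^(-sigma n) with sigma = sum_j beta_j, if v is empty and sigma < alpha,
   and then the extrapolation annihilates it; otherwise it is O(p^(-alpha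
   n)) already. *)

Require Import Defs.
From mathcomp Require Import all_boot all_order all_algebra.
From mathcomp Require Import all_classical all_reals all_analysis.
From mathcomp Require Import measurable_realfun ess_sup_inf complex ring lra zify.

Set Implicit Arguments.
Unset Strict Implicit.
Unset Printing Implicit Defensive.
Import Order.TTheory GRing.Theory Num.Theory.
Import numFieldNormedType.Exports.
Local Open Scope classical_set_scope.
Local Open Scope ring_scope.

(** * Bernoulli polynomials *)

(** Working with the finite Walsh system of the grid, instead of the infinite Walsh series of the
    kernel, confines the discretization error to the frequency 0, where it is explicit enough for
    the extrapolation to act on it. The price is that smoothness has to be read off from finite
    differences of samples. The obstacle there is the periodic Bernoulli function of degree alpha,
    whose derivative of order alpha - 1 jumps at the integers: on a grid with N points per period, a
    difference of order alpha across an integer is only O(N^(1 - alpha)). But at most alpha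
    differences per period cross an integer, so for every order r up to alpha the bound O(N^-r)
    survives on average over a period, and an average is all that summation by parts needs.

    Truncating the points to m digits does no harm, since a frequency below p^m involves only the
    first m rows of each matrix. Its dual vectors are therefore dual vectors of the untruncated net,
    to which the order alpha condition applies. *)

Section BernoulliPolynomials.
Context {R : realFieldType}.
Local Notation B := (bernoulli_numbers R).
Local Notation bp := (bernoulli_poly R).

Lemma size_bernoulli_numbers n : size (B n) = n.+1.
Proof. by elim: n => //= n IHn; rewrite size_rcons IHn. Qed.

Lemma nth_bernoulli_numbers n k : (k <= n)%N -> (B n)`_k = (B k)`_k.
Proof.
elim: n => [|n IHn]; first by rewrite leqn0 => /eqP ->.
rewrite leq_eqVlt => /orP[/eqP -> //|kn].
by rewrite /= nth_rcons size_bernoulli_numbers kn IHn.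
Qed.

Lemma sum_bernoulli_numbers n : (0 < n)%N ->
  \sum_(k < n.+1) 'C(n.+1, k)%:R * (B k)`_k = 0 :> R.
Proof.
case: n => // n _; rewrite big_ord_recr /= nth_rcons size_bernoulli_numbers.
rewrite ltnn eqxx binSn mulrC divfK ?pnatr_eq0// addrC.
apply/eqP; rewrite addrC subr_eq0; apply/eqP; apply: eq_bigr => k _.
by rewrite [in RHS]nth_bernoulli_numbers// -ltnS.
Qed.

Lemma coef_bernoulli_poly n k :
  (bp n)`_k = 'C(n, k)%:R * (B (n - k))`_(n - k).
Proof.
rewrite coef_poly ltnS; case: leqP => kn; last by rewrite bin_small// mul0r.
by rewrite nth_bernoulli_numbers// leq_subr.
Qed.

Lemma deriv_bernoulli_poly n : (bp n.+1)^`() = n.+1%:R *: bp n.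
Proof.
apply/polyP => k; rewrite coef_deriv coefZ !coef_bernoulli_poly subSS.
by rewrite -[LHS]mulr_natl !mulrA -!natrM -mul_bin_diag.
Qed.

Lemma bernoulli_poly0 : bp 0 = 1.
Proof.
apply/polyP => k; rewrite coef_bernoulli_poly coef1.
by case: k => [|k] /=; rewrite ?mul1r ?bin_small ?mul0r.
Qed.

Lemma horner0_bernoulli_poly n : (bp n).[0] = (B n)`_n.
Proof. by rewrite horner_coef0 coef_bernoulli_poly bin0 mul1r subn0. Qed.

(** Read backwards, the coefficients sum to the expression that the recursion of the Bernoulli
    numbers sets to 0, plus the value at 0. Only in degree 1 is that expression nonzero. *)
Lemma horner1_bernoulli_poly n :
  (bp n.+1).[1] = (bp n.+1).[0] + (n == 0%N)%:R.
Proof.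
rewrite horner0_bernoulli_poly (@horner_coef_wide _ n.+2); last exact: size_poly.
rewrite (reindex_inj rev_ord_inj) /=.
rewrite (eq_bigr (fun k : 'I_n.+2 => 'C(n.+1, k)%:R * (B k)`_k)); last first.
  move=> k _; rewrite expr1n mulr1 coef_bernoulli_poly subSS.
  have kn : (k <= n.+1)%N by rewrite -ltnS.
  by rewrite bin_sub// subKn.
rewrite big_ord_recr /= binn mul1r addrC; congr (_ + _).
case: n => [|n]; last by rewrite sum_bernoulli_numbers.
by rewrite big_ord1 bin0 mul1r.
Qed.

Lemma deriv_eq0_const (q : {poly R}) : q^`() = 0 -> q = (q`_0)%:P.
Proof.
move=> q0; apply/polyP => -[|k]; rewrite coefC//=.
have := congr1 (fun r : {poly R} => r`_k) q0.
by rewrite coef_deriv coef0 => /eqP; rewrite mulrn_eq0 /= => /eqP.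
Qed.

(* A family with q_(n+1)' = (n+1) q_n and q_n(0) = q_n(1) is determined by q_0:
   each q_n is constant once q_(n-1) = 0, and the periodicity of q_(n+1) then
   forces this constant to vanish. *)
Lemma appell_periodic_eq0 (q : nat -> {poly R}) :
  q 0%N = 0 -> (forall n, (q n.+1)^`() = n.+1%:R *: q n) ->
  (forall n, (q n).[1] = (q n).[0]) -> forall n, q n = 0.
Proof.
move=> q0 dq q10; elim=> // n qn.
have /deriv_eq0_const qn1 : (q n.+1)^`() = 0 by rewrite dq qn scaler0.
set c := (q n.+1)`_0 in qn1.
have /deriv_eq0_const qn2 : (q n.+2 - (n.+2%:R * c) *: 'X)^`() = 0.
  by rewrite derivB derivZ derivX dq qn1 alg_polyC -mul_polyC -polyCM subrr.
have: (q n.+2 - (n.+2%:R * c) *: 'X).[1] = (q n.+2 - (n.+2%:R * c) *: 'X).[0].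
  by rewrite qn2 !hornerC.
rewrite !hornerE q10 => /eqP.
rewrite (inj_eq (addrI _)) eqr_opp mulf_eq0 pnatr_eq0 /=.
by rewrite qn1 => /eqP ->.
Qed.

(** The difference of the two sides is again an Appell family, so by induction each member is
    constant; its value at 0 is settled by the jump from 0 to 1. *)
Lemma bernoulli_poly_shift n x :
  (bp n).[x + 1] = (bp n).[x] + n%:R * x ^+ n.-1.
Proof.
pose q n : {poly R} := bp n \Po ('X + 1) - bp n - n%:R *: 'X^(n.-1).
have dX : ('X + 1 : {poly R})^`() = 1 by rewrite derivD derivX derivC addr0.
suff /(congr1 (horner^~ x)) : q n = 0.
  rewrite /q !hornerE horner_comp !hornerE => /eqP.
  by rewrite -addrA -opprD subr_eq0 => /eqP.
have dq k : (q k.+1)^`() = k.+1%:R *: q k.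
  rewrite /q !derivB derivZ derivXn deriv_comp deriv_bernoulli_poly dX mulr1.
  by rewrite comp_polyZ -!scalerBr [k%:R *: _]scaler_nat.
elim: n => [|n IHn].
  by rewrite /q bernoulli_poly0 comp_polyC scale0r subr0 subrr.
have /deriv_eq0_const -> : (q n.+1)^`() = 0 by rewrite dq IHn scaler0.
rewrite -horner_coef0 /q !hornerE horner_comp !hornerE horner1_bernoulli_poly.
case: (n) => [|k]; rewrite ?expr0 ?expr0n /=; ring.
Qed.

(** Raabe's multiplication theorem. Both sides are Appell families with the same start, and from x =
    0 to x = 1 the left one telescopes to the jump of a single Bernoulli polynomial, which the right
    one matches. *)
Lemma bernoulli_poly_mult n N x : (0 < N)%N ->
  \sum_(i < N) (bp n).[(x + i%:R) / N%:R] * N%:R ^+ n = N%:R * (bp n).[x].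
Proof.
move=> N0; have N0' : N%:R != 0 :> R by rewrite pnatr_eq0 -lt0n.
pose l i : {poly R} := N%:R^-1 *: ('X + i%:R%:P).
pose q n : {poly R} := \sum_(i < N) N%:R ^+ n *: (bp n \Po l i) - N%:R *: bp n.
suff /(congr1 (horner^~ x)) : q n = 0.
  rewrite /q hornerD hornerN hornerZ horner0 => /eqP; rewrite subr_eq0 => /eqP <-.
  rewrite horner_sum; apply: eq_bigr => i _.
  by rewrite hornerZ horner_comp /l !hornerE mulrC [_^-1 * _]mulrC.
apply: appell_periodic_eq0 => [|{}n|{}n].
- rewrite /q bernoulli_poly0; under eq_bigr do rewrite comp_polyC expr0 scale1r.
  by rewrite sumr_const card_ord scaler_nat subrr.
- rewrite /q derivB derivZ deriv_bernoulli_poly scalerBr !scalerA.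
  rewrite [n.+1%:R * _]mulrC; congr (_ - _).
  rewrite linear_sum scaler_sumr; apply: eq_bigr => i _ /=.
  rewrite derivZ deriv_comp deriv_bernoulli_poly /l derivZ derivD derivX derivC.
  rewrite addr0 comp_polyZ -scalerAl -scalerAr mulr1 !scalerA; congr (_ *: _).
  by rewrite exprS; field.
- rewrite /q !hornerE !horner_sum.
  have H i : (bp n \Po l i).[1] = (bp n).[i.+1%:R / N%:R].
    by rewrite horner_comp /l !hornerE mulrC -natr1 addrC.
  have H0 i : (bp n \Po l i).[0] = (bp n).[i%:R / N%:R].
    by rewrite horner_comp /l !hornerE mulrC.
  under eq_bigr do rewrite hornerZ H.
  under [in RHS]eq_bigr do rewrite hornerZ H0.
  have -> : \sum_(i < N) N%:R ^+ n * (bp n).[i.+1%:R / N%:R] =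
      \sum_(i < N) N%:R ^+ n * (bp n).[i%:R / N%:R] +
      N%:R ^+ n * ((bp n).[1] - (bp n).[0]).
    apply/eqP; rewrite addrC -subr_eq -sumrB.
    under eq_bigr do rewrite -mulrBr.
    rewrite -mulr_sumr -(big_mkord xpredT
      (fun i => (bp n).[i.+1%:R / N%:R] - (bp n).[i%:R / N%:R])).
    by rewrite telescope_sumr// mul0r divff.
  case: n q H H0 => [|n] q _ _; first by rewrite bernoulli_poly0 !hornerC; ring.
  rewrite horner1_bernoulli_poly; case: n {q} => [|n] /=; ring.
Qed.
End BernoulliPolynomials.

(** * Digits and Walsh functions *)

Section Digits.
Variable p : nat.
Hypothesis p_gt1 : (1 < p)%N.

Let p_gt0 : (0 < p)%N. Proof. exact: ltnW. Qed.

Lemma sum_ord_mul (V : nmodType) (m n : nat) (F : nat -> V) :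
  \sum_(i < m * n) F i = \sum_(i < m) \sum_(j < n) F (i * n + j)%N.
Proof.
elim: m => [|m IHm]; first by rewrite mul0n !big_ord0.
rewrite mulSnr big_split_ord big_ord_recr /= IHm; congr (_ + _).
Qed.

Lemma sum_ord_expS (V : nmodType) n (F : nat -> V) :
  \sum_(i < p ^ n.+1) F i = \sum_(i < p ^ n) \sum_(j < p) F (i * p + j)%N.
Proof. by rewrite -sum_ord_mul expnSr. Qed.

Lemma sum_ord_expSl (V : nmodType) n (F : nat -> V) :
  \sum_(i < p ^ n.+1) F i = \sum_(i < p) \sum_(j < p ^ n) F (i * p ^ n + j)%N.
Proof. by rewrite -sum_ord_mul expnS. Qed.

Local Open Scope nat_scope.

Lemma digitS k i : digit p k i.+1 = digit p (k %/ p) i.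
Proof. by rewrite /digit expnS divnMA. Qed.

Lemma digit_lt k i : (digit p k i < p)%N.
Proof. by rewrite /digit ltn_mod. Qed.

Lemma digit_small k n i : (k < p ^ n)%N -> (n <= i)%N -> digit p k i = 0%N.
Proof.
move=> kn ni; rewrite /digit divn_small ?mod0n//.
by rewrite (leq_trans kn)// leq_pexp2l.
Qed.

Lemma digit_expansion n k : (k < p ^ n)%N ->
  k = (\sum_(i < n) digit p k i * p ^ i)%N.
Proof.
elim: n k => [|n IHn] k; first by rewrite expn0 ltnS leqn0 big_ord0 => /eqP.
move=> kn; rewrite big_ord_recl /= muln1 {1}(divn_eq k p) addnC.
rewrite {1}/digit expn0 divn1; congr (_ + _)%N.
have /IHn -> : (k %/ p < p ^ n)%N by rewrite ltn_divLR// -expnSr.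
rewrite big_distrl /=; apply: eq_bigr => i _.
by rewrite digitS -[in LHS]mulnA -expnSr.
Qed.

Lemma digit_sum n (x : nat -> nat) i : (forall j, (x j < p)%N) -> (i < n)%N ->
  digit p (\sum_(j < n) x j * p ^ j) i = x i.
Proof.
elim: n x i => // n IHn x i xp.
have E : (\sum_(j < n.+1) x j * p ^ j =
          (\sum_(j < n) x j.+1 * p ^ j) * p + x 0)%N.
  rewrite big_ord_recl /= muln1 addnC; congr (_ + _)%N.
  by rewrite big_distrl /=; apply: eq_bigr => j _; rewrite expnSr mulnA.
case: i => [_|i].
  by rewrite /digit expn0 divn1 E modnMDl modn_small.
rewrite ltnS => lin; rewrite digitS E divnMDl// divn_small// addn0.
exact: (IHn (fun j => x j.+1)).
Qed.

Lemma sum_digits_lt n (x : nat -> nat) : (forall j, (x j < p)%N) ->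
  (\sum_(j < n) x j * p ^ j < p ^ n)%N.
Proof.
move=> xp; elim: n => [|n IHn]; first by rewrite big_ord0.
rewrite big_ord_recr /= expnS.
rewrite (leq_trans (_ : _ < p ^ n + x n * p ^ n)%N) ?ltn_add2r//.
by rewrite -mulSn leq_mul2r xp orbT.
Qed.

Definition digit_count k := size (digit_positions p k).

(** The range scanned by [digit_positions] depends on [k]; this freedom in the range is what lets
    [k] and [k %/ p] be compared. *)
Lemma digit_positions_wide n k : (k < p ^ n)%N ->
  digit_positions p k = [seq i.+1 | i <- rev (iota 0 n) & digit p k i != 0%N].
Proof.
move=> kn; rewrite /digit_positions; congr map.
have H a d : (k < p ^ a)%N -> [seq i <- rev (iota 0 (a + d)) | digit p k i != 0%N]
    = [seq i <- rev (iota 0 a) | digit p k i != 0%N].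
  move=> ka; rewrite iotaD rev_cat filter_cat add0n.
  rewrite (_ : [seq i <- rev (iota a d) | _] = [::]) //.
  apply/eqP; rewrite -[_ == _]negbK -has_filter; apply/hasPn => i.
  by rewrite mem_rev mem_iota => /andP[ai _]; rewrite negbK (digit_small ka ai).
have [kl|/ltnW kl] := leqP n k.
  by have := H n (k - n)%N kn; rewrite subnKC.
by have := H k (n - k)%N (ltn_expl _ p_gt1); rewrite subnKC.
Qed.

Lemma digit_positions_rec k :
  digit_positions p k = [seq c.+1 | c <- digit_positions p (k %/ p)] ++
    (if k %% p == 0%N then [::] else [:: 1%N]).
Proof.
have kn : (k < p ^ k)%N by rewrite ltn_expl.
have kn1 : (k < p ^ k.+1)%N by rewrite (ltn_trans kn)// ltn_exp2l.
have kn' : (k %/ p < p ^ k)%N by rewrite ltn_divLR// -expnSr.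
rewrite (digit_positions_wide kn1) (digit_positions_wide kn').
rewrite -[k.+1]add1n iotaD rev_cat filter_cat map_cat; congr (_ ++ _).
  rewrite add0n (iotaDl 1 0) -map_rev filter_map -!map_comp.
  rewrite (eq_filter (_ : _ =1 fun i => digit p (k %/ p) i != 0%N)) //.
  by move=> i /=; rewrite add1n digitS.
by rewrite /= /digit expn0 divn1; case: eqP.
Qed.

Lemma digit_count_rec k :
  digit_count k = (digit_count (k %/ p) + (k %% p != 0))%N.
Proof.
rewrite /digit_count digit_positions_rec size_cat size_map.
by case: eqP.
Qed.

Lemma digit_positions0 : digit_positions p 0 = [::].
Proof. by []. Qed.

(** Appending a lowest digit raises every counted position by one; a nonzero new digit enters at
    position 1 as long as fewer than [alpha] are counted. This is the recursion that Walsh sums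
    follow. *)
Lemma digit_weight_rec alpha k :
  digit_weight p alpha k =
    (digit_weight p alpha (k %/ p) + minn alpha (digit_count k))%N.
Proof.
have S1 (l : seq nat) : sumn [seq c.+1 | c <- l] = (sumn l + size l)%N.
  by elim: l => //= c l ->; lia.
rewrite digit_count_rec /digit_weight digit_positions_rec /digit_count.
set P := digit_positions p _.
rewrite take_cat size_map; case: ltnP => aP.
  rewrite -map_take S1 size_take aP; congr (_ + _)%N; lia.
rewrite sumn_cat S1 (@take_oversize _ alpha P)//.
case: eqP => /=; first by move=> _; lia.
have [->|] := eqVneq alpha (size P); first by rewrite subnn /=; lia.
case E : (alpha - size P)%N => [|d] /=; lia.
Qed.

End Digits.

Section Walsh.
Context {R : realType}.
Local Notation normc := (@Normc.normc R).

Lemma normc_real (x : R) : normc x%:C%C = `|x|.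
Proof. by rewrite /= expr0n addr0 sqrtr_sqr. Qed.

Lemma normc_sum (I : Type) (r : seq I) (P : pred I) (F : I -> R[i]) :
  normc (\sum_(i <- r | P i) F i) <= \sum_(i <- r | P i) normc (F i).
Proof.
elim/big_ind2: _ => //; first by rewrite Normc.normc0.
by move=> x a y b xa yb; apply: le_trans (lerD xa yb); exact: le_normcD.
Qed.

Lemma normcX (z : R[i]) n : normc (z ^+ n) = normc z ^+ n.
Proof.
elim: n => [|n IHn]; first by rewrite !expr0 Normc.normc1.
by rewrite !exprS Normc.normcM IHn.
Qed.

Lemma normc_prod (I : Type) (r : seq I) (P : pred I) (F : I -> R[i]) :
  normc (\prod_(i <- r | P i) F i) = \prod_(i <- r | P i) normc (F i).
Proof.
elim/big_ind2: _ => //; first by rewrite Normc.normc1.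
by move=> x a y b <- <-; rewrite Normc.normcM.
Qed.

Lemma normc_ge0 (z : R[i]) : 0 <= normc z.
Proof. by case: z => a b; exact: sqrtr_ge0. Qed.

(** A root of 1 + X + ... + X^(p-1) has order dividing p, and the order is not 1 because the value
    of this polynomial at 1 is p. *)
Lemma prime_prim_root_exists p : prime p -> exists w : R[i], p.-primitive_root w.
Proof.
move=> pp; have p1 := prime_gt1 pp; have p0 := prime_gt0 pp.
pose q : {poly R[i]} := \poly_(i < p) 1.
have : size q != 1%N by rewrite size_poly_eq ?oner_eq0// neq_ltn p1 orbT.
case/closed_rootP => w; rewrite /root horner_poly => /eqP qw.
have wp : w ^+ p = 1.
  apply/eqP; rewrite -subr_eq0 subrX1 (eq_bigr (fun i : 'I_p => 1 * w ^+ i)).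
    by rewrite qw mulr0.
  by move=> i _; rewrite mul1r.
have [m wm mp] := prim_order_exists p0 wp; exists w.
case/primeP: pp => _ /(_ m mp) /orP[/eqP m1|/eqP <- //].
move: wm qw; rewrite m1 => /prim_expr_order; rewrite expr1 => -> /eqP.
under eq_bigr do rewrite expr1n mul1r.
by rewrite sumr_const card_ord pnatr_eq0 eqn0Ngt p0.
Qed.

Variable p : nat.
Hypothesis p_prime : prime p.
Variable w : R[i].
Hypothesis w_prim : p.-primitive_root w.

Let p_gt1 : (1 < p)%N. Proof. exact: prime_gt1. Qed.
Let p_gt0 : (0 < p)%N. Proof. exact: prime_gt0. Qed.

Let wp : w ^+ p = 1. Proof. exact: prim_expr_order. Qed.

Let w_neq0 : w != 0.
Proof.
apply/eqP => w0; move/eqP: wp; rewrite w0 expr0n gtn_eqF// eq_sym.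
by rewrite oner_eq0.
Qed.

Lemma normc_root : normc w = 1.
Proof.
apply/eqP; rewrite -(@pexpr_eq1 _ _ p) ?normc_ge0//.
by rewrite -normcX wp Normc.normc1.
Qed.

(* The k-th Walsh function at a / p^n. *)
Fixpoint walsh n (k a : nat) : R[i] :=
  if n is n'.+1 then
    w ^+ ((k %% p) * (a %/ p ^ n'))%N * walsh n' (k %/ p)%N (a %% p ^ n')%N
  else 1.
Local Arguments walsh (n k a)%_nat_scope.

Lemma walsh0 n a : walsh n 0 a = 1.
Proof.
by elim: n a => //= n IHn a; rewrite mod0n mul0n expr0 div0n IHn mul1r.
Qed.

(** The lowest digit of [k] meets the highest digit of the numerator, that is, the first digit of
    the point a / p^n after the radix point. *)
Lemma walsh_cons n k d b : (b < p ^ n)%N ->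
  walsh n.+1 k (d * p ^ n + b)%N = w ^+ (k %% p * d) * walsh n (k %/ p)%N b.
Proof.
move=> bn /=; have pn : (0 < p ^ n)%N by rewrite expn_gt0 p_gt0.
by rewrite divnMDl// (divn_small bn) addn0 modnMDl (modn_small bn).
Qed.

Lemma sum_walsh1 a b : (a < p)%N -> (b < p)%N ->
  \sum_(k < p) w ^+ (k * a) * (w ^+ (k * b))^-1 = (p * (a == b))%:R.
Proof.
move=> ap bp; set z := w ^+ a * (w ^+ b)^-1.
rewrite (eq_bigr (fun k : 'I_p => z ^+ k)); last first.
  by move=> k _; rewrite /z exprMn exprVn -!exprM ![(k * _)%N]mulnC.
have [ab|ab] := eqVneq a b.
  rewrite muln1 (eq_bigr (fun=> 1)) ?sumr_const ?card_ord//.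
  by move=> k _; rewrite /z ab divff ?expf_neq0// expr1n.
have z1 : z != 1.
  apply: contra_neq ab => /eqP; rewrite /z -(inj_eq (mulIf (expf_neq0 b w_neq0))).
  rewrite mulfVK ?expf_neq0// mul1r (eq_prim_root_expr w_prim).
  by rewrite !modn_small// => /eqP.
have zp : z ^+ p = 1 by rewrite /z exprMn exprVn -!exprM ![(_ * p)%N]mulnC
  !exprM wp !expr1n invr1 mulr1.
rewrite muln0; apply/eqP; move/eqP: zp; rewrite -subr_eq0 subrX1 mulf_eq0.
by rewrite subr_eq0 (negPf z1).
Qed.

Lemma sum_walsh n a b : (a < p ^ n)%N -> (b < p ^ n)%N ->
  \sum_(k < p ^ n) walsh n k a * (walsh n k b)^-1 = (p ^ n * (a == b))%:R.
Proof.
elim: n a b => [|n IHn] a b.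
  by rewrite !expn0 !ltnS !leqn0 => /eqP -> /eqP ->; rewrite big_ord1 mul1n /= invr1 mulr1.
have pn : (0 < p ^ n)%N by rewrite expn_gt0 p_gt0.
move=> an bn.
rewrite (@sum_ord_expS p _ _ (fun k => walsh n.+1 k a *
  (walsh n.+1 k b)^-1)).
rewrite (eq_bigr (fun k : 'I_(p ^ n) => (p * ((a %/ p ^ n)%N == (b %/ p ^ n)%N))%:R *
  (walsh n k (a %% p ^ n) * (walsh n k (b %% p ^ n))^-1))); last first.
  move=> k _; rewrite -sum_walsh1 ?ltn_divLR -?expnS//.
  rewrite mulr_suml; apply: eq_bigr => j _ /=.
  rewrite modnMDl divnMDl// (divn_small (ltn_ord j)) addn0 (modn_small (ltn_ord j)).
  by rewrite invfM mulrACA.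
rewrite -mulr_sumr IHn ?ltn_mod// -natrM; congr _%:R.
rewrite mulnACA -expnS; congr (_ * _)%N; rewrite mulnb; congr nat_of_bool.
apply/andP/eqP => [[/eqP d /eqP m]|-> //].
by rewrite (divn_eq a (p ^ n)) d m -divn_eq.
Qed.

(** Walsh values are powers of a root of unity, so the inverse serves as the complex conjugate. *)
Definition walsh_sum n k (F : nat -> R) : R[i] :=
  \sum_(a < p ^ n) (F a)%:C%C * (walsh n k a)^-1.

Lemma walsh_inversion n (F : nat -> R) a : (a < p ^ n)%N ->
  (F a)%:C%C = \sum_(k < p ^ n) walsh_sum n k F / (p ^ n)%:R * walsh n k a.
Proof.
move=> an; have pn : (p ^ n)%:R != 0 :> R[i].
  by rewrite pnatr_eq0 -lt0n expn_gt0 p_gt0.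
under eq_bigr do rewrite /walsh_sum mulrAC mulr_suml mulr_suml.
rewrite exchange_big /=.
under eq_bigr => b _.
  under eq_bigr do rewrite -mulrA -mulrA [X in _ * X]mulrA -[_^-1 * _]mulrC.
  rewrite -mulr_sumr -mulr_suml sum_walsh//.
  over.
rewrite (bigD1 (Ordinal an)) //= eqxx muln1 divff// mulr1 big1 ?addr0// => b ba.
rewrite (_ : (a == b) = false) ?muln0 ?mul0r ?mulr0//.
by apply: contra_neqF ba => /eqP ab; apply: val_inj.
Qed.

End Walsh.

(** * Summation by parts for Walsh sums *)

Section WalshDecay.
Context {R : realType}.
Implicit Types F : nat -> R.
Local Notation normc := (@Normc.normc R).

Definition fdiff F a := F a.+1 - F a.

Lemma iter_fdiff_shift r F c a :
  iter r fdiff (fun b => F (c + b)%N) a = iter r fdiff F (c + a)%N.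
Proof. by elim: r a => //= r IHr a; rewrite /fdiff !IHr addnS. Qed.

Lemma sum_fdiff F c a : F (c + a)%N - F a = \sum_(e < c) fdiff F (e + a)%N.
Proof.
elim: c => [|c IHc]; first by rewrite big_ord0 subrr.
by rewrite big_ord_recr -IHc /fdiff /= addSn; ring.
Qed.

Variables (p : nat) (w : R[i]).
Hypotheses (p_prime : prime p) (w_prim : p.-primitive_root w).

Let p_gt1 : (1 < p)%N. Proof. exact: prime_gt1. Qed.
Let p_gt0 : (0 < p)%N. Proof. exact: prime_gt0. Qed.

Lemma walsh_sum_sum n k c (G : nat -> nat -> R) :
  walsh_sum p w n k (fun a => \sum_(e < c) G e a) =
  \sum_(e < c) walsh_sum p w n k (G e).
Proof.
rewrite /walsh_sum exchange_big; apply: eq_bigr => a _ /=.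
by rewrite rmorph_sum mulr_suml.
Qed.

Lemma walsh_sumB n k F G :
  walsh_sum p w n k (fun a => F a - G a) = walsh_sum p w n k F - walsh_sum p w n k G.
Proof.
by rewrite /walsh_sum -sumrB; apply: eq_bigr => a _; rewrite rmorphB mulrBl.
Qed.

Lemma walsh_sum_rec n k F : walsh_sum p w n.+1 k F =
  \sum_(d < p) (w ^+ (k %% p * d))^-1 *
    walsh_sum p w n (k %/ p)%N (fun b => F (d * p ^ n + b)%N).
Proof.
rewrite /walsh_sum (@sum_ord_expSl p _ _ (fun a => (F a)%:C%C * (walsh p w n.+1 k a)^-1)).
apply: eq_bigr => d _; rewrite mulr_sumr; apply: eq_bigr => b _.
by rewrite walsh_cons// invfM mulrCA.
Qed.

(* The nonzero digits of k counted by the weight, at most alpha of them, each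
   turn a sum over one digit of a into a difference. *)
Lemma walsh_sum_bound alpha n k : (k < p ^ n)%N -> exists L : seq nat,
  [/\ (size L * p ^ digit_weight p alpha k <=
         p ^ ((2 + n) * minn alpha (digit_count p k)))%N,
      {in L, forall l, (l <= alpha * p ^ n)%N} &
      forall F, normc (walsh_sum p w n k F) <=
        \sum_(l <- L) \sum_(b < p ^ n)
          `|iter (minn alpha (digit_count p k)) fdiff F (l + b)%N| ].
Proof.
(* The induction needs the offsets bounded through the actual order of the difference, since each
   new order adds one more p^n to them. *)
suff H : (k < p ^ n)%N -> exists L : seq nat,
  [/\ (size L * p ^ digit_weight p alpha k <=
         p ^ ((2 + n) * minn alpha (digit_count p k)))%N,
      {in L, forall l, (l <= minn alpha (digit_count p k) * p ^ n)%N} &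
      forall F, normc (walsh_sum p w n k F) <=
        \sum_(l <- L) \sum_(b < p ^ n)
          `|iter (minn alpha (digit_count p k)) fdiff F (l + b)%N| ].
  move=> /H[L [L1 L2 L3]]; exists L; split=> // l /L2 /leq_trans; apply.
  by rewrite leq_mul2r geq_minl orbT.
elim: n k => [|n IHn] k.
  rewrite expn0 ltnS leqn0 => /eqP ->; exists [:: 0%N].
  rewrite /digit_weight /digit_count digit_positions0 minn0 /=; split=> //.
  - by move=> l; rewrite inE => /eqP ->.
  - move=> F; rewrite big_seq1 big_ord1 /walsh_sum big_ord1 /walsh invr1 mulr1.
    by rewrite normc_real.
move=> kn; have kn' : (k %/ p < p ^ n)%N by rewrite ltn_divLR// -expnSr.
have [L [L1 L2 L3]] := IHn _ kn'.
have wdn d : normc (w ^+ (k %% p * d))^-1 = 1.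
  by rewrite Normc.normcV normcX (normc_root p_prime w_prim) expr1n invr1.
rewrite (digit_weight_rec p_gt1).
(* In the first case the lowest digit is zero or [alpha] digits are counted already: the triangle
   inequality over d suffices, and the p windows join into one of length p^(n+1). In the second case
   one more difference must be gained. *)
have [Er|[Er kp]] : minn alpha (digit_count p k) = minn alpha (digit_count p (k %/ p)) \/
   minn alpha (digit_count p k) = (minn alpha (digit_count p (k %/ p))).+1 /\
   (k %% p != 0)%N.
  by rewrite (digit_count_rec p_gt1 k); case: eqP => _ /=; lia.
  rewrite Er; set r := minn _ (digit_count p (k %/ p)) in Er L1 L2 L3 *; exists L; split.
  - by rewrite expnD mulnA addnS mulSn addnC expnD leq_mul2r L1 orbT.
  - move=> l /L2 /leq_trans; apply; rewrite leq_mul2l leq_exp2l// leqnSn.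
    by rewrite orbT.
  move=> F; rewrite walsh_sum_rec; apply: le_trans (normc_sum _ _ _) _.
  under eq_bigr do rewrite Normc.normcM wdn mul1r.
  under [leRHS]eq_bigr do
    rewrite (@sum_ord_expSl p _ n (fun b => `|iter r fdiff F (_ + b)%N|)).
  rewrite [leRHS]exchange_big; apply: ler_sum => d _ /=.
  apply: le_trans (L3 _) _; apply: ler_sum => l _; apply: ler_sum => b _.
  by rewrite iter_fdiff_shift addnCA.
rewrite Er; set r := minn _ (digit_count p (k %/ p)) in Er L1 L2 L3 *.
(* The offsets e of the telescoping sum of F(d p^n + b) - F(b), for all d < p. There are at most p *
   p^(n+1) of them, whence the 2 in the exponent (2 + n) r. *)
pose E := flatten [seq iota 0 (d * p ^ n) | d <- iota 0 p].
exists [seq (l + e)%N | l <- L, e <- E]; split.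
- have sE : (size E <= p * p ^ n.+1)%N.
    rewrite size_flatten /shape -map_comp sumnE big_map.
    rewrite (@leq_trans (\sum_(d <- iota 0 p) p ^ n.+1)%N) //; last first.
      by rewrite big_const_seq count_predT size_iota iter_addn_0 mulnC.
    rewrite big_seq [leqRHS]big_seq leq_sum// => d; rewrite mem_iota /= => dp.
    by rewrite size_iota expnS leq_mul2r ltnW ?orbT.
  rewrite size_allpairs expnD mulnACA mulnCA.
  rewrite (leq_trans (_ : _ <= (p * p ^ n.+1) * (p ^ ((2 + n) * r) * p ^ r.+1))%N)//.
    by rewrite leq_mul// leq_mul2r L1 orbT.
  by rewrite -expnS -!expnD leq_exp2l//; lia.
- move=> l /allpairsP[[l' e] /= [/L2 l'L /flattenP[x /mapP[d]]]].
  rewrite mem_iota /= add0n => dp -> ; rewrite mem_iota add0n /= => ed ->.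
  rewrite mulSn addnC leq_add//.
    rewrite (leq_trans (ltnW ed))// expnS leq_mul2r ltnW ?orbT//.
  by rewrite (leq_trans l'L)// leq_mul2l leq_exp2l// leqnSn orbT.
move=> F.
(* The term F(b) may be subtracted because it does not depend on d and the character of a nonzero
   digit sums to 0 over d. *)
have -> : walsh_sum p w n.+1 k F = \sum_(d < p) (w ^+ (k %% p * d))^-1 *
    walsh_sum p w n (k %/ p)%N (fun b => F (d * p ^ n + b)%N - F b).
  rewrite walsh_sum_rec; apply/eqP; rewrite -subr_eq0 -sumrB.
  under eq_bigr do rewrite walsh_sumB mulrBr opprB addrC subrK.
  rewrite -mulr_suml mulf_eq0; apply/orP; left.
  have kp' : (k %% p < p)%N by rewrite ltn_mod.
  have := sum_walsh1 p_prime w_prim p_gt0 kp'; rewrite eq_sym (negPf kp) muln0 => H.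
  apply/eqP; rewrite -[RHS]/(0%:R) -H.
  by apply: eq_bigr => d _; rewrite muln0 expr0 mul1r mulnC.
apply: le_trans (normc_sum _ _ _) _.
under eq_bigr do rewrite Normc.normcM wdn mul1r.
rewrite big_allpairs_dep exchange_big /= /E big_flatten /= big_map.
have iotaE c (G : nat -> R) : \sum_(i <- iota 0 c) G i = \sum_(i < c) G i.
  by rewrite -(big_mkord xpredT) /index_iota subn0.
rewrite iotaE.
apply: ler_sum => d _.
rewrite (_ : walsh_sum _ _ _ _ _ = walsh_sum p w n (k %/ p)%N
   (fun b => \sum_(e < d * p ^ n) fdiff F (e + b)%N)); last first.
  by congr walsh_sum; apply/funext => b; rewrite sum_fdiff.
rewrite (@walsh_sum_sum _ _ _ (fun e b => fdiff F (e + b)%N)); apply: le_trans (normc_sum _ _ _) _.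
rewrite iotaE.
apply: ler_sum => e _; apply: le_trans (L3 _) _; apply: ler_sum => l _.
apply: (@le_trans _ _ (\sum_(b < p ^ n) `|iter r.+1 fdiff F (l + e + b)%N|)).
  apply: ler_sum => b _; rewrite iter_fdiff_shift iterSr addnA.
  by rewrite [(e + l)%N]addnC.
rewrite (@sum_ord_expSl p _ _ (fun b => `|iter r.+1 fdiff F (l + e + b)%N|)).
rewrite (bigD1 (Ordinal p_gt0)) //= -[leLHS]addr0 lerD//; last first.
  by rewrite sumr_ge0// => ? _; rewrite sumr_ge0.
Qed.

End WalshDecay.

(** * Decay of Walsh coefficients of sampled smooth functions *)

Section SmoothSamples.
Context {R : realType}.
Implicit Types (F : nat -> R) (f : R -> R).

Lemma iter_fdiffD r F G a :
  iter r fdiff (fun b => F b + G b) a = iter r fdiff F a + iter r fdiff G a.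
Proof. by elim: r a => //= r IHr a; rewrite /fdiff !IHr; ring. Qed.

Lemma iter_fdiff_bound r F a c : (forall j, (j <= r)%N -> `|F (a + j)%N| <= c) ->
  `|iter r fdiff F a| <= 2 ^+ r * c.
Proof.
elim: r a => [|r IHr] a Fc; first by have := Fc 0%N; rewrite addn0 mul1r; exact.
rewrite /= /fdiff exprS -mulrA mulr2n mulrDl mul1r.
apply: le_trans (ler_normB _ _) _; apply: lerD; apply: IHr => j jr.
  by rewrite addSnnS; exact: Fc.
by apply: Fc; rewrite leqW.
Qed.

Definition hdiff (h : R) f x := f (x + h) - f x.

Lemma iter_hdiff_sample r (h t : R) f a :
  iter r fdiff (fun b => f ((t + b%:R) * h)) a =
  iter r (hdiff h) f ((t + a%:R) * h).
Proof.
elim: r a => //= r IHr a; rewrite /fdiff /hdiff !IHr.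
by rewrite -natr1 addrA [in X in X - _]mulrDl mul1r.
Qed.

Lemma iter_hdiff_sum r (h : R) n (g : nat -> R -> R) (c : nat -> R) x :
  iter r (hdiff h) (fun y => \sum_(i < n) c i * g i y) x =
  \sum_(i < n) c i * iter r (hdiff h) (g i) x.
Proof.
elim: r x => //= r IHr x; rewrite /hdiff !IHr -sumrB.
by apply: eq_bigr => i _; rewrite mulrBr.
Qed.

Lemma poly_bounded (q : {poly R}) A : exists2 c : R, 0 <= c &
  forall x, 0 <= x <= A -> `|q.[x]| <= c.
Proof.
exists (\sum_(i < size q) `|q`_i| * `|A| ^+ i).
  by rewrite sumr_ge0// => i _; rewrite mulr_ge0// exprn_ge0.
move=> x /andP[x0 xA]; rewrite horner_coef; apply: le_trans (ler_norm_sum _ _ _) _.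
apply: ler_sum => i _; rewrite normrM ler_wpM2l// normrX lerXn2r ?nnegrE//.
by rewrite (ger0_norm x0) (le_trans xA)// ler_norm.
Qed.

(** Taylor expansion writes q(x + h) - q(x) as a combination of the normalized derivatives at x with
    coefficients h^i, i > 0, so one difference gains one factor h. Everything is evaluated at x,
    hence nothing is asked of x + r h. *)
Lemma poly_hdiff_bound A r (q : {poly R}) : exists2 c : R, 0 <= c &
  forall x h, 0 <= x <= A -> 0 <= h <= 1 ->
    `|iter r (hdiff h) (horner q) x| <= c * h ^+ r.
Proof.
elim: r q => [|r IHr] q.
  have [c c0 H] := poly_bounded q A; exists c => // x h xA _.
  by rewrite mulr1; exact: H.
have /choice[c H] : forall i, exists c : R, 0 <= c /\
    forall x h, 0 <= x <= A -> 0 <= h <= 1 ->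
    `|iter r (hdiff h) (horner q^`N(i)) x| <= c * h ^+ r.
  by move=> i; have [c c0 H] := IHr q^`N(i); exists c.
exists (\sum_(i < size q) c i).
  by rewrite sumr_ge0// => i _; have [] := H i.
move=> x h xA h01; have /andP[h0 h1] := h01; rewrite iterSr.
pose e (i : nat) := if i == 0%N then 0 else h ^+ i.
have -> : hdiff h (horner q) = fun y => \sum_(i < size q) e i * q^`N(i).[y].
  apply/funext => y; rewrite /hdiff nderiv_taylor; last exact: mulrC.
  case: (size q) (size_poly_eq0 q) => [/esym/eqP ->|n _].
    by rewrite !big_ord0 horner0 subrr.
  rewrite !big_ord_recl /e /= expr0 mulr1 nderivn0 mul0r add0r addrC addKr.
  by apply: eq_bigr => i _; rewrite mulrC.
rewrite (@iter_hdiff_sum _ _ _ (fun i => horner q^`N(i)) e).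
apply: le_trans (ler_norm_sum _ _ _) _; rewrite mulr_suml.
apply: ler_sum => i _; rewrite normrM; have [ci0 Hi] := H i.
rewrite /e; case: eqP => i0; first by rewrite normr0 mul0r mulr_ge0// exprn_ge0.
rewrite normrX (ger0_norm h0) exprS mulrCA; apply: ler_pM; rewrite ?exprn_ge0//.
  case: {Hi ci0} i i0 => -[//|i] /= _ _; rewrite exprS ler_piMr//.
  by rewrite exprn_ile1.
exact: Hi.
Qed.

(* The r-th differences of F are O(N^-r) on average over any window of length N,
   as if F sampled a smooth function with step 1/N. *)
Definition smooth_samples (alpha : nat) (c : R) (N : nat) F : Prop :=
  forall r l, (r <= alpha)%N -> (l <= alpha * N)%N ->
    \sum_(b < N) `|iter r fdiff F (l + b)%N| <= c * N%:R / N%:R ^+ r.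

(** A window starts at alpha N at the latest and has length N, so the arguments stay in
    [0, alpha + 1]. *)
Lemma smooth_samples_poly alpha (q : {poly R}) : exists2 c : R, 0 <= c &
  forall N, (0 < N)%N -> smooth_samples alpha c N (fun a => q.[a%:R / N%:R]).
Proof.
have /choice[c H] : forall r, exists c : R, 0 <= c /\
    forall x h, 0 <= x <= alpha.+1%:R -> 0 <= h <= 1 ->
    `|iter r (hdiff h) (horner q) x| <= c * h ^+ r.
  by move=> r; have [c c0 H] := poly_hdiff_bound alpha.+1%:R r q; exists c.
exists (\sum_(r < alpha.+1) c r).
  by rewrite sumr_ge0// => i _; have [] := H i.
move=> N N0 r l ra la; have N0' : 0 < N%:R :> R by rewrite ltr0n.
have [cr0 Hr] := H r.
rewrite (@le_trans _ _ (\sum_(b < N) c r / N%:R ^+ r))//.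
  apply: ler_sum => b _.
  rewrite (_ : (fun a => _) = (fun a => horner q ((0 + a%:R) * N%:R^-1))); last first.
    by apply/funext => a; rewrite add0r.
  rewrite iter_hdiff_sample -exprVn; apply: Hr.
    rewrite add0r divr_ge0 ?ler0n//= ler_pdivrMr// -natrM ler_nat mulSn addnC.
    by rewrite leq_add// ltnW.
  by rewrite invr_ge0 ler0n/= invf_le1// ler1n.
rewrite sumr_const card_ord -[leLHS]mulr_natr mulrAC.
rewrite ler_wpM2r ?invr_ge0 ?exprn_ge0 ?ler0n// ler_wpM2r ?ler0n//.
rewrite (bigD1 (Ordinal (ra : (r < alpha.+1)%N)))//= lerDl sumr_ge0// => i _.
by have [] := H i.
Qed.

Lemma sum_periodic N (g : nat -> R) c : (forall i, g (N + i)%N = g i) ->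
  \sum_(b < N) g (c + b)%N = \sum_(b < N) g b.
Proof.
move=> gN; elim: c => //= c <-.
case: N gN => [|N] gN; first by rewrite !big_ord0.
rewrite big_ord_recr [RHS]big_ord_recl /= addrC addn0 addSnnS addnC gN.
by congr (_ + _); apply: eq_bigr => i _; rewrite addSnnS.
Qed.

End SmoothSamples.

Section BernoulliSamples.
Context {R : realType}.

Definition b_poly tau : {poly R} := tau`!%:R^-1 *: bernoulli_poly R tau.

Lemma b_polyE tau x : b_fun tau x = (b_poly tau).[x].
Proof. by rewrite /b_fun hornerZ mulrC. Qed.

Lemma b_perDz tau (x : R) (z : int) : b_per tau (x + z%:~R) = b_per tau x.
Proof.
rewrite /b_per floorDrz ?intr_int// intrKfloor; congr b_fun.
by rewrite intrD opprD; ring.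
Qed.

Lemma b_per_itv tau (x : R) : 0 <= x < 1 -> b_per tau x = b_fun tau x.
Proof. by move=> x01; rewrite /b_per (@floor_def _ _ 0) ?subr0. Qed.

Lemma b_fun1 tau : (1 < tau)%N -> b_fun tau 1 = b_fun tau 0 :> R.
Proof.
case: tau => [//|[//|tau]] _.
by rewrite /b_fun horner1_bernoulli_poly addr0.
Qed.

Lemma b_perN_itv tau (x : R) : (1 < tau)%N -> 0 <= x < 1 ->
  b_per tau (- x) = b_fun tau (1 - x).
Proof.
move=> tau1 /andP[]; rewrite le_eqVlt => /predU1P[<- _|x0 x1].
  by rewrite oppr0 addr0 b_per_itv ?lexx ?ltr01// b_fun1.
rewrite -(b_perDz _ _ 1) b_per_itv 1?addrC//; lra.
Qed.

Lemma b_per_bounded tau : exists2 c : R, 0 <= c & forall x : R, `|b_per tau x| <= c.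
Proof.
have [c c0 H] := poly_bounded (b_poly tau) 1; exists c => // x.
rewrite /b_per b_polyE; apply: H.
have := ge_floor x; have := floorD1_gt x; rewrite intrD; lra.
Qed.

(** Measures the mismatch between two neighbouring arcs of the periodic function at distance x from
    their common endpoint. *)
Lemma b_fun_shift tau (x : R) :
  `|b_fun tau (x + 1) - b_fun tau x| <= `|x| ^+ tau.-1.
Proof.
rewrite /b_fun bernoulli_poly_shift -mulrBl addrC addKr normrM normrM normrX.
rewrite mulrAC ler_piMl ?exprn_ge0// !ger0_norm ?invr_ge0 ?ler0n//.
rewrite ler_pdivrMr ?mul1r ?ltr0n ?fact_gt0// ler_nat.
by case: tau => // tau; rewrite factS leq_pmulr// fact_gt0.
Qed.

Lemma b_fun_mult tau N (x : R) : (0 < N)%N ->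
  (\sum_(i < N) b_fun tau ((x + i%:R) / N%:R)) / N%:R =
  b_fun tau x / N%:R ^+ tau.
Proof.
move=> N0; have N0' : N%:R != 0 :> R by rewrite pnatr_eq0 -lt0n.
rewrite /b_fun -mulr_suml.
have := bernoulli_poly_mult tau x N0; rewrite -mulr_suml => H.
have -> : (bernoulli_poly R tau).[x] = (\sum_(i < N)
  (bernoulli_poly R tau).[(x + i%:R) / N%:R]) * N%:R ^+ tau / N%:R.
  by rewrite H mulrAC divff// mul1r.
have f0 : tau`!%:R != 0 :> R by rewrite pnatr_eq0 -lt0n fact_gt0.
move: (expf_neq0 tau N0') => e0; move: (_ ^+ tau) e0 => e e0.
by move: (\sum_(i < N) _) => S; field; rewrite f0 e0 N0'.
Qed.

(* On the grid of step 1/N the function b_per tau (y - .) runs through the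
   samples of a single polynomial arc, up to a cyclic shift. *)
Lemma b_per_samples tau N (y : R) : (1 < tau)%N -> (0 < N)%N ->
  exists (th : R) (c : nat), 0 <= th < 1 /\
    let G i := b_per tau (- ((th + i%:R) / N%:R)) in
    [/\ forall a, b_per tau (y - a%:R / N%:R) = G (c + a)%N,
        forall i, G (N + i)%N = G i &
        forall i, (i < N)%N -> G i = b_fun tau (1 - (th + i%:R) / N%:R)].
Proof.
move=> tau1 N0; have N0' : N%:R != 0 :> R by rewrite pnatr_eq0 -lt0n.
(* y - a/N = -(x + a)/N. The integer part of x, reduced mod N, becomes the cyclic shift, and the
   fractional part [th] is the offset of the grid. *)
pose x := - (y * N%:R); pose th := x - (Num.floor x)%:~R.
pose z := Num.floor x.
have th01 : 0 <= th < 1.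
  have := ge_floor x; have := floorD1_gt x; rewrite intrD /th; lra.
have zN : (0 <= z %% N)%Z by rewrite modz_ge0// eqz_nat -lt0n.
exists th, `|(z %% N)%Z|%N; split=> //; split.
- move=> a.
  rewrite -(b_perDz _ _ (z %/ N)%Z) natrD; congr b_per.
  have -> : `|(z %% N)%Z|%:R = (z %% N)%Z%:~R :> R by rewrite -[in RHS](gez0_abs zN).
  have -> : th = x - ((z %/ N)%Z%:~R * N%:R + (z %% N)%Z%:~R).
    by rewrite /th -/z {1}(divz_eq z N) intrD intrM.
  by rewrite /x; field.
- move=> i; rewrite -[RHS](b_perDz _ _ (-1)) natrD; congr b_per.
  by rewrite mulrNz; field.
- move=> i iN; apply: b_perN_itv => //; apply/andP; split.
    by case/andP: th01 => th0 _; rewrite (divr_ge0 (addr_ge0 th0 (ler0n _ _)))// ler0n.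
  rewrite ltr_pdivrMr ?ltr0n// mul1r.
  have : i.+1%:R <= N%:R :> R by rewrite ler_nat.
  rewrite -natr1; lra.
Qed.

(** Read backwards, the samples of one arc are at (1 - th + i)/N, so the multiplication theorem
    gives their mean exactly. *)
Lemma b_per_mean tau : (1 < tau)%N -> exists2 c : R, 0 <= c &
  forall N (y : R), (0 < N)%N ->
    `|(\sum_(a < N) b_per tau (y - a%:R / N%:R)) / N%:R| <= c / N%:R ^+ tau.
Proof.
move=> tau1; have [c c0 H] := poly_bounded (b_poly tau) 1; exists c => // N y N0.
have [th [s [th01 [GE GN Gf]]]] := b_per_samples y tau1 N0.
under eq_bigr do rewrite GE.
rewrite (sum_periodic _ GN) (eq_bigr _ (fun i _ => Gf _ (ltn_ord i))).
rewrite (reindex_inj rev_ord_inj) /=.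
have N0' : N%:R != 0 :> R by rewrite pnatr_eq0 -lt0n.
rewrite (eq_bigr (fun i : 'I_N => b_fun tau ((1 - th + i%:R) / N%:R))); last first.
  by move=> i _; congr b_fun; rewrite natrB// -natr1; field.
rewrite b_fun_mult// normrM normfV [`|_ ^+ tau|]ger0_norm ?exprn_ge0 ?ler0n//.
rewrite ler_wpM2r ?invr_ge0 ?exprn_ge0 ?ler0n// b_polyE H//; lra.
Qed.

(** For M = N: at most r of the N differences of order r in a period reach beyond its end. *)
Lemma sum_tail_count N M r : (\sum_(b < M) (N <= b + r) <= M + r - N)%N.
Proof.
elim: M => [|M IHM]; first by rewrite big_ord0.
rewrite big_ord_recr /= (leq_trans (leq_add IHM (leqnn _)))//.
by case: leqP => /= H; lia.
Qed.

(** By periodicity the window may be taken to be a full arc. Continue the arc as the polynomial q: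
    differences of q are of order N^-r, and the defect [E] lives on the at most alpha samples past
    the end, within distance alpha/N of the breakpoint, where it is at most (alpha/N)^(alpha-1). *)
Lemma smooth_samples_b_per alpha : (1 < alpha)%N -> exists2 c : R, 0 <= c &
  forall N (y : R), (0 < N)%N ->
    smooth_samples alpha c N (fun a => b_per alpha (y - a%:R / N%:R)).
Proof.
move=> alpha1; have [M M0 HM] := b_per_bounded alpha.
pose q := b_poly alpha \Po (1 - 'X).
have qE x : q.[x] = b_fun alpha (1 - x)
  by rewrite b_polyE horner_comp; congr (_.[_]); rewrite !hornerE.
have /choice[c H] : forall r, exists c : R, 0 <= c /\
    forall x h, 0 <= x <= 2 -> 0 <= h <= 1 ->
    `|iter r (hdiff h) (horner q) x| <= c * h ^+ r.
  by move=> r; have [c c0 H] := poly_hdiff_bound 2 r q; exists c.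
pose A : R := alpha%:R.
(* [c1] adds the polynomial part and the at most alpha crossing differences; [c2] is the crude bound
   for N < alpha, where N^r is at most alpha^alpha. *)
pose c1 := \sum_(r < alpha.+1) c r + A * (2 ^+ alpha * A ^+ alpha.-1).
pose c2 := 2 ^+ alpha * M * A ^+ alpha.
have A1 : 1 <= A by rewrite ler1n ltnW.
have A0 : 0 <= A by rewrite ler0n.
have c10 : 0 <= c1.
  by rewrite addr_ge0 ?mulr_ge0 ?exprn_ge0 ?sumr_ge0// => i _; have [] := H i.
have c20 : 0 <= c2 by rewrite !mulr_ge0 ?exprn_ge0.
exists (c1 + c2) => [|N y N0 r l ra la]; first exact: addr_ge0.
have N0' : 0 < N%:R :> R by rewrite ltr0n.
have [th [s [th01 [GE GN Gf]]]] := b_per_samples y alpha1 N0.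
pose G i := b_per alpha (- ((th + i%:R) / N%:R)).
have {}GE a : b_per alpha (y - a%:R / N%:R) = G (s + a)%N := GE a.
have {}GN i : G (N + i)%N = G i := GN i.
have {}Gf i : (i < N)%N -> G i = b_fun alpha (1 - (th + i%:R) / N%:R) := @Gf i.
have -> : (fun a => b_per alpha (y - a%:R / N%:R)) = (fun a => G (s + a)%N).
  by apply/funext => a; rewrite GE.
under eq_bigr do rewrite iter_fdiff_shift addnA.
rewrite (@sum_periodic _ _ (fun i => `|iter r fdiff G i|)); last first.
  move=> i; rewrite -iter_fdiff_shift; congr (`|iter _ _ _ _|).
  by apply/funext => b; rewrite GN.
have Nr0 : 0 < N%:R ^+ r :> R by rewrite exprn_gt0.
have [Na|aN] := ltnP N alpha.
  rewrite (@le_trans _ _ (c2 * N%:R / N%:R ^+ r))//; last first.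
    by rewrite ler_wpM2r ?invr_ge0 ?exprn_ge0 ?ler0n// ler_wpM2r ?ler0n// lerDr.
  rewrite (@le_trans _ _ (\sum_(b < N) 2 ^+ alpha * M))//.
    apply: ler_sum => b _; rewrite (@le_trans _ _ (2 ^+ r * M))//.
      by apply: iter_fdiff_bound => j _; exact: HM.
    by rewrite ler_wpM2r// ler_weXn2l// ler1n.
  rewrite sumr_const card_ord -[leLHS]mulr_natr [leRHS]mulrAC ler_wpM2r ?ler0n//.
  rewrite ler_pdivlMr// ler_wpM2l ?mulr_ge0 ?exprn_ge0//.
  rewrite (@le_trans _ _ (A ^+ r))//; last by rewrite ler_weXn2l.
  by rewrite lerXn2r ?nnegrE ?ler0n// ler_nat ltnW.
rewrite (@le_trans _ _ (c1 * N%:R / N%:R ^+ r))//; last first.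
  by rewrite ler_wpM2r ?invr_ge0 ?exprn_ge0 ?ler0n// ler_wpM2r ?ler0n// lerDl.
pose d : R := (A / N%:R) ^+ alpha.-1.
have d0 : 0 <= d by rewrite exprn_ge0// divr_ge0 ?ler0n.
have [cr0 Hr] := H r.
pose E i := G i - q.[(th + i%:R) / N%:R].
have E0 i : (i < N)%N -> E i = 0 by move=> iN; rewrite /E Gf// qE subrr.
have Ed i : (i < N + r)%N -> `|E i| <= d.
  move=> iNr; have [iN|Ni] := ltnP i N; first by rewrite E0// normr0.
  have iN : (i - N < N)%N by rewrite ltn_subLR// (leq_trans iNr)// leq_add2l (leq_trans ra).
  pose x : R := (th + (i - N)%:R) / N%:R.
  have xE : (th + i%:R) / N%:R = x + 1.
    by rewrite /x natrB//; field; rewrite gt_eqF.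
  rewrite /E -{1}(subnKC Ni) GN Gf// qE xE -/x opprD [1 + (_ + _)]addrC subrK.
  have := b_fun_shift alpha (- x); rewrite [- x + 1]addrC => /le_trans; apply.
  rewrite normrN; have x0 : 0 <= x.
    by case/andP: th01 => th0 _; rewrite (divr_ge0 (addr_ge0 th0 (ler0n _ _)))// ler0n.
  rewrite ger0_norm// /d; apply: lerXn2r; rewrite ?nnegrE//.
    by rewrite divr_ge0 ?ler0n.
  apply: ler_wpM2r; first by rewrite invr_ge0 ler0n.
  have : (i - N).+1%:R <= A by rewrite ler_nat (leq_trans _ ra)// ltn_subLR.
  rewrite -natr1; lra.
have Hb (b : 'I_N) : `|iter r fdiff G b| <=
    c r / N%:R ^+ r + (N <= b + r)%:R * (2 ^+ alpha * d).
  have -> : G = (fun i => horner q ((th + i%:R) * N%:R^-1) + E i).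
    by apply/funext => i; rewrite /E addrC subrK.
  rewrite iter_fdiffD iter_hdiff_sample; apply: le_trans (ler_normD _ _) _.
  apply: lerD.
    rewrite -exprVn; apply: Hr; last first.
      by rewrite invr_ge0 ler0n/= invf_le1// ler1n.
    have : b.+1%:R <= N%:R :> R by rewrite ler_nat.
    have := ler0n R b; rewrite -natr1 => b0 bN.
    by rewrite divr_ge0 ?ler_pdivrMr//; lra.
  case: leqP => Nbr; rewrite ?mul1r ?mul0r.
    rewrite (@le_trans _ _ (2 ^+ r * d))//; last first.
      by rewrite ler_wpM2r// ler_weXn2l// ler1n.
    by apply: iter_fdiff_bound => j jr; apply: Ed; exact: leq_add (ltn_ord b) jr.
  rewrite -(mulr0 (2 ^+ r)); apply: iter_fdiff_bound => j jr.
  by rewrite E0 ?normr0// (leq_ltn_trans _ Nbr)// leq_add2l.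
apply: le_trans (ler_sum _ (fun b _ => Hb b)) _.
rewrite big_split /= sumr_const card_ord -mulr_suml -natr_sum /c1 !mulrDl.
apply: lerD.
  rewrite -[leLHS]mulr_natr mulrAC.
  rewrite ler_wpM2r ?invr_ge0 ?exprn_ge0 ?ler0n// ler_wpM2r ?ler0n//.
  rewrite (bigD1 (Ordinal (ra : (r < alpha.+1)%N)))//= lerDl sumr_ge0// => i _.
  by have [] := H i.
have dE : d <= A ^+ alpha.-1 * (N%:R / N%:R ^+ r).
  rewrite /d exprMn ler_wpM2l ?exprn_ge0// exprVn.
  rewrite ler_pdivlMr// mulrC ler_pdivrMr ?exprn_gt0// -exprS prednK ?(ltnW alpha1)//.
  by rewrite ler_weXn2l// ler1n.
rewrite -!mulrA; apply: ler_pM; rewrite ?ler0n//.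
- by rewrite mulr_ge0// exprn_ge0.
- by rewrite ler_nat (leq_trans (sum_tail_count _ _ _))// addKn.
- by rewrite ler_wpM2l ?exprn_ge0.
Qed.

End BernoulliSamples.

(** * Digital nets and their duals *)

Section NetPoints.
Context {R : realType}.
Variables (p s : nat).
Hypothesis p_prime : prime p.

Let p_gt1 : (1 < p)%N. Proof. exact: prime_gt1. Qed.
Let p_gt0 : (0 < p)%N. Proof. exact: prime_gt0. Qed.

Lemma Fp_ord_lt (x : 'F_p) : (x < p)%N.
Proof. by rewrite (leq_trans (ltn_ord x))// Fp_cast. Qed.

Implicit Types (C : gen_matrices p s) (k : 'I_s -> nat).

Definition net_index m C (j : 'I_s) h : nat :=
  \sum_(i < m) (\sum_(l < m) C j i l * (digit p h l)%:R : 'F_p)%R * p ^ (m.-1 - i).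

Lemma coord_net_point m C j h :
  Defs.coord (net_point R m m C h) j = (net_index m C j h)%:R / (p ^ m)%:R.
Proof.
rewrite /Defs.coord tnth_mktuple natr_sum mulr_suml; apply: eq_bigr => i _.
have p0 e : (p ^ e)%:R != 0 :> R by rewrite pnatr_eq0 -lt0n expn_gt0 p_gt0.
rewrite natrM -mulrA; congr (_ * _).
rewrite -natrX; apply: (mulfI (p0 i.+1)); rewrite mulfV// mulrA -natrM -expnD.
by rewrite (_ : (_ + _)%N = m) ?divff//; have := ltn_ord i; lia.
Qed.

Lemma net_index_lt m C j h : (net_index m C j h < p ^ m)%N.
Proof.
rewrite /net_index (reindex_inj rev_ord_inj) /=.
pose x i : nat := \sum_(l < m) C j (m - i.+1)%N l * (digit p h l)%:R.
rewrite (eq_bigr (fun i : 'I_m => x i * p ^ i)%N).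
  by apply: (@sum_digits_lt p m x) => i; exact: Fp_ord_lt.
move=> i _; have := ltn_ord i.
by move=> im; rewrite (_ : m.-1 - (m - i.+1) = i)%N//; lia.
Qed.

Definition dual_eq m C k l : 'F_p :=
  \sum_j \sum_(i < m) C j i l * (digit p (k j) i)%:R.

(** Frequencies below p^m have no digits past the first m, so cutting the matrices to m rows does
    not change which of them are dual. *)
Lemma dual_eqP m C k : (forall j, (k j < p ^ m)%N) ->
  dual_net m C k <-> forall l, (l < m)%N -> dual_eq m C k l = 0.
Proof.
move=> km; have E l : dual_eq m C k l =
    \sum_j \sum_(i < k j) C j i l * (digit p (k j) i)%:R.
  apply: eq_bigr => j _.
  pose f i : 'F_p := C j i l * (digit p (k j) i)%:R.
  have H a b : (k j < p ^ a)%N -> \sum_(i < a + b) f i = \sum_(i < a) f i.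
    move=> ka; rewrite big_split_ord /= [X in _ + X]big1 ?addr0// => i _.
    by rewrite /f (digit_small p_gt1 ka) ?leq_addr// mulr0.
  rewrite -(H m (k j) (km j)) addnC H// ltn_expl//.
by split=> H l lm; have := H l lm; rewrite E.
Qed.

End NetPoints.

Section NetAverage.
Context {R : realType}.
Variables (p : nat) (w : R[i]).
Hypotheses (p_prime : prime p) (w_prim : p.-primitive_root w).
Local Notation normc := (@Normc.normc R).

Let p_gt1 : (1 < p)%N. Proof. exact: prime_gt1. Qed.
Let p_gt0 : (0 < p)%N. Proof. exact: prime_gt0. Qed.
Let pX_neq0 n : (p ^ n)%:R != 0 :> R[i].
Proof. by rewrite pnatr_eq0 -lt0n expn_gt0 p_gt0. Qed.

Definition walsh_coef n k (F : nat -> R) : R[i] :=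
  walsh_sum p w n k F / (p ^ n)%:R.

Lemma normc_nat n : normc n%:R = n%:R.
Proof. by rewrite -(rmorph_nat (real_complex R)) normc_real ger0_norm ?ler0n. Qed.

(** After division by p^n, each window gives c p^(-n r), and there are at most p^((2 + n) r) / p^mu
    windows, mu being the weight of k. What remains besides p^-mu is p^(2 r), hence the factor p^(2
    alpha). *)
Lemma walsh_coef_bound alpha n k (F : nat -> R) (c : R) : 0 <= c ->
  (k < p ^ n)%N -> smooth_samples alpha c (p ^ n) F ->
  normc (walsh_coef n k F) <= c * p%:R ^+ (2 * alpha) / p%:R ^+ digit_weight p alpha k.
Proof.
move=> c0 kn Fc; have [L [L1 L2 L3]] := walsh_sum_bound p_prime w_prim alpha kn.
set r := minn _ _ in L1 L3; have ra : (r <= alpha)%N by exact: geq_minl.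
set z := digit_weight _ _ _ in L1 *.
have P0 e : 0 < p%:R ^+ e :> R by rewrite exprn_gt0// ltr0n.
rewrite /walsh_coef Normc.normcM Normc.normcV normc_nat.
rewrite natrX ler_pdivrMr//; apply: le_trans (L3 _) _.
rewrite (@le_trans _ _ (\sum_(l <- L) c * (p ^ n)%:R / (p ^ n)%:R ^+ r))//.
  by rewrite big_seq [leRHS]big_seq; apply: ler_sum => l lL; exact: Fc (L2 _ lL).
rewrite big_const_seq count_predT iter_addr_0 -[leLHS]mulr_natr.
rewrite natrX (_ : c * _ / _ * _ = c * ((size L)%:R / (p%:R ^+ n) ^+ r) * p%:R ^+ n).
  rewrite ler_wpM2r ?exprn_ge0 ?ler0n// -[leRHS]mulrA ler_wpM2l//.
  rewrite -exprM ler_pdivrMr// mulrAC ler_pdivlMr// -exprD.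
  rewrite -!natrX -natrM ler_nat (leq_trans L1)// leq_exp2l// mulnDl.
  by rewrite leq_add2r leq_mul2l ra orbT.
by ring.
Qed.

Lemma sum_prod_digits (V : comNzRingType) m (F : nat -> nat -> V) :
  \sum_(h < p ^ m) \prod_(l < m) F l (digit p h l) =
  \prod_(l < m) \sum_(d < p) F l d.
Proof.
elim: m F => [|m IHm] F.
  by rewrite big_ord0 big_ord1 big_ord0.
rewrite (@sum_ord_expS p _ _ (fun h => \prod_(l < m.+1) F l (digit p h l))).
rewrite big_ord_recl /= -(IHm (fun l => F l.+1)) mulrC mulr_suml.
apply: eq_bigr => h _; rewrite mulr_sumr; apply: eq_bigr => d _.
rewrite big_ord_recl /= mulrC {2}/digit expn0 divn1 modnMDl modn_small//.
congr (_ * _); apply: eq_bigr => l _ /=.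
by rewrite digitS divnMDl// divn_small// addn0.
Qed.

Lemma walsh_digits n k (x : nat -> nat) : (forall i, (x i < p)%N) ->
  walsh p w n k (\sum_(i < n) x i * p ^ (n.-1 - i))%N =
  \prod_(i < n) w ^+ (digit p k i * x i).
Proof.
move=> xp; elim: n k x xp => [|n IHn] k x xp; first by rewrite !big_ord0.
rewrite !big_ord_recl /= subn0.
rewrite (eq_bigr (fun i : 'I_n => x i.+1 * p ^ (n.-1 - i))%N); last first.
  by move=> i _ /=; rewrite /bump add1n subnS -subn1 subnAC subn1.
have lt : (\sum_(i < n) x i.+1 * p ^ (n.-1 - i) < p ^ n)%N.
  rewrite (reindex_inj rev_ord_inj) /=.
  rewrite (eq_bigr (fun i : 'I_n => x (n - i)%N * p ^ i)%N).
    exact: (@sum_digits_lt p n (fun i => x (n - i)%N) (fun i => xp _)).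
  move=> i _; have := ltn_ord i.
  by move=> ni; rewrite -subSn// subSS (_ : n.-1 - (n - i.+1) = i)%N//; lia.
have := walsh_cons p_prime w k (x 0%N) lt; rewrite /= => ->.
rewrite [digit p k 0]/digit expn0 divn1 (IHn _ (fun i => x i.+1))//; congr (_ * _).
by apply: eq_bigr => i _; rewrite /= /bump add1n digitS.
Qed.

(** The additive character of F_p that sends 1 to [w]. *)
Definition Fp_char (x : 'F_p) : R[i] := w ^+ x.

Lemma Fp_char_nat n : Fp_char n%:R = w ^+ n.
Proof. by rewrite /Fp_char val_Fp_nat// (prim_expr_mod w_prim). Qed.

Lemma Fp_charD : {morph Fp_char : x y / x + y >-> x * y}.
Proof.
move=> x y; rewrite -[in LHS](natr_Zp x) -[in LHS](natr_Zp y) -natrD.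
by rewrite Fp_char_nat exprD.
Qed.

Lemma Fp_char0 : Fp_char 0 = 1.
Proof. by rewrite -[0]/(0%:R) Fp_char_nat expr0. Qed.

Lemma Fp_charMn n (x : 'F_p) : Fp_char (n%:R * x) = w ^+ (n * x).
Proof. by rewrite -[in LHS](natr_Zp x) -natrM Fp_char_nat. Qed.

Variable s : nat.
Implicit Types (C : gen_matrices p s) (k : 'I_s -> nat).

(** The exponents form a bilinear expression in the digits of h and of k; exchanging the sums
    applies the transposed matrices to the digits of k. *)
Lemma prod_walsh_net m C k h :
  \prod_j walsh p w m (k j) (net_index m C j h) =
  \prod_(l < m) w ^+ (digit p h l * dual_eq m C k l).
Proof.
under eq_bigr => j _.
  rewrite (walsh_digits m (k j) (fun i => Fp_ord_lt p_prime
    (\sum_(l < m) C j i l * (digit p h l)%:R))).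
  under eq_bigr do rewrite -Fp_charMn.
  rewrite -(big_morph Fp_char Fp_charD Fp_char0).
  over.
under [in RHS]eq_bigr do rewrite -Fp_charMn.
rewrite -!(big_morph Fp_char Fp_charD Fp_char0); congr Fp_char.
under eq_bigr => j _ do under eq_bigr do rewrite mulr_sumr.
under eq_bigr => j _ do rewrite exchange_big.
rewrite exchange_big; apply: eq_bigr => l _ /=.
rewrite /dual_eq mulr_sumr; apply: eq_bigr => j _.
rewrite mulr_sumr; apply: eq_bigr => i _.
by rewrite mulrCA [RHS]mulrCA; congr (_ * _); rewrite mulrC.
Qed.

(** The digits of h run independently, so the sum splits into one character sum per dual
    equation. *)
Lemma sum_prod_walsh_net m C k :
  \sum_(h < p ^ m) \prod_j walsh p w m (k j) (net_index m C j h) =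
  (p ^ m * [forall l : 'I_m, dual_eq m C k l == 0])%:R.
Proof.
under eq_bigr do rewrite prod_walsh_net.
rewrite (sum_prod_digits m (fun l d => w ^+ (d * dual_eq m C k l))).
have E (l : 'I_m) : \sum_(d < p) w ^+ (d * dual_eq m C k l) =
    (p * (dual_eq m C k l == 0))%:R.
  have := sum_walsh1 p_prime w_prim (Fp_ord_lt p_prime (dual_eq m C k l)) p_gt0.
  under eq_bigr do rewrite muln0 expr0 invr1 mulr1.
  by move=> ->.
under eq_bigr do rewrite E.
rewrite -natr_prod big_split /= prod_nat_const card_ord; congr (_ * _)%:R.
case: forallP => [H|H]; first by rewrite big1// => l _; rewrite H.
have /existsP[l El] : [exists l : 'I_m, dual_eq m C k l != 0].
  by rewrite -negb_forall; apply/forallP.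
by rewrite (bigD1 l)//= (negPf El) mul0n.
Qed.

(** Poisson summation for the net, exact because the grid is finite: Walsh inversion of every
    factor, distributivity, and the character sums over h. *)
Lemma net_average m C (F : 'I_s -> nat -> R) :
  ((\sum_(h < p ^ m) \prod_j F j (net_index m C j h)) / (p ^ m)%:R)%:C%C =
  \sum_(k : {ffun 'I_s -> 'I_(p ^ m)} |
      [forall l : 'I_m, dual_eq m C (fun j => k j) l == 0])
    \prod_j walsh_coef m (k j) (F j).
Proof.
rewrite fmorph_div rmorph_nat rmorph_sum.
under eq_bigr => h _.
  rewrite rmorph_prod.
  rewrite (eq_bigr (fun j => \sum_(k < p ^ m) walsh_coef m k (F j) *
      walsh p w m k (net_index m C j h))); last first.
    by move=> j _; exact: walsh_inversion (net_index_lt p_prime _ _ _ _).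
  rewrite bigA_distr_bigA /=.
  under eq_bigr do rewrite big_split /=.
  over.
rewrite exchange_big mulr_suml [in RHS]big_mkcond; apply: eq_bigr => k _ /=.
rewrite -mulr_sumr (sum_prod_walsh_net m C (fun j => k j)) natrM.
case: ifP => _; rewrite ?mulr0 ?mul0r//.
by rewrite mulr1 mulfK.
Qed.

End NetAverage.

(** * The leading nonzero digits of a frequency *)

Section TopDigits.
Variables (p alpha : nat).
Hypotheses (p_gt1 : (1 < p)%N) (alpha_gt0 : (0 < alpha)%N).
Local Open Scope nat_scope.
Local Notation pos := (digit_positions p).

Let p_gt0 : 0 < p. Proof. exact: ltnW. Qed.

Lemma mem_digit_positions k c : (c \in pos k) = (0 < c) && (digit p k c.-1 != 0).
Proof.
case: c => [|c] /=; first by apply/mapP => -[].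
rewrite mem_map; last exact: succn_inj.
rewrite mem_filter mem_rev mem_iota leq0n add0n /=.
case: ltnP => kc; rewrite ?andbT// andbF; apply/esym/negbTE; rewrite negbK.
by rewrite (digit_small p_gt1 (ltn_expl k p_gt1)).
Qed.

Lemma digit_positions_le k n c : k < p ^ n -> c \in pos k -> c <= n.
Proof.
move=> kn; rewrite mem_digit_positions; case: c => // c /=.
by apply: contraNltn => nc; rewrite (digit_small p_gt1 kn).
Qed.

Lemma sorted_digit_positions k : sorted gtn (pos k).
Proof.
rewrite /digit_positions sorted_map; apply: sorted_filter.
  by move=> a b c /= ab ca; exact: ltn_trans ca ab.
rewrite rev_sorted; apply: sub_sorted (iota_ltn_sorted 0 k).
by move=> a b.
Qed.

Lemma digit_weightE k : digit_weight p alpha k = \sum_(i < alpha) nth 0 (pos k) i.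
Proof.
rewrite /digit_weight; elim: alpha (pos k) => [|a IHa] P.
  by rewrite take0 big_ord0.
rewrite big_ord_recl; case: P => [|c P] /=; last by rewrite IHa.
by rewrite big1// => i _; rewrite nth_nil.
Qed.

Lemma digit_weight_le k n : k < p ^ n -> digit_weight p alpha k <= alpha * n.
Proof.
move=> kn; rewrite digit_weightE -[alpha in alpha * n]card_ord -sum_nat_const.
apply: leq_sum => i _; have [iP|/(nth_default 0) -> //] := ltnP i (size (pos k)).
by apply: (digit_positions_le kn); exact: mem_nth.
Qed.

(* Code of the i-th leading nonzero digit: its position and its value, in base p. *)
Definition top_code k i :=
  if i < size (pos k) then (nth 0 (pos k) i).-1 * p + digit p k (nth 0 (pos k) i).-1
  else 0.

Lemma top_code_lt n k i : 0 < n -> k < p ^ n -> top_code k i < n * p.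
Proof.
move=> n0 kn; rewrite /top_code; case: (ltnP i (size (pos k))) => iP /=; last by rewrite muln_gt0 n0.
have := digit_positions_le kn (mem_nth 0 iP).
have := mem_nth 0 iP; rewrite mem_digit_positions; case: (nth _ _ _) => //= c _ cn.
rewrite (leq_trans _ (leq_mul cn (leqnn p)))// mulSn addnC ltn_add2r.
exact: digit_lt.
Qed.

(** A recorded digit is nonzero, so the code 0 is free to mean that there is no i-th digit. *)
Lemma nth_digit_positions k i :
  nth 0 (pos k) i = if top_code k i == 0 then 0 else (top_code k i %/ p).+1.
Proof.
rewrite /top_code; case: (ltnP i (size (pos k))) => iP /=; last by rewrite nth_default.
have := mem_nth 0 iP; rewrite mem_digit_positions.
case: (nth _ _ _) => //= c; rewrite -lt0n => dc.
rewrite divnMDl// divn_small ?digit_lt// addn0 ifN// -lt0n.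
by rewrite (leq_trans dc)// leq_addl.
Qed.

(** The number of digits below the alpha-th leading nonzero one. The default 0 makes it 0 when there
    are fewer than [alpha] nonzero digits, and then the codes determine all of [k]. *)
Definition low_size k := (nth 0 (pos k) alpha.-1).-1.

Lemma low_size_weight k : alpha * low_size k <= digit_weight p alpha k.
Proof.
rewrite digit_weightE -[alpha in alpha * _]card_ord -sum_nat_const.
apply: leq_sum => i _; rewrite /low_size; apply: leq_trans (leq_pred _) _.
have [aP|/(nth_default 0) -> //] := ltnP alpha.-1 (size (pos k)).
have := ltn_ord i; rewrite -[alpha in i < alpha]prednK// ltnS leq_eqVlt.
case/predU1P => [-> //|ia].
apply: ltnW; apply: (sorted_ltn_nth (leT := gtn)) => //.
- by move=> a b c /= ab ca; exact: ltn_trans ca ab.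
- exact: sorted_digit_positions.
- by rewrite inE (ltn_trans ia).
Qed.

Lemma top_code_digit k i : low_size k <= i -> digit p k i != 0 ->
  exists2 a, a < alpha & top_code k a = i * p + digit p k i.
Proof.
move=> di ki; have iP : i.+1 \in pos k by rewrite mem_digit_positions.
exists (index i.+1 (pos k)); last by rewrite /top_code index_mem iP nth_index.
rewrite ltnNge; apply: contraL di => ai; rewrite -ltnNge /low_size.
have aP : alpha.-1 < index i.+1 (pos k) by rewrite prednK.
have tr : transitive gtn by move=> a b c /= ab ca; exact: ltn_trans ca ab.
have := sorted_ltn_nth tr 0 (sorted_digit_positions k).
move=> /(_ alpha.-1 (index i.+1 (pos k))); rewrite !inE index_mem iP.
move=> /(_ (ltn_trans aP _) isT aP); rewrite index_mem iP nth_index//.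
by move=> /(_ isT) /=; case: (nth _ _ _).
Qed.

(** From [low_size] upward every nonzero digit is among the leading [alpha] and is recorded with its
    position; all others there are zero. *)
Lemma top_code_eq k k' : (forall a, a < alpha -> top_code k a = top_code k' a) ->
  [/\ low_size k = low_size k',
      digit_weight p alpha k = digit_weight p alpha k' &
      forall i, low_size k <= i -> digit p k i = digit p k' i].
Proof.
move=> kk'; have nk a : a < alpha -> nth 0 (pos k) a = nth 0 (pos k') a.
  by move=> aa; rewrite !nth_digit_positions kk'.
have dk : low_size k = low_size k' by rewrite /low_size nk// prednK.
split=> //; first by rewrite !digit_weightE; apply: eq_bigr => i _; rewrite nk.
suff H k1 k2 : (forall a, a < alpha -> top_code k1 a = top_code k2 a) ->
    forall i, low_size k1 <= i -> digit p k1 i != 0 -> digit p k1 i = digit p k2 i.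
  move=> i di; have [ki|/(H _ _ kk' _ di)//] := eqVneq (digit p k i) 0.
  have [->//|] := eqVneq (digit p k' i) 0.
  by rewrite dk in di => k'i; rewrite (H k' k)// => a aa; rewrite kk'.
move=> {}kk' i di ki; have [a aa] := top_code_digit di ki.
rewrite kk'// /top_code; case: ifP => [aP|_ /eqP]; last first.
  by rewrite eq_sym addn_eq0 (negPf ki) andbF.
move=> E; have := congr1 (modn^~ p) E; rewrite !modnMDl !modn_small ?digit_lt// => <-.
have := congr1 (divn^~ p) E; rewrite !divnMDl// !divn_small ?digit_lt// !addn0.
by move=> ->.
Qed.

Lemma digit_div k e i : digit p (k %/ p ^ e) i = digit p k (e + i).
Proof. by rewrite /digit -divnMA -expnD. Qed.

Lemma digit_mod k n i : i < n -> digit p (k %% p ^ n) i = digit p k i.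
Proof.
move=> lin; rewrite /digit {2}(divn_eq k (p ^ n)).
have -> : p ^ n = p ^ (n - i).-1 * p * p ^ i.
  by rewrite -expnSr prednK ?subn_gt0// -expnD subnK// ltnW.
by rewrite mulnA divnMDl ?expn_gt0 ?p_gt0// mulnA modnMDl.
Qed.

Lemma digit_eq k k' : digit p k =1 digit p k' -> k = k'.
Proof.
move=> E; pose n := maxn k k'.
have kn : k < p ^ n by rewrite (leq_ltn_trans (leq_maxl k k'))// ltn_expl.
have kn' : k' < p ^ n by rewrite (leq_ltn_trans (leq_maxr k k'))// ltn_expl.
by rewrite (digit_expansion p_gt1 kn) (digit_expansion p_gt1 kn');
   apply: eq_bigr => i _; rewrite E.
Qed.

End TopDigits.

(** Induction on the surplus, lowering one positive entry by one each time. *)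
Lemma subweight_exists (I : finType) (d : I -> nat) M :
  (M <= \sum_i d i)%N -> exists2 e : I -> nat,
    forall i, (e i <= d i)%N & (\sum_i e i = M)%N.
Proof.
move=> Md; rewrite -(subKn Md); have := leq_subr M (\sum_i d i)%N.
elim: (_ - _)%N => [_|n IHn nd]; first by exists d; rewrite ?subn0.
have [e ed eS] := IHn (ltnW nd).
have /existsP[i ei] : [exists i, 0 < e i]%N.
  apply: contraLR nd; rewrite negb_exists => /forallP e0; rewrite -leqNgt -subn_eq0.
  by rewrite -eS big1// => i _; apply/eqP; rewrite -[_ == _]negbK -lt0n e0.
exists (fun j => if j == i then (e i).-1 else e j).
  by move=> j; case: eqP => [->|//]; rewrite (leq_trans (leq_pred _)).
rewrite (bigD1 i)//= eqxx (eq_bigr e) => [|j /negPf -> //].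
by rewrite subnS -eS [in RHS](bigD1 i)//=; case: (e i) ei.
Qed.

(** * Counting dual vectors by their leading digits *)

Section DualNetSum.
Context {R : realType}.
Variables (p alpha t m s : nat) (C : gen_matrices p s).
Hypotheses (p_prime : prime p) (alpha_gt0 : (0 < alpha)%N) (m_gt0 : (0 < m)%N).
Hypothesis C_net : order_digital_net alpha t m C.

Let p_gt1 : (1 < p)%N. Proof. exact: prime_gt1. Qed.
Let p_gt0 : (0 < p)%N. Proof. exact: prime_gt0. Qed.

Notation wt k := (\sum_j digit_weight p alpha (k j))%N.

Definition dual_points (u : {set 'I_s}) : {set {ffun 'I_s -> 'I_(p ^ m)}} :=
  [set k : {ffun 'I_s -> 'I_(p ^ m)} |
    [&& [forall l : 'I_m, dual_eq m C (fun j => k j) l == 0],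
        [exists j, k j != 0 :> nat] &
        [forall j, (j \notin u) ==> (k j == 0 :> nat)]]].

Lemma dual_weight u k : k \in dual_points u -> (alpha * m - t < wt k)%N.
Proof.
rewrite inE => /and3P[/forallP kD /existsP k0 _].
apply: C_net.2 => //; apply/(dual_eqP p_prime) => // l lm.
by apply/eqP; exact: (kD (Ordinal lm)).
Qed.

Definition dual_code (k : {ffun 'I_s -> 'I_(p ^ m)}) :
    {ffun 'I_s -> {ffun 'I_alpha -> 'I_(m * p)}} :=
  [ffun j => [ffun i : 'I_alpha =>
     Ordinal (top_code_lt p_gt1 i m_gt0 (ltn_ord (k j)))]].

Lemma dual_code_eq k k' : dual_code k = dual_code k' -> forall j,
  [/\ low_size p alpha (k j) = low_size p alpha (k' j),
      digit_weight p alpha (k j) = digit_weight p alpha (k' j) &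
      forall i, (low_size p alpha (k j) <= i)%N -> digit p (k j) i = digit p (k' j) i].
Proof.
move=> E j; apply: (top_code_eq p_gt1 alpha_gt0) => a aa.
have := congr1 (fun c : {ffun 'I_s -> {ffun 'I_alpha -> 'I_(m * p)}} =>
  nat_of_ord (c j (Ordinal aa))) E.
by rewrite !ffunE.
Qed.

(* The digitwise difference of k and k' is a dual vector of weight at most
   alpha * sum_j e_j. *)
Lemma dual_eq_low u (k k' : {ffun 'I_s -> 'I_(p ^ m)}) (e : 'I_s -> nat) :
  k \in dual_points u -> k' \in dual_points u ->
  (forall j i, (e j <= i)%N -> digit p (k j) i = digit p (k' j) i) ->
  (alpha * \sum_j e j <= alpha * m - t)%N -> k = k'.
Proof.
rewrite !inE => /and3P[/forallP kD _ _] /and3P[/forallP kD' _ _] kk' eM.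
(* Subtraction in F_p digit by digit, without carries, keeps the dual equations linear. *)
pose x j i : 'F_p := (digit p (k j) i)%:R - (digit p (k' j) i)%:R.
have xp j i : (x j i < p)%N by apply: Fp_ord_lt.
pose d j : nat := (\sum_(i < m) x j i * p ^ i)%N.
have dm j : (d j < p ^ m)%N by exact: (@sum_digits_lt p m (fun i => x j i)).
have dE j i : (i < m)%N -> digit p (d j) i = x j i.
  by move=> im; exact: (@digit_sum p p_gt1 m (fun i => x j i)).
have dD : dual_net m C d.
  apply/(dual_eqP p_prime) => // l lm.
  have := kD (Ordinal lm); have := kD' (Ordinal lm) => /eqP k'0 /eqP k0.
  rewrite -[RHS](subrr 0) -{1}k0 -k'0 /dual_eq -sumrB; apply: eq_bigr => j _.
  rewrite -sumrB; apply: eq_bigr => i _.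
  by rewrite -mulrBr dE// natr_Zp.
have de j : (d j < p ^ e j)%N.
  rewrite /d (eq_bigr (fun i : 'I_m => (if (i < e j)%N then x j i : nat else 0) * p ^ i)%N).
    have [em|me] := leqP (e j) m; last first.
      rewrite (@leq_trans (p ^ m)) ?leq_exp2l ?(ltnW me)//.
      apply: (@sum_digits_lt p m (fun i => if (i < e j)%N then x j i : nat else 0%N)).
      by move=> i; case: ifP.
    rewrite -(subnKC em) big_split_ord /= [X in (_ + X)%N]big1 ?addn0.
      apply: (@sum_digits_lt p (e j) (fun i => if (i < e j)%N then x j i : nat else 0%N)).
      by move=> i; case: ifP.
    by move=> i _; rewrite ltnNge leq_addr.
  by move=> i _; case: ltnP => // ei; rewrite /x kk'// subrr.
(* Having only e_j digits, [d j] has weight at most alpha e_j; a nonzero [d] would violate the net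
   condition. *)
have d0 j : d j = 0%N.
  apply/eqP; apply: contraLR eM => dj; rewrite -ltnNge.
  rewrite (leq_trans (C_net.2 d dD _))//; first by exists j.
  rewrite big_distrr leq_sum// => i _; exact: digit_weight_le.
apply/ffunP => j; apply/val_inj/(digit_eq p_gt1) => i /=.
have [im|mi] := ltnP i m; last by rewrite !(digit_small p_gt1 (ltn_ord _) mi).
have := dE j i im; rewrite d0 => /esym x0.
have /eqP : x j i = 0 by rewrite -[LHS]natr_Zp x0 /digit div0n mod0n.
rewrite subr_eq0 -(inj_eq val_inj) /= !val_Fp_nat//.
by rewrite !modn_small ?digit_lt// => /eqP.
Qed.

(** Members of a class agree in all digits from d_j, their [low_size], upward. For e below d with
    alpha times the sum of the e_j at most alpha m - t, members that agree also between e_j and d_j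
    coincide. So the class has at most p^(sum of d_j - e_j) members, and e is chosen to make this
    exponent small. *)
Lemma card_dual_class u k0 : k0 \in dual_points u ->
  (#|[set k in dual_points u | dual_code k == dual_code k0]| * p ^ (alpha * m) <=
   p ^ wt k0 * p ^ (t + alpha))%N.
Proof.
move=> k0D; set S := [set k in _ | _].
pose d j := low_size p alpha (k0 j).
pose M := ((alpha * m - t) %/ alpha)%N.
have [tm _] := C_net.
have z0 := dual_weight k0D.
have dz : (alpha * \sum_j d j <= wt k0)%N.
  by rewrite big_distrr leq_sum// => j _; exact: low_size_weight.
have aM : (alpha * M <= alpha * m - t)%N by rewrite mulnC leq_trunc_div.
have Ma : (alpha * m - t < alpha * M + alpha)%N.
  by rewrite -mulnSr [(alpha * M.+1)%N]mulnC /M ltn_ceil.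
(* If the d_j have sum at most M, then e = d, and the exponent bound is the lower bound for the
   weight. Otherwise the e_j have sum M, and (sum of d_j) - M is at most alpha times itself; the
   rounding in M costs the summand alpha. *)
have [e ed [eM eS]] : exists2 e : 'I_s -> nat, forall j, (e j <= d j)%N &
    (\sum_j e j <= M)%N /\ (\sum_j (d j - e j) + alpha * m <= wt k0 + (t + alpha))%N.
  have [dM|/ltnW Md] := leqP (\sum_j d j)%N M.
    exists d => //; split => //; rewrite big1 => [|j _]; last exact: subnn.
    lia.
  have [e ed eM] := subweight_exists Md; exists e => //; rewrite eM; split=> //.
  rewrite sumnB// eM.
  have : (alpha.-1 * M <= alpha.-1 * \sum_j d j)%N by rewrite leq_mul2l Md orbT.
  have aE b : (alpha * b = b + alpha.-1 * b)%N by rewrite -mulSn prednK.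
  move: dz aM Ma; rewrite (aE (\sum_j d j)%N) (aE M).
  move: (alpha.-1 * M)%N (alpha.-1 * _)%N => x y; lia.
have H : (#|S| <= p ^ \sum_j (d j - e j))%N.
  have lt (k : {ffun 'I_s -> 'I_(p ^ m)}) j :
      ((k j %/ p ^ e j) %% p ^ (d j - e j) < p ^ m)%N.
    by rewrite (leq_ltn_trans (leq_mod _ _))// (leq_ltn_trans (leq_div _ _)).
  (* Extracts the digits at the positions from e_j to d_j - 1. *)
  pose g k : {ffun 'I_s -> 'I_(p ^ m)} := [ffun j => Ordinal (lt k j)].
  have gI : {in S &, injective g}.
    move=> k k' /setIdP[kD /eqP kc] /setIdP[kD' /eqP kc'] gkk'.
    apply: (@dual_eq_low u _ _ e) => //; last first.
      by rewrite (leq_trans _ aM)// leq_mul2l eM orbT.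
    move=> j i ei; have [dk _ Hk] := dual_code_eq kc j.
    have [dk' _ Hk'] := dual_code_eq kc' j.
    have [di|id] := leqP (d j) i; first by rewrite Hk ?dk// Hk' ?dk'.
    have := congr1 (fun f : {ffun 'I_s -> 'I_(p ^ m)} =>
      digit p (f j) (i - e j)) gkk'.
    by rewrite !ffunE /= !digit_mod ?ltn_sub2r ?(leq_ltn_trans ei)// !digit_div subnKC.
  rewrite -(card_in_imset gI).
  pose F j := [pred z : 'I_(p ^ m) | (z < p ^ (d j - e j))%N].
  apply: (@leq_trans #|family F|).
    apply/subset_leq_card/fintype.subsetP => f /imsetP[k _ ->].
    by apply/familyP => j; rewrite inE ffunE /= ltn_mod expn_gt0 p_gt0.
  rewrite card_family foldrE big_map big_enum /= expn_sum leq_prod// => j _.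
  rewrite cardE -(size_map val) -[leqRHS](size_iota 0) uniq_leq_size//.
    by rewrite map_inj_uniq ?enum_uniq//; exact: val_inj.
  by move=> z /mapP[y]; rewrite mem_enum mem_iota => yc ->.
by rewrite (leq_trans (leq_mul H (leqnn _)))// -!expnD leq_exp2l.
Qed.

(** The weight is constant on a class of equal codes and cancels against its cardinality, which
    leaves p^(t + alpha) / p^(alpha m) per class. The number of codes, at most (m p)^(alpha |u|), is
    the source of the power of the logarithm. *)
Lemma dual_points_sum u :
  \sum_(k in dual_points u) (p%:R ^+ wt k)^-1 <=
  ((m * p)%:R ^+ alpha) ^+ #|u| * p%:R ^+ (t + alpha) / p%:R ^+ (alpha * m) :> R.
Proof.
have P0 e : 0 < p%:R ^+ e :> R by rewrite exprn_gt0// ltr0n.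
have mp0 : (0 < m * p)%N by rewrite muln_gt0 m_gt0.
pose c0 : {ffun 'I_alpha -> 'I_(m * p)} := [ffun=> Ordinal mp0].
pose Q : pred {ffun 'I_s -> {ffun 'I_alpha -> 'I_(m * p)}} :=
  pffun_on c0 (mem u) predT.
have QD k : k \in dual_points u -> Q (dual_code k).
  rewrite inE => /and3P[_ _ /forallP ku]; apply/pffun_onP; split=> //.
  apply/supportP => j ju; apply/ffunP => i; apply/val_inj; rewrite !ffunE /=.
  by have /implyP/(_ ju)/eqP -> := ku j.
rewrite (partition_big dual_code Q) => [|k]; last exact: QD.
apply: (@le_trans _ _ (\sum_(c | Q c) (p%:R ^+ (t + alpha) / p%:R ^+ (alpha * m)))).
  apply: ler_sum => c _.
  have [k0 /andP[k0D /eqP k0c]|none] := pickP (fun k => (k \in dual_points u) && (dual_code k == c)).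
    rewrite (eq_bigr (fun=> (p%:R ^+ wt k0)^-1)); last first.
      move=> k /andP[_ /eqP kc]; congr (_ ^+ _)^-1; apply: eq_bigr => j _.
      by have [] := @dual_code_eq k k0 _ j; rewrite ?kc.
    rewrite sumr_const -[leLHS]mulr_natr mulrC ler_pdivrMr// mulrAC ler_pdivlMr//.
    rewrite -!natrX -!natrM ler_nat [leqRHS]mulnC.
    rewrite (leq_trans _ (card_dual_class k0D))// leq_mul2r.
    apply/orP; right; apply/subset_leq_card/fintype.subsetP => k.
    by case/andP=> kD kc; apply/setIdP; rewrite k0c.
  by rewrite big_pred0// divr_ge0// ltW.
rewrite sumr_const -[leLHS]mulr_natl -[leRHS]mulrA ler_wpM2r ?divr_ge0 ?(ltW (P0 _))//.
rewrite -!natrX ler_nat.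
rewrite card_pffun_on [#|predT|]card_ffun !card_ord.
exact: leqnn.
Qed.

End DualNetSum.

(** * Extrapolated quadrature of the Bernoulli kernels *)

Section ProductRule.
Context {R : realType}.
Variables (p alpha t s : nat) (C : gen_matrices p s).
Hypotheses (p_prime : prime p) (alpha_gt0 : (0 < alpha)%N).
Local Notation normc := (@Normc.normc R).

Let p_gt1 : (1 < p)%N. Proof. exact: prime_gt1. Qed.
Let p_gt0 : (0 < p)%N. Proof. exact: prime_gt0. Qed.
Let P0 e : 0 < p%:R ^+ e :> R. Proof. by rewrite exprn_gt0// ltr0n. Qed.
Let pX_neq0 e : (p ^ e)%:R != 0 :> R.
Proof. by rewrite pnatr_eq0 -lt0n expn_gt0 p_gt0. Qed.

Lemma digit_count_eq0 k : (digit_count p k == 0%N) = (k == 0%N).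
Proof.
apply/eqP/eqP => [/size0nil kP|->//]; apply: (digit_eq p_gt1) => i.
have := mem_digit_positions p_gt1 k i.+1; rewrite kP in_nil /= => /esym/negbFE/eqP ->.
by rewrite /digit div0n mod0n.
Qed.

Lemma walsh_coef0 (w : R[i]) n (F : nat -> R) :
  walsh_coef p w n 0 F = ((\sum_(a < p ^ n) F a) / (p ^ n)%:R)%:C%C.
Proof.
rewrite /walsh_coef /walsh_sum fmorph_div rmorph_nat rmorph_sum; congr (_ / _).
by apply: eq_bigr => a _; rewrite walsh0 invr1 mulr1.
Qed.

(** For k nonzero, summation by parts with one counted digit involves only first differences, which
    vanish for a constant. *)
Lemma walsh_coef_const (w : R[i]) n k : p.-primitive_root w -> (k < p ^ n)%N ->
  walsh_coef p w n k (fun=> 1) = (k == 0%N)%:R.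
Proof.
move=> w_prim kn; have [->|k0] := eqVneq k 0%N.
  rewrite walsh_coef0 sumr_const card_ord divff ?rmorph1//.
have [L [_ _ /(_ (fun=> 1)) H]] := walsh_sum_bound p_prime w_prim 1 kn.
have r1 : minn 1 (digit_count p k) = 1%N.
  by apply/minn_idPl; rewrite lt0n digit_count_eq0.
move: H; rewrite r1 big1 => [H|l _]; last first.
  by rewrite big1// => b _; rewrite /= /fdiff subrr normr0.
rewrite /walsh_coef (_ : walsh_sum _ _ _ _ _ = 0) ?mul0r//.
by apply: Normc.eq0_normc; apply/eqP; rewrite eq_le H normc_ge0.
Qed.

(* The frequency 0 contributes the product of the one-dimensional means; the
   other frequencies supported in u lie in the dual net. *)
Lemma qmc_rule_prod_error m (u : {set 'I_s}) (c : R) (phi : 'I_s -> R -> R) :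
  (0 < m)%N -> order_digital_net alpha t m C -> 0 <= c ->
  (forall j, j \in u ->
     smooth_samples alpha c (p ^ m) (fun a => phi j (a%:R / (p ^ m)%:R))) ->
  (forall j x, j \notin u -> phi j x = 1) ->
  `|qmc_rule m m C (fun x => \prod_j phi j (Defs.coord x j)) -
    \prod_(j in u) ((\sum_(a < p ^ m) phi j (a%:R / (p ^ m)%:R)) / (p ^ m)%:R)| <=
  (c * p%:R ^+ (2 * alpha)) ^+ #|u| *
    (((m * p)%:R ^+ alpha) ^+ #|u| * p%:R ^+ (t + alpha) / p%:R ^+ (alpha * m)).
Proof.
move=> m_gt0 Cnet c0 phi_u phi_1.
have [w w_prim] := @prime_prim_root_exists R p p_prime.
pose F j a := phi j (a%:R / (p ^ m)%:R).
have pm0 : (0 < p ^ m)%N by rewrite expn_gt0 p_gt0.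
pose k0 : {ffun 'I_s -> 'I_(p ^ m)} := [ffun=> Ordinal pm0].
have F1 j : j \notin u -> F j = fun=> 1 by move=> ju; apply/funext => a; exact: phi_1.
pose T (k : {ffun 'I_s -> 'I_(p ^ m)}) := \prod_j walsh_coef p w m (k j) (F j).
have T0 : T k0 =
    (\prod_(j in u) ((\sum_(a < p ^ m) phi j (a%:R / (p ^ m)%:R)) / (p ^ m)%:R))%:C%C.
  rewrite rmorph_prod big_mkcond; apply: eq_bigr => j _.
  rewrite ffunE walsh_coef0; case: ifPn => // ju.
  rewrite (eq_bigr (fun=> 1)) ?sumr_const ?card_ord ?divff ?rmorph1// => a _.
  by rewrite F1.
have cB x y : (x - y)%:C%C = x%:C%C - y%:C%C :> R[i] by rewrite rmorphB.
rewrite -normc_real cB -T0.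
have -> : qmc_rule m m C (fun x => \prod_j phi j (Defs.coord x j)) =
    (\sum_(h < p ^ m) \prod_j F j (net_index m C j h)) / (p ^ m)%:R :> R.
  congr (_ / _); apply: eq_bigr => h _; apply: eq_bigr => j _.
  by rewrite coord_net_point.
rewrite (net_average p_prime w_prim) (bigD1 k0)/=; last first.
  apply/forallP => l; apply/eqP; rewrite /dual_eq big1// => j _; rewrite big1// => i _.
  by rewrite ffunE /digit div0n mod0n mulr0.
rewrite addrAC -/(T k0) subrr add0r.
(* A frequency with a nonzero coordinate outside [u] meets the constant factor 1 there and
   contributes 0. *)
rewrite (bigID (fun k => k \in dual_points m C u)) /= [X in _ + X]big1 ?addr0; last first.
  move=> k /andP[/andP[kD k1]]; rewrite inE kD /= negb_and => /orP[/existsPn k2|].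
    case/eqP: k1; apply/ffunP => j; apply/val_inj; rewrite ffunE /=.
    by have := k2 j; rewrite negbK => /eqP.
  rewrite negb_forall => /existsP[j]; rewrite negb_imply => /andP[ju kj].
  rewrite (bigD1 j)//= F1// walsh_coef_const// (negPf kj) mul0r//.
apply: le_trans (normc_sum _ _ _) _.
rewrite (eq_bigl (fun k => k \in dual_points m C u)); last first.
  move=> k; apply/idP/idP => [/andP[]//|kD]; rewrite kD andbT.
  move: kD; rewrite inE => /and3P[-> /existsP[j kj] _] /=.
  by apply: contraNneq kj => ->; rewrite ffunE.
apply: (@le_trans _ _ (\sum_(k in dual_points m C u) (c * p%:R ^+ (2 * alpha)) ^+ #|u| *
   (p%:R ^+ (\sum_j digit_weight p alpha (k j))%N)^-1)).
  apply: ler_sum => k kD; rewrite normc_prod.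
  apply: (@le_trans _ _ (\prod_j ((if j \in u then c * p%:R ^+ (2 * alpha) else 1) *
      (p%:R ^+ digit_weight p alpha (k j))^-1))).
    apply: ler_prod => j _; rewrite normc_ge0 /=; case: ifPn => ju.
      exact: walsh_coef_bound (phi_u j ju).
    rewrite F1// walsh_coef_const//; move: kD; rewrite inE => /and3P[_ _ /forallP].
    by move=> /(_ j)/implyP/(_ ju)/eqP ->; rewrite Normc.normc1 mul1r invr1.
  rewrite big_split /= -big_mkcond prodr_const prodfV.
  by rewrite (big_morph (fun e => p%:R ^+ e : R) (exprD _) (expr0 _)).
rewrite -mulr_sumr ler_wpM2l ?exprn_ge0 ?mulr_ge0 ?(ltW (P0 _))//.
exact: dual_points_sum.
Qed.

End ProductRule.

(** * Richardson extrapolation of sequences *)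

Section Richardson.
Context {R : realType}.
Variable p : nat.
Hypothesis p_gt1 : (1 < p)%N.
Implicit Types q : nat -> R.

(** The extrapolation recursion on an arbitrary sequence, so that the product of means and the
    remaining error can be extrapolated separately. *)
Fixpoint richardson q tau m : R :=
  if tau is tau'.+1 then
    (p%:R ^+ tau * richardson q tau' m.+1 - richardson q tau' m) / (p%:R ^+ tau - 1)
  else q m.

Lemma extrapolationE s (C : gen_matrices p s) (f : vecR R s -> R) tau m :
  extrapolation C f tau m = richardson (fun n => qmc_rule n n C f) tau m.
Proof. by elim: tau m => //= tau IHtau m; rewrite !IHtau. Qed.

Lemma richardsonD q q' tau m :
  richardson (fun n => q n + q' n) tau m = richardson q tau m + richardson q' tau m.
Proof. by elim: tau m => //= tau IHtau m; rewrite !IHtau; ring. Qed.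

Lemma pX_gt2 e : (0 < e)%N -> 2 <= p%:R ^+ e :> R.
Proof.
case: e => // e _; rewrite -natrX ler_nat expnS.
by rewrite (leq_trans p_gt1)// leq_pmulr// expn_gt0 ltnW.
Qed.

(** One step multiplies the bound by (P + 1)/(P - 1) with P a positive power of p, which is at most
    3 since P is at least 2. *)
Lemma richardson_bound q tau m (c : R) :
  (forall i, (i <= tau)%N -> `|q (m + i)%N| <= c) ->
  `|richardson q tau m| <= 3 ^+ tau * c.
Proof.
elim: tau m => [|tau IHtau] m qc; first by have := qc 0%N; rewrite addn0 mul1r; exact.
have H1 : `|richardson q tau m.+1| <= 3 ^+ tau * c.
  by apply: IHtau => i it; rewrite addSnnS; exact: qc.
have H0 : `|richardson q tau m| <= 3 ^+ tau * c.
  by apply: IHtau => i it; apply: qc; rewrite leqW.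
have := @pX_gt2 tau.+1 isT; rewrite [richardson _ _ _]/=.
move: (p%:R ^+ tau.+1) => P P2; rewrite exprS -mulrA.
move: (3 ^+ tau * c) H0 H1 => B H0 H1.
have P1 : 0 < P - 1 by lra.
rewrite normrM normfV (gtr0_norm P1) ler_pdivrMr//.
apply: le_trans (ler_normB _ _) _; rewrite normrM ger0_norm; last by lra.
have : P * `|richardson q tau m.+1| <= P * B by rewrite ler_wpM2l//; lra.
have B0 : 0 <= B by rewrite (le_trans _ H0).
nra.
Qed.

(* Step tau+1 multiplies the component P^n by p^(tau+1) * P - 1. *)
Lemma richardson_geometric (c P : R) tau m :
  richardson (fun n => c * P ^+ n) tau m =
  c * P ^+ m * \prod_(1 <= i < tau.+1) ((p%:R ^+ i * P - 1) / (p%:R ^+ i - 1)).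
Proof.
elim: tau m => [|tau IHtau] m; first by rewrite big_geq// mulr1.
rewrite big_nat_recr//= !IHtau [P ^+ m.+1]exprS.
by move: (_ - 1)^-1 (\prod_(1 <= _ < _) _) => X Y; ring.
Qed.

Lemma richardson_cst (c : R) tau m : richardson (fun=> c) tau m = c.
Proof.
elim: tau m => //= tau IHtau m; rewrite !IHtau.
by have := @pX_gt2 tau.+1 isT => P2; field; lra.
Qed.

(** Step sigma contributes the factor p^sigma p^-sigma - 1 = 0. *)
Lemma richardson_kill (c : R) sigma tau m : (0 < sigma <= tau)%N ->
  richardson (fun n => c / (p%:R ^+ sigma) ^+ n) tau m = 0.
Proof.
move=> /andP[s0 st]; under eq_fun do rewrite -exprVn.
rewrite richardson_geometric (bigD1_seq sigma) ?iota_uniq ?mem_index_iota//=.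
  rewrite mulfV ?subrr ?mul0r ?mulr0//.
  by have := pX_gt2 s0 => P2; rewrite gt_eqF//; lra.
by rewrite s0.
Qed.

End Richardson.

(** * The extrapolated rule applied to a Bernoulli kernel *)

Section KernelBound.
Context {R : realType}.

Lemma smooth_samples_le alpha (c c' : R) N F : c <= c' ->
  smooth_samples alpha c N F -> smooth_samples alpha c' N F.
Proof.
move=> cc' H r l ra la; apply: le_trans (H r l ra la) _.
by rewrite -!mulrA ler_wpM2r// divr_ge0 ?exprn_ge0 ?ler0n.
Qed.

Lemma bernoulli_constant alpha : (1 < alpha)%N -> exists2 c : R, 1 <= c &
  forall N, (0 < N)%N ->
  [/\ forall tau, (tau <= alpha)%N ->
        smooth_samples alpha c N (fun a => b_fun tau (a%:R / N%:R)),
      forall y, smooth_samples alpha c N (fun a => b_per alpha (y - a%:R / N%:R)),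
      forall tau, (tau <= alpha)%N -> `|b_fun tau 0| <= c &
      forall y, `|(\sum_(a < N) b_per alpha (y - a%:R / N%:R)) / N%:R| <= c / N%:R ^+ alpha].
Proof.
move=> alpha1.
have /choice[c1 H1] : forall tau, exists c : R, 0 <= c /\
    forall N, (0 < N)%N -> smooth_samples alpha c N (fun a => b_fun tau (a%:R / N%:R)).
  move=> tau; have [c c0 H] := smooth_samples_poly alpha (@b_poly R tau).
  exists c; split=> // N /H.
  by rewrite (_ : (fun a => b_fun _ _) = (fun a => (b_poly tau).[a%:R / N%:R]))//;
    apply/funext => a; rewrite b_polyE.
have [c2 c20 H2] := @smooth_samples_b_per R alpha alpha1.
have [c3 c30 H3] := @b_per_mean R alpha alpha1.
pose S1 := \sum_(i < alpha.+1) c1 i; pose S3 := \sum_(i < alpha.+1) `|b_fun i 0| : R.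
have S10 : 0 <= S1 by rewrite sumr_ge0// => i _; have [] := H1 i.
have S30 : 0 <= S3 by rewrite sumr_ge0.
exists (1 + S1 + c2 + c3 + S3) => [|N N0]; first by lra.
split=> [tau ta|y|tau ta|y].
- have [_ /(_ N N0)] := H1 tau; apply: smooth_samples_le.
  suff : c1 tau <= S1 by lra.
  rewrite /S1 (bigD1 (Ordinal (ta : (tau < alpha.+1)%N)))//= lerDl sumr_ge0// => i _.
  by have [] := H1 i.
- by apply: smooth_samples_le (H2 N y N0); lra.
- suff : `|b_fun tau 0| <= S3 by lra.
  by rewrite /S3 (bigD1 (Ordinal (ta : (tau < alpha.+1)%N)))//= lerDl sumr_ge0.
- apply: le_trans (H3 N y N0) _; rewrite ler_wpM2r ?invr_ge0 ?exprn_ge0 ?ler0n//; lra.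
Qed.

(** A geometric sum with ratio at least 2 lies between its last term and the power that would come
    next. *)
Lemma total_evaluations_bounds p alpha m : (1 < p)%N -> (0 < alpha)%N ->
  (p ^ (m + alpha.-1) <= total_evaluations p alpha m <= p ^ (m + alpha))%N.
Proof.
move=> p1 a0; apply/andP; split.
  by case: alpha a0 => // a _; rewrite /total_evaluations big_ord_recr leq_addl.
rewrite /total_evaluations; elim: alpha {a0} => [|a IHa]; first by rewrite big_ord0.
rewrite big_ord_recr /= addnS expnS.
rewrite (leq_trans (leq_add IHa (leqnn _)))// addnn -mul2n leq_mul2r p1 orbT//.
Qed.

Lemma log_base_ge p (n : nat) (x : R) : (1 < p)%N -> p%:R ^+ n <= x ->
  n%:R <= log_base p x.
Proof.
move=> p1 nx; have p0 : 0 < p%:R :> R by rewrite ltr0n ltnW.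
have lp : 0 < ln p%:R :> R by rewrite ln_gt0// ltr1n.
have pn : 0 < p%:R ^+ n :> R by rewrite exprn_gt0.
rewrite /log_base ler_pdivlMr// mulr_natl -lnXn//.
by rewrite ler_ln// posrE (lt_le_trans pn).
Qed.

Variables (p alpha t : nat).
Hypotheses (p_prime : prime p) (alpha_gt1 : (1 < alpha)%N).

Let p_gt1 : (1 < p)%N. Proof. exact: prime_gt1. Qed.
Let p_gt0 : (0 < p)%N. Proof. exact: prime_gt0. Qed.
Let alpha_gt0 : (0 < alpha)%N. Proof. exact: ltnW. Qed.
Let P0 e : 0 < p%:R ^+ e :> R. Proof. by rewrite exprn_gt0// ltr0n. Qed.

Definition bernoulli_kernel s (u v : {set 'I_s}) (beta : {ffun 'I_s -> 'I_alpha.+1})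
    (y x : vecR R s) : R :=
  (\prod_(j in u :\: v) b_fun (beta j) (Defs.coord x j)) *
  \prod_(j in v) b_per alpha (Defs.coord y j - Defs.coord x j).

Lemma richardson_kernel_bound : exists K : nat -> R, (forall k, 0 < K k) /\
  forall s (C : gen_matrices p s) m (u v : {set 'I_s}) beta (y : vecR R s),
    order_digital_sequence alpha t C -> (0 < m)%N -> (t < alpha * m)%N ->
    u != finset.set0 -> v \subset u -> beta \in orders alpha u v ->
    let N : R := (total_evaluations p alpha m)%:R in
    `|extrapolation C (bernoulli_kernel u v beta y) alpha.-1 m| <=
      K #|u| * (log_base p N ^+ (alpha * #|u|) / N ^+ alpha).
Proof.
have [c c1 Hc] := bernoulli_constant alpha_gt1.
have c0 : 0 < c by rewrite (lt_le_trans _ c1).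
(* [K1] is the net bound without its powers of n. [K] adds [c ^+ k] for the product of means, a 3
   for each extrapolation step, and p^(alpha^2) for passing from p^m to N. *)
pose K1 k : R := (c * p%:R ^+ (2 * alpha)) ^+ k * (p%:R ^+ alpha) ^+ k * p%:R ^+ (t + alpha).
pose K k : R := 3 ^+ alpha.-1 * (K1 k + c ^+ k) * p%:R ^+ (alpha * alpha).
have K10 k : 0 < K1 k.
  apply: mulr_gt0; last exact: P0.
  by apply: mulr_gt0; apply: exprn_gt0 => //; exact: mulr_gt0.
exists K; split=> [k|].
  apply: mulr_gt0; last exact: P0.
  by apply: mulr_gt0; [rewrite exprn_gt0|rewrite addr_gt0// exprn_gt0].
move=> s C m u v beta y [_ Cnet] m0 tm u0 vu Hb; lazy zeta.
set N : R := (total_evaluations _ _ _)%:R.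
have betaP j : if j \in v then beta j == alpha :> nat
    else if j \in u then (0 < beta j)%N else beta j == 0%N :> nat.
  by move: Hb; rewrite inE => /forallP/(_ j).
pose phi j x : R := if j \in v then b_per alpha (Defs.coord y j - x)
  else if j \in u then b_fun (beta j) x else 1.
have kE x : bernoulli_kernel u v beta y x = \prod_j phi j (Defs.coord x j).
  rewrite /bernoulli_kernel big_mkcond [X in _ * X]big_mkcond -big_split /=.
  apply: eq_bigr => j _; rewrite /phi finset.in_setD.
  by case: (j \in v); rewrite ?mul1r//=; case: (j \in u); rewrite mulr1.
pose mean n j := (\sum_(a < p ^ n) phi j (a%:R / (p ^ n)%:R)) / (p ^ n)%:R.
pose Z n := \prod_(j in u) mean n j.
pose E n := qmc_rule n n C (bernoulli_kernel u v beta y) - Z n.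
have pn0 n : (0 < p ^ n)%N by rewrite expn_gt0 p_gt0.
have ba j : (beta j <= alpha)%N by rewrite -ltnS.
have HE n : (m <= n)%N -> `|E n| <= K1 #|u| * n%:R ^+ (alpha * #|u|) / p%:R ^+ (alpha * n).
  move=> mn; rewrite /E (_ : bernoulli_kernel _ _ _ _ = fun x => \prod_j phi j (Defs.coord x j)); last first.
    by apply/funext => x; rewrite kE.
  have tn : (t < alpha * n)%N by rewrite (leq_trans tm)// leq_mul2l mn orbT.
  have n0 : (0 < n)%N by rewrite (leq_trans m0).
  apply: le_trans (qmc_rule_prod_error (u := u) (c := c) p_prime alpha_gt0 n0 (Cnet n tn) (ltW c0) _ _) _.
  - move=> j ju; have [H1 H2 _ _] := Hc _ (pn0 n).
    by rewrite /phi ju; case: (j \in v); [exact: H2|exact: H1].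
  - move=> j x ju; rewrite /phi (negPf ju) ifN//.
    by apply: contraNN ju; apply: (fintype.subsetP vu).
  rewrite le_eqVlt; apply/orP; left; apply/eqP.
  rewrite /K1 natrM [(_ * p%:R) ^+ alpha]exprMn [(n%:R ^+ alpha * _) ^+ _]exprMn.
  rewrite [n%:R ^+ (alpha * _)]exprM.
  ring.
have meanE n j : j \in u -> j \notin v -> mean n j = b_fun (beta j) 0 / (p%:R ^+ n) ^+ beta j.
  move=> ju jv; rewrite /mean /phi (negPf jv) ju -natrX -b_fun_mult//; congr (_ / _).
  by apply: eq_bigr => a _; rewrite add0r.
have HZ n : (alpha <= \sum_(j in u) beta j)%N -> `|Z n| <= c ^+ #|u| / p%:R ^+ (alpha * n).
  move=> ab; rewrite /Z normr_prod.
  apply: (@le_trans _ _ (\prod_(j in u) (c * ((p%:R ^+ n) ^+ beta j)^-1))).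
    apply: ler_prod => j ju; rewrite normr_ge0 /=.
    have [_ _ H3 H4] := Hc _ (pn0 n); have [jv|jv] := boolP (j \in v).
      have := betaP j; rewrite jv => /eqP ->.
      by have := H4 (Defs.coord y j); rewrite /mean /phi jv natrX.
    rewrite meanE// normrM normfV [`|_ ^+ beta j|]ger0_norm ?exprn_ge0 ?ler0n//.
    by rewrite ler_wpM2r ?invr_ge0 ?exprn_ge0 ?ler0n// H3.
  rewrite big_split /= prodr_const prodfV ler_wpM2l ?exprn_ge0 ?(ltW c0)//.
  rewrite lef_pV2 ?posrE ?prodr_gt0// => [|j _]; last by rewrite -exprM P0.
  rewrite -(big_morph (fun e => (p%:R ^+ n) ^+ e : R) (exprD _) (expr0 _)).
  by rewrite -exprM ler_weXn2l ?ler1n// mulnC leq_mul2l ab orbT.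
(* An index in [v] would contribute alpha by itself, so here [v] is empty and every mean is known
   exactly; sigma > 0 because [u] is not empty. *)
have Zkill : (\sum_(j in u) beta j < alpha)%N -> richardson p Z alpha.-1 m = 0.
  move=> ab; have v0 j : j \in u -> j \notin v.
    move=> ju; apply: contraTN ab => jv; rewrite -leqNgt (bigD1 j)//=.
    by have := betaP j; rewrite jv => /eqP ->; rewrite leq_addr.
  pose sigma := (\sum_(j in u) beta j)%N.
  have -> : Z = fun n => (\prod_(j in u) b_fun (beta j) 0) / (p%:R ^+ sigma) ^+ n.
    apply/funext => n; rewrite /Z (eq_bigr _ (fun j ju => meanE n j ju (v0 j ju))).
    rewrite big_split prodfV /=; congr (_ / _).
    rewrite -(big_morph (fun e => (p%:R ^+ n) ^+ e : R) (exprD _) (expr0 _)).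
    by rewrite -!exprM mulnC.
  apply: richardson_kill => //; apply/andP; split; last by rewrite -ltnS prednK.
  have /finset.set0Pn[j ju] := u0; rewrite /sigma (bigD1 j)//= addn_gt0.
  by have := betaP j; rewrite (negPf (v0 j ju)) ju => ->.
have /andP[N1 N2] := total_evaluations_bounds m p_gt1 alpha_gt0.
(* Covers every n that the extrapolation uses, as N is at least p^(m + alpha - 1). *)
have Nn n : (n < m + alpha)%N -> n%:R <= log_base p N.
  move=> nm; apply: log_base_ge => //; rewrite -natrX ler_nat (leq_trans _ N1)//.
  by rewrite leq_exp2l//; lia.
have N0 : 0 < N by rewrite ltr0n (leq_trans _ N1).
have L1 : 1 <= log_base p N by apply: (Nn 1%N); lia.
set L := log_base p N in Nn L1 *.
pose B := L ^+ (alpha * #|u|) * p%:R ^+ (alpha * alpha) / N ^+ alpha.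
have LX0 : 1 <= L ^+ (alpha * #|u|) by rewrite exprn_ege1.
(* N is at most p^(m + alpha), hence at most p^(n + alpha). *)
have pB n : (m <= n)%N -> (p%:R ^+ (alpha * n))^-1 <= p%:R ^+ (alpha * alpha) / N ^+ alpha.
  move=> mn; rewrite -[leLHS]mul1r ler_pdivrMr// mulrAC ler_pdivlMr ?exprn_gt0//.
  rewrite mul1r -exprD -mulnDr mulnC exprM -natrX -!natrX ler_nat.
  rewrite leq_exp2r//= (leq_trans N2)// leq_exp2l// addnC leq_add2l//.
have HEB i : (i <= alpha.-1)%N -> `|E (m + i)%N| <= K1 #|u| * B.
  move=> ia; apply: le_trans (HE _ (leq_addr _ _)) _.
  rewrite -[leLHS]mulrA ler_wpM2l ?(ltW (K10 _))// /B -[leRHS]mulrA; apply: ler_pM => //.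
  + apply: lerXn2r; rewrite ?nnegrE ?ler0n//; first by rewrite (le_trans _ L1).
    by apply: Nn; lia.
  + by apply: pB; rewrite leq_addr.
have HZB i : (alpha <= \sum_(j in u) beta j)%N -> `|Z (m + i)%N| <= c ^+ #|u| * B.
  move=> ab; apply: le_trans (HZ _ ab) _; rewrite ler_wpM2l ?exprn_ge0 ?(ltW c0)//.
  apply: le_trans (pB _ (leq_addr _ _)) _; rewrite /B -mulrA ler_peMl//.
  by rewrite divr_ge0 ?exprn_ge0// ltW.
have B0 : 0 <= B by rewrite !mulr_ge0 ?invr_ge0 ?exprn_ge0 ?(le_trans _ L1) ?ler0n// ltW.
rewrite extrapolationE.
have -> : (fun n => qmc_rule n n C (bernoulli_kernel u v beta y)) = fun n => E n + Z n.
  by apply/funext => n; rewrite subrK.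
rewrite richardsonD; apply: le_trans (ler_normD _ _) _.
have -> : K #|u| * (L ^+ (alpha * #|u|) / N ^+ alpha) =
    3 ^+ alpha.-1 * (K1 #|u| * B) + 3 ^+ alpha.-1 * (c ^+ #|u| * B).
  rewrite /K /B; ring.
apply: lerD; first exact: (richardson_bound p_gt1 HEB).
have [ab|ab] := leqP alpha (\sum_(j in u) beta j)%N.
  by apply: (richardson_bound p_gt1) => i _; exact: HZB.
rewrite Zkill// normr0; apply: mulr_ge0; first exact: exprn_ge0.
by apply: mulr_ge0 => //; apply: exprn_ge0; exact: ltW.
Qed.

End KernelBound.

(** * Integration over the cube *)

Section CubeMeasure.
Context {R : realType}.
Local Open Scope ereal_scope.
Local Notation mu := (@cube_measure R).

Lemma integral_prob_cst d (T : measurableType d) (P : probability T R) (c : \bar R) :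
  \int[P]_x c = c.
Proof.
have -> : \int[P]_x c = \int[P]_x cst c x by [].
by rewrite (integral_cst P measurableT) [X in _ * X](@probability_setT _ _ _ P) mule1.
Qed.

Lemma ge0_integral_cubeS s (f : vecR R s.+1 -> \bar R) :
  measurable_fun [set: vecR R _] f -> (forall x, 0 <= f x) ->
  \int[mu s.+1]_x f x = \int[unit_measure]_a \int[mu s]_x f (point_cons (a, x)).
Proof.
move=> mf f0; rewrite (ge0_integral_distribution (@point_cons R s))//.
rewrite fubini_tonelli1 => [//||x]; last exact: f0.
exact: (measurableT_comp mf (@measurable_point_cons R s)).
Qed.

Lemma measurable_tuple d (T : measurableType d) s (F : T -> vecR R s) :
  (forall j, measurable_fun setT (fun x => tnth (F x) j)) -> measurable_fun setT F.
Proof. by move=> mF; apply/measurable_fun_tnthP. Qed.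

Lemma measurable_splice s (v : {set 'I_s}) :
  measurable_fun setT (fun z : vecR R s * vecR R s => splice v z.1 z.2).
Proof.
apply: measurable_tuple => j; under eq_fun do rewrite tnth_mktuple.
case: (j \in v).
  exact: (measurableT_comp (measurable_tnth j) measurable_fst).
exact: (measurableT_comp (measurable_tnth j) measurable_snd).
Qed.

Lemma splice_cons s (v : {set 'I_s.+1}) a b (x y : vecR R s) :
  splice v (point_cons (a, x)) (point_cons (b, y)) =
  point_cons (if ord0 \in v then a else b, splice [set j | lift ord0 j \in v]%SET x y).
Proof.
apply: eq_from_tnth => j; rewrite tnth_mktuple.
case: (unliftP ord0 j) => [i ->|->] //.
by rewrite !tnthS tnth_mktuple inE.
Qed.

(** Splicing carries the product of two copies of the cube measure to the cube measure. Induction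
    peels off the first coordinate: one of its two copies is a dummy and integrates to 1. *)
Lemma ge0_integral_splice s (v : {set 'I_s}) (f : vecR R s -> \bar R) :
  measurable_fun [set: vecR R _] f -> (forall x, 0 <= f x) ->
  \int[mu s]_x \int[mu s]_y f (splice v x y) = \int[mu s]_z f z.
Proof.
elim: s v f => [|s IHs] v f mf f0.
  apply: eq_integral => x _; rewrite (eq_integral (cst (f x))).
    by rewrite integral_prob_cst.
  by move=> y _; congr f; apply: eq_from_tnth => -[].
set v' := [set j | lift ord0 j \in v]%SET.
have mS := measurableT_comp mf (@measurable_splice s.+1 v).
rewrite ge0_integral_cubeS; first last.
- by move=> x; apply: integral_ge0.
- exact: (measurable_fun_fubini_tonelli_F (m2 := mu s.+1)
    (fun z => f (splice v z.1 z.2)) mS).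
have mcons d (T : measurableType d) (h : T -> measurableTypeR R) (k : T -> vecR R s) :
    measurable_fun setT h -> measurable_fun setT k ->
    measurable_fun setT (fun z => f (point_cons (h z, k z))).
  move=> mh mk; apply: (measurableT_comp mf).
  apply: (measurableT_comp (@measurable_point_cons R s)).
  exact: measurable_fun_pair.
have inner a x : \int[mu s.+1]_y f (splice v (point_cons (a, x)) y) =
    \int[unit_measure]_b \int[mu s]_y
      f (point_cons (if ord0 \in v then a else b, splice v' x y)).
  rewrite ge0_integral_cubeS//.
    by apply: eq_integral => b _; apply: eq_integral => y _; rewrite splice_cons.
  exact: (measurableT_comp mS (measurable_pair1 (point_cons (a, x)))).
under eq_integral => a _ do under eq_integral => x _ do rewrite inner.
rewrite [RHS]ge0_integral_cubeS//.
have mSp : measurable_fun setT (fun z : vecR R s * vecR R s => splice v' z.1 z.2).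
  exact: measurable_splice.
have mf' a : measurable_fun setT (fun x => f (point_cons (a, x))).
  have H := mcons _ (vecR R s) (fun=> a) (fun x : vecR R s => x).
  by apply: H; [exact: measurable_cst|exact: measurable_id].
case: (ord0 \in v) => /=.
  apply: eq_integral => a _; rewrite -(IHs v' _ (mf' a) (fun=> f0 _)).
  apply: eq_integral => x _; exact: integral_prob_cst.
rewrite integral_prob_cst.
(* With the first coordinate outside [v], its live copy belongs to y, so its integral must be moved
   past the one over x. *)
rewrite (fubini_tonelli (fun z : vecR R s * measurableTypeR R =>
  \int[mu s]_y f (point_cons (z.2, splice v' z.1 y)))); first last.
- by move=> z; apply: integral_ge0.
- pose F (z : (vecR R s * measurableTypeR R) * vecR R s) :=
    f (point_cons (z.1.2, splice v' z.1.1 z.2)).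
  have mF : measurable_fun setT F.
    have H := mcons _ ((vecR R s * measurableTypeR R) * vecR R s)%type
      (fun z => z.1.2) (fun z => splice v' z.1.1 z.2).
    apply: H; first exact: (measurableT_comp measurable_snd measurable_fst).
    exact: (measurableT_comp mSp (measurable_fun_pair
      (measurableT_comp measurable_fst measurable_fst) measurable_snd)).
  exact: (measurable_fun_fubini_tonelli_F (m2 := mu s) F mF (fun=> f0 _)).
apply: eq_integral => b _; by rewrite -(IHs v' _ (mf' b) (fun=> f0 _)).
Qed.

End CubeMeasure.

Section Transfer.
Context {R : realType}.
Local Open Scope ereal_scope.

(** Tonelli provides the identity for nonnegative functions; positive and negative parts extend it
    to integrable ones. *)
Lemma integral_transfer d1 d2 (T1 : measurableType d1) (T2 : measurableType d2)
    (P1 : probability T1 R) (P2 : probability T2 R) (S : T1 -> T2) :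
  measurable_fun setT S ->
  (forall f : T2 -> \bar R, measurable_fun setT f -> (forall x, 0 <= f x) ->
    \int[P1]_x f (S x) = \int[P2]_y f y) ->
  forall f : T2 -> \bar R, P2.-integrable setT f ->
    P1.-integrable setT (f \o S) /\ \int[P1]_x f (S x) = \int[P2]_y f y.
Proof.
move=> mS SE f /integrableP[mf intf]; split.
  apply/integrableP; split; first exact: measurableT_comp.
  by rewrite (SE (fun x => `|f x|))//; exact: measurableT_comp.
rewrite integralE [RHS]integralE; congr (_ - _).
  by rewrite -(SE f^\+ (measurable_funepos mf) (fun=> funepos_ge0 _ _));
    apply: eq_integral => x _; rewrite !funeposE.
by rewrite -(SE f^\- (measurable_funeneg mf) (fun=> funeneg_ge0 _ _));
  apply: eq_integral => x _; rewrite !funenegE.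
Qed.

Lemma integrable_bounded_mul d (T : measurableType d) (P : probability T R)
    (g h : T -> R) (c : R) :
  P.-integrable setT (EFin \o g) -> measurable_fun setT h ->
  (forall x, (`|h x| <= c)%R) -> P.-integrable setT (EFin \o (fun x => g x * h x)%R).
Proof.
move=> ig mh hc; suff bh : [bounded h x | x in setT].
  exact: (integrableMl measurableT ig mh bh).
exists c; split; first exact: num_real.
by move=> y cy x _ /=; rewrite (le_trans (hc x))// ltW.
Qed.

Variable s : nat.
Local Notation mu := (@cube_measure R s).

Lemma integrable_snd (g : vecR R s -> \bar R) : mu.-integrable setT g ->
  (mu \x mu)%E.-integrable setT (fun z => g z.2).
Proof.
have H := @integral_transfer _ _ _ _ [the probability _ _ of (mu \x mu)%E] mu snd measurable_snd.
move=> ig; have [] // := H _ g ig.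
move=> f mf f0; rewrite fubini_tonelli1//; first by rewrite /fubini_F /= integral_prob_cst.
exact: (measurableT_comp mf measurable_snd).
Qed.

End Transfer.

Section CubeIntegrals.
Context {R : realType}.
Variable s : nat.
Local Notation mu := (@cube_measure R s).
Local Notation mu2 := [the probability (vecR R s * vecR R s)%type R of (mu \x mu)%E].
Implicit Types (g h : vecR R s -> R).

Lemma EFin_cube_int h : cube_integrable h ->
  (cube_int h)%:E = (\int[mu]_x (h x)%:E)%E.
Proof. by move=> ih; rewrite fineK//; exact: integrable_fin_num. Qed.

Lemma cube_integrable_bounded h c : measurable_fun setT h ->
  (forall x, `|h x| <= c) -> cube_integrable h.
Proof.
move=> mh hc; have i1 : mu.-integrable setT (EFin \o (fun=> 1%R)).
  by apply: finite_measure_integrable_cst.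
have := integrable_bounded_mul i1 mh hc.
by rewrite /cube_integrable;
  under [X in _ -> mu.-integrable _ (EFin \o X)]eq_fun do rewrite -[h _]mul1r.
Qed.

Section Kernel.
Variables (g : vecR R s -> R) (kappa : vecR R s * vecR R s -> R) (c : R).
Hypotheses (ig : cube_integrable g) (mk : measurable_fun setT kappa)
  (kc : forall z, `|kappa z| <= c).

Let ik : (mu \x mu)%E.-integrable setT (EFin \o (fun z => g z.2 * kappa z)).
Proof.
by apply: (@integrable_bounded_mul R _ _ mu2 (fun z => g z.2) kappa c (integrable_snd ig)).
Qed.

Lemma cube_integrable_kernel x : cube_integrable (fun y => g y * kappa (x, y)).
Proof.
apply: (@integrable_bounded_mul R _ _ mu g (fun y => kappa (x, y)) c) => //.
exact: (measurableT_comp mk (measurable_pair1 x)).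
Qed.

Lemma integrable_kernel_int :
  cube_integrable (fun x => cube_int (fun y => g y * kappa (x, y))).
Proof.
have := integrable_fubini_F ik; apply: eq_integrable => // x _ /=.
by rewrite EFin_cube_int//; exact: cube_integrable_kernel.
Qed.

Lemma kernel_fubini : cube_int (fun x => cube_int (fun y => g y * kappa (x, y))) =
  cube_int (fun y => g y * cube_int (fun x => kappa (x, y))).
Proof.
rewrite /cube_int /Rintegral; congr fine.
transitivity (\int[mu]_x fubini_F mu (EFin \o (fun z => g z.2 * kappa z)%R) x)%E.
  apply: eq_integral => x _.
  exact: (EFin_cube_int (cube_integrable_kernel x)).
rewrite (integral12_prod_meas1 ik) -(integral21_prod_meas1 ik).
apply: eq_integral => y _; rewrite /fubini_G /=.
have iy : cube_integrable (fun x => kappa (x, y)).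
  apply: (cube_integrable_bounded (c := c)) => //.
  exact: (measurableT_comp mk (measurable_pair2 y)).
rewrite -RintegralZl// -EFin_cube_int//.
rewrite /cube_integrable (_ : EFin \o _ = (fun x => ((g y)%:E * (kappa (x, y))%:E)%E)).
  exact: integrableZl.
by apply/funext.
Qed.

End Kernel.

Lemma integrable_splice v h : cube_integrable h ->
  (mu \x mu)%E.-integrable setT (EFin \o (fun z => h (splice v z.1 z.2))) /\
  (\int[mu \x mu]_z (h (splice v z.1 z.2))%:E = \int[mu]_z (h z)%:E)%E.
Proof.
move=> ih; apply: (@integral_transfer R _ _ _ _ mu2 mu (fun z => splice v z.1 z.2) _ _ _ ih).
  exact: measurable_splice.
move=> f mf f0; rewrite -(ge0_integral_splice v mf f0) fubini_tonelli1//.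
exact: (measurableT_comp mf (measurable_splice v)).
Qed.

Lemma partial_int_measurable v g : cube_integrable g ->
  measurable_fun setT (partial_int v g).
Proof.
move=> /(integrable_splice v)[ig _].
apply: (measurableT_comp (fine_measurable measurableT)).
exact: measurable_fubini_F ig.
Qed.

(** Write the integral as a double one through [splice]. As [K] sees only the coordinates in [v], it
    leaves the inner integral, which becomes the partial integral of [g]. *)
Lemma cube_int_partial_bound v g (K : vecR R s -> R) (c : R) :
  cube_integrable g -> measurable_fun setT K ->
  (forall x, `|K x| <= c) -> (forall x y, K (splice v x y) = K x) ->
  (`|cube_int (fun y => g y * K y)|%:E <=
    c%:E * \int[mu]_x (`|partial_int v g x|)%:E)%E.
Proof.
move=> ig mK Kc Kv.
have igK : cube_integrable (fun y => g y * K y) by exact: integrable_bounded_mul Kc.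
have [is1 is2] := integrable_splice v igK.
have [it1 it2] := integrable_splice v ig.
have mP := partial_int_measurable v ig.
have c0 : 0 <= c by rewrite (le_trans _ (Kc [tuple 0 | j < s])).
rewrite (EFin_normr_Rintegral measurableT igK) -is2 -(integral12_prod_meas1 is1).
apply: le_trans (le_abse_integral mu measurableT (measurable_fubini_F is1)) _.
rewrite -ge0_integralZl//; first last.
- by apply/measurable_EFinP; exact: measurableT_comp.
apply: ae_ge0_le_integral => //.
- by apply: measurableT_comp => //; exact: measurable_fubini_F is1.
- by move=> x _; rewrite -EFinM lee_fin mulr_ge0.
- apply: emeasurable_funM => //; apply/measurable_EFinP; exact: measurableT_comp.
(* The inner integrand is integrable only for almost every x. *)
have := ae_integrable1 it1; apply: filterS => x ix _.
rewrite /fubini_F /=.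
under eq_integral do rewrite Kv mulrC EFinM.
rewrite integralZl// -(EFin_cube_int ix) -EFinM lee_fin normrM ler_wpM2r//.
Qed.

End CubeIntegrals.

(** * Mean values of the one-dimensional kernels *)

Section UnitIntegrals.
Context {R : realType}.
Local Notation leb := (@lebesgue_measure R).

Lemma integral_poly (q Q : {poly R}) (a b : R) : Q^`() = q -> a <= b ->
  (\int[leb]_(x in `[a, b]) (q.[x])%:E = (Q.[b] - Q.[a])%:E)%E.
Proof.
move=> Qq; rewrite le_eqVlt => /predU1P[<-|ab].
  by rewrite set_itv1 integral_set1 subrr.
rewrite (@continuous_FTC2 R (horner q) (horner Q)) ?EFinB//.
- by apply: continuous_subspaceT => x; exact: continuous_horner.
- split=> [x _||].
  + by apply: ex_derive; exact: is_derive_poly.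
  + by apply: cvg_at_right_filter; exact: continuous_horner.
  + by apply: cvg_at_left_filter; exact: continuous_horner.
- by move=> x _; rewrite derive1E (@derive_val _ _ _ _ _ _ _ (is_derive_poly Q x)) Qq.
Qed.

Lemma integral_unit (f : R -> R) : measurable_fun setT f ->
  (\int[@unit_measure R]_x (f x)%:E = \int[leb]_(x in `[0%R, 1%R[) (f x)%:E)%E.
Proof.
move=> mf; pose D : set R := `[0%R, 1%R[%classic.
have mD : measurable D by exact: measurable_itv.
transitivity (\int[@unit_measure R]_(x in D) (f x)%:E)%E.
  rewrite [RHS]integral_mkcond; apply: ae_eq_integral => //.
  - by apply/measurable_EFinP.
  - by apply/(measurable_restrictT _ mD)/measurable_EFinP; exact: measurable_funTS.
  exists (~` D); split; first exact: measurableC.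
    rewrite /= /unit_measure /mrestr (_ : _ `&` _ = set0) ?measure0//.
    exact: setICl.
  move=> x /= H; apply: contra_not H => Dx _.
  by rewrite patchE mem_set.
apply: eq_measure_integral => A mA AD.
by rewrite /= /unit_measure /mrestr (_ : A `&` _ = A)//; exact/setIidPl.
Qed.

Lemma deriv_b_poly tau : (@b_poly R tau.+1)^`() = b_poly tau.
Proof.
rewrite /b_poly derivZ deriv_bernoulli_poly scalerA factS natrM invfM mulrAC.
by rewrite mulVf ?mul1r// pnatr_eq0.
Qed.

Lemma measurable_b_per tau : measurable_fun setT (@b_per R tau).
Proof.
rewrite /b_per; under eq_fun do rewrite b_polyE.
apply: (measurableT_comp (f := horner (b_poly tau))).
  by apply: continuous_measurable_fun; exact: continuous_horner.
apply: measurable_funB => //; apply: nondecreasing_measurable => // x y xy.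
by rewrite ler_int le_floor.
Qed.

Lemma integral_piece (f : R -> R) (q Q : {poly R}) (a b : R) :
  measurable_fun setT f -> Q^`() = q -> a <= b ->
  (forall x, a < x < b -> f x = q.[x]) ->
  (\int[leb]_(x in `[a, b[) (f x)%:E = (Q.[b] - Q.[a])%:E)%E.
Proof.
move=> mf Qq ab fq; rewrite -(integral_poly Qq ab).
have mfE : measurable_fun `]a, b[ (EFin \o f).
  by apply/measurable_EFinP; exact: measurable_funTS.
have mqE : measurable_fun `]a, b[ (EFin \o horner q).
  apply/measurable_EFinP; apply: measurable_funTS.
  apply: continuous_measurable_fun; exact: continuous_horner.
rewrite (integral_itv_bndoo _ _ mfE) (integral_itv_bndoo true false mqE).
by apply: eq_integral => x; rewrite inE /= in_itv /= => /fq ->.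
Qed.

Lemma integral_b_per tau : (0 < tau)%N ->
  (\int[@unit_measure R]_x (b_per tau x)%:E = 0)%E.
Proof.
move=> tau0; rewrite integral_unit; last exact: measurable_b_per.
rewrite (integral_piece (q := b_poly tau) (Q := b_poly tau.+1)) ?deriv_b_poly//.
- by rewrite -!b_polyE b_fun1// subrr.
- exact: measurable_b_per.
- by move=> x /andP[x0 x1]; rewrite -b_polyE b_per_itv// ltW.
Qed.

Lemma measurable_b_perB tau (y : R) : measurable_fun setT (fun x : R => b_per tau (y - x)).
Proof.
by apply: (measurableT_comp (measurable_b_per tau)); exact: measurable_funB.
Qed.

(** Split at the fractional part z of y. Both arcs have antiderivatives built from the Bernoulli
    function of degree tau + 1 > 1, whose equal values at 0 and 1 make the four endpoint terms
    cancel. *)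
Lemma integral_b_perB tau (y : R) : (0 < tau)%N ->
  (\int[@unit_measure R]_x (b_per tau (y - x))%:E = 0)%E.
Proof.
move=> tau0; rewrite integral_unit; last exact: measurable_b_perB.
pose z := y - (Num.floor y)%:~R.
have z01 : 0 <= z < 1.
  have := ge_floor y; have := floorD1_gt y; rewrite intrD /z; lra.
have yE x : b_per tau (y - x) = b_per tau (z - x) :> R.
  by rewrite -(b_perDz tau (z - x) (Num.floor y)); congr b_per; rewrite /z; ring.
have /andP[z0 z1] := z01.
have -> : `[0%R, 1%R[%classic = (`[0%R, z[ `|` `[z, 1%R[)%classic :> set R.
  by rewrite -itv_bndbnd_setU ?bnd_simp// ltW.
rewrite integral_setU//; first last.
- apply/disj_set2P; rewrite -subset0 => x [] /=; rewrite !in_itv /= => /andP[_ xz].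
  by move=> /andP[zx _]; move: (lt_le_trans xz zx); rewrite ltxx.
- by apply/measurable_EFinP; apply: measurable_funTS; exact: measurable_b_perB.
pose Q0 a : {poly R} := - (b_poly tau.+1 \Po (a%:P - 'X)).
have Q0d a : (Q0 a)^`() = b_poly tau \Po (a%:P - 'X).
  rewrite /Q0 derivN deriv_comp deriv_b_poly derivB derivC derivX sub0r.
  by rewrite mulrN1 opprK.
have Q0E a x : (Q0 a).[x] = - (b_poly tau.+1).[a - x].
  by rewrite /Q0 hornerN horner_comp !hornerE.
rewrite (integral_piece (measurable_b_perB tau y) (Q0d z) z0); last first.
  move=> x /andP[x0 xz]; rewrite horner_comp yE b_per_itv.
    by rewrite b_polyE; congr (_.[_]); rewrite !hornerE.
  by rewrite subr_ge0 ltW//=; lra.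
rewrite (integral_piece (measurable_b_perB tau y) (Q0d (z + 1)) (ltW z1)); last first.
  move=> x /andP[zx x1]; rewrite horner_comp yE -(b_perDz _ _ 1) b_per_itv.
    by rewrite b_polyE; congr (_.[_]); rewrite !hornerE; ring.
  lra.
rewrite !Q0E subrr subr0 addrK [z + 1 - z]addrC addKr -!b_polyE b_fun1//.
by rewrite -EFinD; congr EFin; ring.
Qed.

End UnitIntegrals.

Lemma ge0_integral_coord {R : realType} s (j : 'I_s) (h : measurableTypeR R -> \bar R) :
  measurable_fun setT h -> (forall x, 0 <= h x)%E ->
  (\int[@cube_measure R s]_x h (tnth x j) = \int[@unit_measure R]_a h a)%E.
Proof.
move=> mh h0; elim: s j => [[]//|s IHs] j.
rewrite ge0_integral_cubeS//; last exact: (measurableT_comp mh (measurable_tnth j)).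
case: (unliftP ord0 j) => [i ->|->].
  under eq_integral => a _ do under eq_integral => x _ do rewrite tnthS.
  under eq_integral => a _ do rewrite IHs.
  exact: integral_prob_cst.
by apply: eq_integral => a _; exact: (integral_prob_cst (cube_measure s) (h a)).
Qed.

Lemma cube_int_coord {R : realType} s (j : 'I_s) (h : R -> R) c :
  measurable_fun setT h -> (forall x, `|h x| <= c) ->
  (\int[@unit_measure R]_x (h x)%:E = 0)%E -> cube_int (fun x => h (Defs.coord x j)) = 0.
Proof.
move=> mh hc h0.
have ih : (@unit_measure R).-integrable setT (EFin \o h).
  have i1 : (@unit_measure R).-integrable setT (EFin \o (fun=> 1%R)).
    by apply: finite_measure_integrable_cst.
  have := integrable_bounded_mul i1 mh hc.
  by under [X in integrable _ _ (EFin \o X)]eq_fun do rewrite mul1r.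
have [_ E] := @integral_transfer R _ _ _ _ (cube_measure s) (@unit_measure R)
  (fun x => tnth x j) (measurable_tnth j) (fun f mf f0 => ge0_integral_coord j mf f0)
  (EFin \o h) ih.
by rewrite /cube_int /Rintegral E h0.
Qed.

(** * The Sobolev norm *)

Section NormBound.
Context {R : realType}.
Local Open Scope ereal_scope.

Lemma poweR_le1 (x : \bar R) (r : R) : 0 <= x -> (0 < r)%R -> x `^ r <= 1 -> x <= 1.
Proof.
case: x => [x| |] x0 r0 //; last by rewrite poweRyr ?gt_eqF.
rewrite poweR_EFin !lee_fin; apply: contraTT; rewrite -!ltNge => x1.
have := gt0_ltr_powR r0 _ _ x1; by rewrite powR1; apply; rewrite nnegrE ?ler01.
Qed.

Lemma lee_term_sum (I : finType) (P : pred I) (F : I -> \bar R) i :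
  P i -> (forall j, P j -> 0 <= F j) -> F i <= \sum_(j | P j) F j.
Proof.
move=> Pi F0; rewrite (bigD1 i Pi) leeDl// sume_ge0// => j /andP[Pj _].
exact: F0.
Qed.

(** For c = 0 the convention x/0 = +oo forces x = 0. *)
Lemma weight_div_le1 (x : \bar R) (c : R) : (0 <= c)%R -> 0 <= x ->
  weight_div x c <= 1 -> x <= c%:E.
Proof.
move=> c0 x0; rewrite /weight_div; case: eqP => [->|/eqP c1].
  by case: eqP => [->//|_]; rewrite leye_eq.
have cgt : (0 < c)%R by rewrite lt_neqAle eq_sym c1.
by rewrite lee_pdivrMr ?mul1e.
Qed.

(** Jensen's inequality on a probability space, by integrating Young's inequality for |f|/a and 1.
    Taking a = c + e with e > 0 avoids dividing by zero when c = 0. *)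
Lemma integral_le_of_powR d (T : measurableType d) (P : probability T R)
    (f : T -> R) (q c : R) :
  measurable_fun setT f -> (1 <= q)%R -> (0 <= c)%R ->
  \int[P]_x (`|f x| `^ q)%:E <= (c `^ q)%:E -> \int[P]_x `|f x|%:E <= c%:E.
Proof.
move=> mf q1 c0 Hq; have q0 : (0 < q)%R by rewrite (lt_le_trans _ q1).
apply/lee_addgt0Pr => e e0; rewrite -EFinD; set a := (c + e)%R.
have a0 : (0 < a)%R by rewrite ltr_wpDl.
(* For q = 1 the conjugate exponent is infinite, but the inequality is then an equality. *)
have fa x : (`|f x| <= a / q * (`|f x| / a) `^ q + a * (1 - q^-1))%R.
  have xa0 : (0 <= `|f x| / a)%R by rewrite divr_ge0// ltW.
  move: q1; rewrite le_eqVlt => /predU1P[<-|q1].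
    by rewrite invr1 subrr mulr0 addr0 mulr1 powRr1// mulrC divfK// gt_eqF.
  have q'0 : (0 < (1 - q^-1)^-1)%R by rewrite invr_gt0 subr_gt0 invf_lt1.
  have := conjugate_powR xa0 (@ler01 R) q0 q'0; rewrite invrK addrC subrK => /(_ erefl).
  rewrite mulr1 powR1 mul1r => H.
  have := ler_wpM2l (ltW a0) H; rewrite mulrC divfK ?gt_eqF// mulrDr.
  by move/le_trans; apply; rewrite lerD2r mulrA [(_ * _ / q)%R]mulrAC.
have mfq : measurable_fun setT (fun x => (`|f x| `^ q)%:E).
  apply/measurable_EFinP; apply: (measurableT_comp (measurable_powR q)).
  exact: measurableT_comp.
pose A : R := (a / q / a `^ q)%R; pose B : R := (a * (1 - q^-1))%R.
have A0 : (0 <= A)%R by rewrite /A !divr_ge0 ?powR_ge0// ltW.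
have B0 : (0 <= B)%R by rewrite /B mulr_ge0 ?subr_ge0 ?invf_le1// ltW.
have fA x : (`|f x| <= A * `|f x| `^ q + B)%R.
  have aV : (a^-1 `^ q = (a `^ q)^-1)%R.
    by rewrite -(powR_inv1 (ltW a0)) -powRrM mulN1r powRN.
  have := fa x; rewrite powRM ?invr_ge0 ?(ltW a0)// aV => /le_trans; apply.
  rewrite lerD2r /A le_eqVlt; apply/orP; left; apply/eqP; ring.
have mAf : measurable_fun setT (fun x => A%:E * (`|f x| `^ q)%:E).
  exact: (emeasurable_funM (measurable_cst A%:E) mfq).
apply: (@le_trans _ _ (\int[P]_x (A%:E * (`|f x| `^ q)%:E + B%:E))).
  apply: ge0_le_integral => //.
  - by apply/measurable_EFinP; exact: measurableT_comp.
  - exact: (emeasurable_funD mAf (measurable_cst B%:E)).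
  - by move=> x _; rewrite -EFinM -EFinD lee_fin.
rewrite ge0_integralD//; first last.
- by move=> x _; rewrite -EFinM lee_fin mulr_ge0// powR_ge0.
rewrite integral_prob_cst ge0_integralZl//.
apply: (@le_trans _ _ (A%:E * (a `^ q)%:E + B%:E)).
  rewrite leeD2r// lee_wpmul2l ?lee_fin//; apply: le_trans Hq _.
  by rewrite lee_fin ge0_ler_powR ?nnegrE ?lerDl// ltW.
rewrite -EFinM -EFinD lee_fin /A divfK ?gt_eqF ?powR_gt0// /B.
by rewrite mulrBr mulr1 addrC subrK.
Qed.

Variables (s alpha : nat).

(** Whatever r is, each block of a norm at most 1 is at most 1. So each term of the inner sum is at
    most gamma_u^q, and Jensen, or the essential supremum when q is infinite, yields the L^1
    bound. *)
Lemma sobolev_norm_partial_int (gamma : {set 'I_s} -> R) (q r : \bar R)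
    (f : vecR R s -> R) (u v : {set 'I_s}) beta :
  (forall u, (0 <= gamma u)%R) -> 1 <= q -> 1 <= r ->
  cube_integrable (deriv_mixed beta f) ->
  sobolev_norm alpha gamma q r f <= 1 -> v \in powerset u -> beta \in orders alpha u v ->
  \int[cube_measure s]_x `|partial_int v (deriv_mixed beta f) x|%:E <= (gamma u)%:E.
Proof.
move=> g0 q1 r1 ig fr vu Hb.
have mP : measurable_fun setT (partial_int v (deriv_mixed beta f)).
  exact: partial_int_measurable.
have inner_sum_ge0 q' w : 0 <= inner_sum alpha q' f w.
  rewrite /inner_sum; apply: sume_ge0 => ? _; apply: sume_ge0 => ? _.
  by apply: integral_ge0 => x _; rewrite lee_fin powR_ge0.
have inner_sup_ge0 w : 0 <= inner_sup alpha f w by exact: bigmax_ge_id.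
have block_ge0 w : 0 <= block_norm alpha gamma q f w.
  have wd0 x c : 0 <= x -> (0 <= c)%R -> 0 <= weight_div x c.
    move=> x0 c0; rewrite /weight_div; case: eqP => _; first by case: eqP.
    by rewrite mule_ge0// lee_fin invr_ge0.
  by rewrite /block_norm; case: q {q1 fr} => [q| |];
    [exact: poweR_ge0|exact: wd0|exact: wd0].
have {fr block_ge0} block1 : block_norm alpha gamma q f u <= 1.
  move: fr r1; rewrite /sobolev_norm; case: r => [r| |] // fr r1.
    have r0 : (0 < r)%R by rewrite -lte_fin (lt_le_trans _ r1).
    have sr : \sum_(u : {set 'I_s}) block_norm alpha gamma q f u `^ r <= 1.
      apply: poweR_le1 fr; last by rewrite invr_gt0.
      by apply: sume_ge0 => ? _; exact: poweR_ge0.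
    apply: (poweR_le1 (block_ge0 u) r0); apply: le_trans sr.
    exact: (lee_term_sum (isT : xpredT u) (fun w _ => poweR_ge0 _ _)).
  by apply: le_trans fr; exact: le_bigmax.
move: q1 block1; rewrite /block_norm; case: q => [q| |] // q1 block1.
  have q0 : (0 < q)%R by rewrite -lte_fin (lt_le_trans _ q1).
  have Sg : inner_sum alpha q f u <= (gamma u `^ q)%:E.
    apply: weight_div_le1; rewrite ?powR_ge0//.
    apply: poweR_le1 block1; last by rewrite invr_gt0.
    rewrite /weight_div; case: eqP => _; first by case: eqP.
    by rewrite mule_ge0// lee_fin invr_ge0 powR_ge0.
  apply: (@integral_le_of_powR _ _ _ _ q) => //; apply: le_trans Sg.
  have int_ge0 w (b : {ffun 'I_s -> 'I_alpha.+1}) : 0 <= \int[cube_measure s]_x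
      (`|partial_int w (deriv_mixed b f) x| `^ q)%:E.
    by apply: integral_ge0 => x _; rewrite lee_fin powR_ge0.
  apply: le_trans (lee_term_sum vu _); last by move=> w _; exact: sume_ge0.
  exact: (@lee_term_sum _ (fun b => b \in orders alpha u v) (fun b => \int[cube_measure s]_x
    (`|partial_int v (deriv_mixed b f) x| `^ q)%:E) _ Hb (fun b _ => int_ge0 v b)).
have Sg := weight_div_le1 (g0 u) (inner_sup_ge0 u) block1.
have eg : ess_sup (cube_measure s) (fun x =>
    `|partial_int v (deriv_mixed beta f) x|%:E) <= (gamma u)%:E.
  apply: le_trans Sg; rewrite /inner_sup.
  apply: le_trans (le_bigmax_cond _ _ vu); exact: (le_bigmax_cond _ _ Hb).
rewrite -[leRHS](integral_prob_cst (cube_measure s)).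
apply: ae_ge0_le_integral => //.
- by apply/measurable_EFinP; exact: measurableT_comp.
- by move=> x _; rewrite lee_fin.
- by move/ess_supP : eg; apply: filterS.
Qed.

End NormBound.

Section CubeInt.
Context {R : realType}.
Variable s : nat.
Local Notation mu := (@cube_measure R s).
Implicit Types (h : vecR R s -> R).

Lemma cube_int_cst (c : R) : cube_int ((fun=> c) : vecR R s -> R) = c.
Proof. by rewrite /cube_int /Rintegral integral_prob_cst. Qed.

Lemma cube_integrable_cst (c : R) : cube_integrable ((fun=> c) : vecR R s -> R).
Proof. exact: finite_measure_integrable_cst. Qed.

Lemma cube_integrableZ c h : cube_integrable h -> cube_integrable (fun x => c * h x).
Proof.
move=> ih; rewrite /cube_integrable (_ : EFin \o _ = (fun x => c%:E * (h x)%:E)%E).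
  exact: integrableZl.
by apply/funext.
Qed.

Lemma cube_intZ c h : cube_integrable h ->
  cube_int (fun x => c * h x) = c * cube_int h.
Proof. exact: RintegralZl. Qed.

Lemma cube_int_sum (I : Type) (r : seq I) (P : pred I) (F : I -> vecR R s -> R) :
  (forall i, P i -> cube_integrable (F i)) ->
  cube_integrable (fun x => \sum_(i <- r | P i) F i x) /\
  cube_int (fun x => \sum_(i <- r | P i) F i x) = \sum_(i <- r | P i) cube_int (F i).
Proof.
move=> iF; elim: r => [|i r [IH1 IH2]].
  rewrite big_nil; under eq_fun do rewrite big_nil.
  by split; [exact: cube_integrable_cst|exact: cube_int_cst].
rewrite big_cons; under eq_fun do rewrite big_cons.
case: ifPn => // Pi; split; last by rewrite -IH2 -RintegralD//; exact: iF.
have := integrableD measurableT (iF i Pi) IH1.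
by rewrite /cube_integrable; apply: eq_integrable.
Qed.

Lemma measurable_cube : measurable (cube R s).
Proof.
have -> : cube R s = \bigcap_j ((fun x : vecR R s =>
    tnth x j) @^-1` `[0%R, 1%R[).
  apply/seteqP; split => x /= H j; first by move=> _; rewrite /= in_itv; exact: H.
  by have := H j I; rewrite /= in_itv.
apply: fin_bigcap_measurable => // j _.
by rewrite -[X in measurable X]setTI; exact: measurable_tnth.
Qed.

(** The representation of f, and the agreement of periodic and polynomial factors, hold only on the
    cube, while integrals run over the whole type. *)
Lemma cube_ae : {ae mu, forall x, cube R s x}.
Proof.
exists (~` cube R s); split; [exact: measurableC measurable_cube| |by []].
rewrite probability_setC; last exact: measurable_cube.
have -> : cube R s = [set x : vecR R s | forall j, `[0%R, 1%R[%classic (Defs.coord x j)].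
  by apply/seteqP; split => x /= H j; have := H j; rewrite /= in_itv.
rewrite (@cube_measure_box R s (fun=> `[0%R, 1%R[%classic)) => [|j]; last exact: measurable_itv.
under eq_bigr do rewrite setIid lebesgue_measure_itv/= lte_fin ltr01 sube0.
by rewrite big1// subee.
Qed.

Lemma eq_cube_int h h' : cube_integrable h -> cube_integrable h' ->
  (forall x, cube R s x -> h x = h' x) -> cube_int h = cube_int h'.
Proof.
move=> /integrableP[mh _] /integrableP[mh' _] hh'; congr fine.
apply: ae_eq_integral => //; have := cube_ae; apply: filterS => x xc _ /=.
by rewrite hh'.
Qed.

End CubeInt.

Section Extrapolation.
Context {R : realType}.
Variables (p s : nat) (C : gen_matrices p s).
Hypothesis p_prime : prime p.
Implicit Types (h : vecR R s -> R).

Lemma net_point_cube m i : cube R s (net_point R m m C i).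
Proof.
move=> j; rewrite coord_net_point//.
have pm : 0 < (p ^ m)%:R :> R by rewrite ltr0n expn_gt0 prime_gt0.
rewrite divr_ge0 ?ler0n//= ltr_pdivrMr// mul1r ltr_nat.
exact: net_index_lt.
Qed.

Lemma eq_extrapolation h h' tau m : (forall x, cube R s x -> h x = h' x) ->
  extrapolation C h tau m = extrapolation C h' tau m.
Proof.
move=> hh'; rewrite !extrapolationE; congr richardson; apply/funext => n.
by congr (_ / _); apply: eq_bigr => i _; exact/hh'/net_point_cube.
Qed.

(** The weights and nodes do not depend on [h]: this lets the rule commute with sums and with the
    integral over y. *)
Lemma extrapolation_linear tau m : exists l : seq (R * vecR R s),
  forall h, extrapolation C h tau m = \sum_(z <- l) z.1 * h z.2.
Proof.
elim: tau m => [|tau IHtau] m /=.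
  exists [seq (((p ^ m)%:R)^-1, net_point R m m C i) | i <- index_iota 0 (p ^ m)].
  move=> h; rewrite big_map big_mkord /qmc_rule mulrC mulr_sumr.
  by apply: eq_bigr.
have [l1 H1] := IHtau m.+1; have [l0 H0] := IHtau m.
set P := p%:R ^+ tau.+1; set d := (P - 1)^-1.
exists ([seq (d * P * z.1, z.2) | z <- l1] ++ [seq (- d * z.1, z.2) | z <- l0]) => h.
rewrite big_cat !big_map /= H1 H0 mulrBl; congr (_ + _).
  by rewrite [LHS]mulrC !mulr_sumr; apply: eq_bigr => z _; rewrite !mulrA.
by rewrite -mulrN [LHS]mulrC mulr_sumr; apply: eq_bigr => z _; rewrite !mulrA.
Qed.

End Extrapolation.

(** * The quadrature error *)

Section PeriodicKernel.
Context {R : realType}.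
Variables (s alpha : nat) (u v : {set 'I_s}) (beta : {ffun 'I_s -> 'I_alpha.+1}).

(** [a] is a coordinate of x and [b] one of y. The periodic [b_per (beta j)] stands in for
    [b_fun (beta j)], equal to it on [0,1), because it is bounded on the whole line. *)
Definition kernel_factor (j : 'I_s) (a b : R) : R :=
  if j \in v then b_per alpha (b - a) else if j \in u then b_per (beta j) a else 1.

Definition kernel_prod (P : pred 'I_s) (z : vecR R s * vecR R s) : R :=
  \prod_(j | P j) kernel_factor j (Defs.coord z.1 j) (Defs.coord z.2 j).

Lemma measurable_kernel_prod P : measurable_fun setT (kernel_prod P).
Proof.
pose F j (z : vecR R s * vecR R s) := kernel_factor j (Defs.coord z.1 j) (Defs.coord z.2 j).
suff mF j : measurable_fun setT (F j).
  have -> : kernel_prod P = fun z => \prod_(j <- [seq j <- index_enum 'I_s | P j]) F j z.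
    by apply/funext => z; rewrite big_filter.
  by apply: (measurable_prod (h := F)) => j _; exact: mF.
rewrite /F.
have m1 : measurable_fun setT (fun z : vecR R s * vecR R s => tnth z.1 j).
  exact: (measurableT_comp (measurable_tnth j) measurable_fst).
have m2 : measurable_fun setT (fun z : vecR R s * vecR R s => tnth z.2 j).
  exact: (measurableT_comp (measurable_tnth j) measurable_snd).
rewrite /kernel_factor; case: (j \in v).
  apply: (measurableT_comp (f := b_per alpha)); first exact: measurable_b_per.
  exact: measurable_funB.
case: (j \in u) => //.
exact: (measurableT_comp (measurable_b_per (beta j)) m1).
Qed.

Lemma kernel_factor_bounded : exists c : R, forall j a b, `|kernel_factor j a b| <= c.
Proof.
have [c1 c10 H1] := @b_per_bounded R alpha.
have /choice[c2 H2] : forall j, exists c : R, 0 <= c /\ forall x : R, `|b_per (beta j) x| <= c.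
  by move=> j; have [c c0 H] := @b_per_bounded R (beta j); exists c.
have S0 : 0 <= \sum_j c2 j by apply: sumr_ge0 => j _; have [] := H2 j.
exists (1 + c1 + \sum_j c2 j) => j a b; rewrite /kernel_factor.
case: (j \in v); first by have := H1 (b - a); lra.
case: (j \in u); last by rewrite normr1; lra.
have [_ /(_ a)] := H2 j; suff : c2 j <= \sum_j c2 j by lra.
by rewrite [leRHS](bigD1 j)//= lerDl sumr_ge0// => i _; have [] := H2 i.
Qed.

Lemma kernel_prod_bounded P : exists c : R, forall z, `|kernel_prod P z| <= c.
Proof.
have [c Hc] := kernel_factor_bounded; exists (\prod_(j | P j) c) => z.
by rewrite normr_prod; apply: ler_prod => j _; rewrite normr_ge0 Hc.
Qed.

Lemma kernel_prod_splice P x y y' : kernel_prod P (x, splice v y y') = kernel_prod P (x, y).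
Proof.
apply: eq_bigr => j _; rewrite /kernel_factor /Defs.coord /= tnth_mktuple.
by case: (j \in v).
Qed.

Lemma kernel_prodE x y : v \subset u -> cube R s x ->
  kernel_prod predT (x, y) = bernoulli_kernel u v beta y x.
Proof.
move=> vu xc; rewrite /bernoulli_kernel big_mkcond [X in _ * X]big_mkcond -big_split /=.
apply: eq_bigr => j _; rewrite /kernel_factor /= finset.in_setD.
case: (j \in v) => /=; first by rewrite mul1r.
by case: (j \in u); rewrite mulr1 // b_per_itv.
Qed.

(** One factor with index [j0] in [u] has mean zero, and the rest of the product does not involve
    that coordinate. The partial integral bound, taken over the complement of [j0], then gives 0. *)
Lemma cube_int_kernel_prod y : (0 < alpha)%N -> u != finset.set0 -> v \subset u ->
  beta \in orders alpha u v -> cube_int (fun x => kernel_prod predT (x, y)) = 0.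
Proof.
move=> alpha0 /finset.set0Pn[j0 ju] vu; rewrite inE => /forallP/(_ j0) bj.
pose h a := kernel_factor j0 a (Defs.coord y j0).
have mh : measurable_fun setT h.
  rewrite /h /kernel_factor; case: (j0 \in v); first exact: measurable_b_perB.
  by rewrite ju; exact: measurable_b_per.
have [c Hc] := kernel_factor_bounded.
have h0 : (\int[@unit_measure R]_x (h x)%:E = 0)%E.
  move: bj; rewrite /h /kernel_factor; case: (j0 \in v) => bj.
    exact: integral_b_perB.
  by rewrite ju in bj *; exact: integral_b_per.
pose g (x : vecR R s) := h (Defs.coord x j0).
have mg : measurable_fun setT g by exact: (measurableT_comp mh (measurable_tnth j0)).
have ig : cube_integrable g.
  by apply: (cube_integrable_bounded (c := c)) => // x; exact: Hc.
pose K (x : vecR R s) := kernel_prod (predC1 j0) (x, y).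
have [c' Hc'] := kernel_prod_bounded (predC1 j0).
have mK : measurable_fun setT K.
  exact: (measurableT_comp (measurable_kernel_prod _) (measurable_pair2 y)).
have KE : (fun x => kernel_prod predT (x, y)) = fun x => g x * K x.
  by apply/funext => x; rewrite /kernel_prod (bigD1 j0).
rewrite KE; apply/eqP; rewrite -normr_le0 -lee_fin.
apply: le_trans (cube_int_partial_bound (v := [set~ j0]%SET) (c := c') ig mK _ _) _ => //.
- by move=> x; exact: Hc'.
- move=> x x'; apply: eq_bigr => j /= jj.
  by rewrite /Defs.coord tnth_mktuple !inE jj.
- rewrite (eq_integral (cst 0%E)) ?integral_cst ?mul0e ?mule0// => x _ /=.
  rewrite (_ : partial_int _ _ _ = 0) ?normr0//.
  rewrite -(cube_int_coord j0 mh (fun a => Hc j0 a _) h0); congr cube_int.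
  by apply/funext => x'; rewrite /g /Defs.coord tnth_mktuple !inE eqxx.
Qed.

End PeriodicKernel.

Section ErrorFunctional.
Context {R : realType}.
Variables (p s : nat) (C : gen_matrices p s) (tau m : nat).
Implicit Types (h : vecR R s -> R).

Definition quad_error h := cube_int h - extrapolation C h tau m.

Lemma quad_errorZ c h : cube_integrable h ->
  quad_error (fun x => c * h x) = c * quad_error h.
Proof.
move=> ih; have [l El] := @extrapolation_linear R p s C tau m.
rewrite /quad_error cube_intZ// !El mulrBr mulr_sumr; congr (_ - _).
by apply: eq_bigr => z _; rewrite mulrCA.
Qed.

Lemma quad_error_sum (I : Type) (r : seq I) (P : pred I) (F : I -> vecR R s -> R) :
  (forall i, P i -> cube_integrable (F i)) ->
  quad_error (fun x => \sum_(i <- r | P i) F i x) = \sum_(i <- r | P i) quad_error (F i).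
Proof.
move=> iF; have [l El] := @extrapolation_linear R p s C tau m.
rewrite /quad_error (cube_int_sum r iF).2 El sumrB; congr (_ - _).
under [RHS]eq_bigr do rewrite El.
by rewrite exchange_big; apply: eq_bigr => z _; rewrite mulr_sumr.
Qed.

Lemma eq_quad_error h h' : prime p -> cube_integrable h -> cube_integrable h' ->
  (forall x, cube R s x -> h x = h' x) -> quad_error h = quad_error h'.
Proof.
by move=> pp ih ih' hh'; rewrite /quad_error (eq_cube_int ih ih')// (eq_extrapolation C pp _ _ hh').
Qed.

Lemma quad_error_cst c : prime p -> quad_error (fun=> c) = 0.
Proof.
move=> pp; rewrite /quad_error cube_int_cst extrapolationE.
rewrite (_ : (fun n => _) = fun=> c); first by rewrite richardson_cst ?subrr// prime_gt1.
apply/funext => n; rewrite /qmc_rule sumr_const card_ord -[c *+ _]mulr_natr mulfK//.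
by rewrite pnatr_eq0 -lt0n expn_gt0 prime_gt0.
Qed.

End ErrorFunctional.

Section Component.
Context {R : realType}.
Variables (s alpha : nat) (f : vecR R s -> R).
Implicit Types (u v : {set 'I_s}) (beta : {ffun 'I_s -> 'I_alpha.+1}).

Definition kernel_term u v beta (x : vecR R s) : R :=
  cube_int (fun y => deriv_mixed beta f y * kernel_prod u v beta predT (x, y)).

Hypothesis f_deriv : has_mixed_derivatives alpha f.

Lemma cube_integrable_deriv_mixed beta : cube_integrable (deriv_mixed beta f).
Proof.
have [_ /(_ beta) [g gP]] := f_deriv.
by have [] := @xgetPex _ (fun=> 0) [set g | weak_derivative beta f g] (ex_intro _ g gP).
Qed.

Lemma cube_integrable_kernel_term u v beta : cube_integrable (kernel_term u v beta).
Proof.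
have [c Hc] := @kernel_prod_bounded R s alpha u v beta predT.
exact: (integrable_kernel_int (cube_integrable_deriv_mixed beta)
  (@measurable_kernel_prod R s alpha u v beta predT) Hc).
Qed.

(** The factors over u \ v are constant in y and may be taken under the integral, so that a single
    kernel is left. *)
Lemma component_kernel_term u x : cube R s x ->
  component alpha f u x =
  \sum_(v in powerset u) (-1) ^+ (alpha.+1 * #|v|) *
    \sum_(beta in orders alpha u v) kernel_term u v beta x.
Proof.
move=> xc; apply: eq_bigr => v; rewrite powersetE => vu; congr (_ * _).
apply: eq_bigr => beta _; rewrite /kernel_term.
under [in RHS]eq_fun do rewrite (kernel_prodE beta _ vu xc).
rewrite /bernoulli_kernel; under [in RHS]eq_fun do rewrite mulrCA.
rewrite cube_intZ//.
have -> : (fun y : vecR R s => deriv_mixed beta f y *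
    \prod_(j in v) b_per alpha (Defs.coord y j - Defs.coord x j)) =
    fun y => deriv_mixed beta f y * kernel_prod v v beta predT (x, y).
  apply/funext => y; rewrite kernel_prodE// /bernoulli_kernel finset.setDv.
  by rewrite finset.big_set0 mul1r.
have [c Hc] := @kernel_prod_bounded R s alpha v v beta predT.
exact: (cube_integrable_kernel (cube_integrable_deriv_mixed beta)
  (@measurable_kernel_prod R s alpha v v beta predT) Hc x).
Qed.

Variables (p : nat) (C : gen_matrices p s) (tau m : nat).
Hypothesis p_prime : prime p.

(** The kernel is then an empty product, so the term is constant, and the extrapolated rule is exact
    on constants. *)
Lemma quad_error_kernel_term0 v beta : v \in powerset finset.set0 ->
  quad_error C tau m (kernel_term finset.set0 v beta) = 0.
Proof.
rewrite powersetE finset.subset0 => /eqP->.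
rewrite (_ : kernel_term _ _ _ = fun=> cube_int (deriv_mixed beta f)).
  exact: quad_error_cst.
apply/funext => x; congr cube_int; apply/funext => y.
by rewrite /kernel_prod big1 ?mulr1// => j _; rewrite /kernel_factor !inE.
Qed.

Lemma quad_error_kernel_term (gamma : {set 'I_s} -> R) (q r : \bar R) u v beta (K : R) :
  (0 < alpha)%N ->
  (forall u, 0 <= gamma u) -> (1 <= q)%E -> (1 <= r)%E ->
  (sobolev_norm alpha gamma q r f <= 1)%E ->
  u != finset.set0 -> v \in powerset u -> beta \in orders alpha u v ->
  (forall y : vecR R s, `|extrapolation C (bernoulli_kernel u v beta y) tau m| <= K) ->
  `|quad_error C tau m (kernel_term u v beta)| <= K * gamma u.
Proof.
move=> alpha0 g0 q1 r1 fr u0 vu bu EK; have vu' : v \subset u by rewrite -powersetE.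
have [c Hc] := @kernel_prod_bounded R s alpha u v beta predT.
have ig := cube_integrable_deriv_mixed beta.
have mk := @measurable_kernel_prod R s alpha u v beta predT.
rewrite /quad_error {1}/kernel_term (kernel_fubini ig mk Hc).
have -> : (fun y => deriv_mixed beta f y *
    cube_int (fun x => kernel_prod u v beta predT (x, y))) = fun=> 0.
  by apply/funext => y; rewrite cube_int_kernel_prod ?mulr0.
rewrite cube_int_cst sub0r normrN.
have [l El] := @extrapolation_linear R p s C tau m.
pose E (y : vecR R s) := extrapolation C (fun x => kernel_prod u v beta predT (x, y)) tau m.
have EE y : E y = \sum_(z <- l) z.1 * kernel_prod u v beta predT (z.2, y) by exact: El.
have mE : measurable_fun setT E.
  rewrite (_ : E = fun y => \sum_(z <- l) z.1 * kernel_prod u v beta predT (z.2, y)); last first.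
    by apply/funext.
  apply: measurable_sum => z; apply: measurable_funM => //.
  exact: (measurableT_comp mk (measurable_pair1 z.2)).
have EKy y : `|E y| <= K.
  by rewrite /E (eq_extrapolation C p_prime _ _ (fun x xc => kernel_prodE beta y vu' xc)).
rewrite (_ : extrapolation _ _ _ _ = cube_int (fun y => deriv_mixed beta f y * E y)).
  rewrite -lee_fin EFinM; apply: le_trans (cube_int_partial_bound (v := v) ig mE EKy _) _.
    move=> x y; rewrite !EE; apply: eq_bigr => z _.
    by rewrite kernel_prod_splice.
  apply: lee_wpmul2l; first by rewrite lee_fin (le_trans _ (EKy [tuple 0 | j < s])).
  exact: (sobolev_norm_partial_int g0 q1 r1 ig fr vu bu).
rewrite El; under [in RHS]eq_fun do rewrite EE mulr_sumr.
rewrite (cube_int_sum _ _).2.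
  apply: eq_bigr => z _; rewrite /kernel_term -cube_intZ.
    by congr cube_int; apply/funext => y; rewrite mulrCA.
  exact: (cube_integrable_kernel ig mk Hc z.2).
move=> z _; under eq_fun do rewrite mulrCA.
apply: cube_integrableZ; exact: (cube_integrable_kernel ig mk Hc z.2).
Qed.

End Component.

(** * Number of terms of a component, and conclusion *)

Section Count.
Variables (s alpha : nat).
Implicit Types (u v : {set 'I_s}).

Lemma card_orders u v : v \subset u -> (#|orders alpha u v| <= alpha.+1 ^ #|u|)%N.
Proof.
move=> /fintype.subsetP vu; rewrite -[X in (X ^ _)%N]card_ord.
have -> : #|'I_alpha.+1| = #|[pred _ : 'I_alpha.+1 | true]| by apply: eq_card.
rewrite -(card_pffun_on ord0); apply/subset_leq_card/fintype.subsetP => beta.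
rewrite inE => /forallP H; apply/pffun_onP; split=> [|x _]; last by rewrite inE.
apply/fintype.subsetP => j; rewrite !inE; apply: contraNT => ju.
have := H j; rewrite (negPf ju) ifN; first by move=> /eqP bj; exact/eqP/val_inj.
by apply: contra ju; exact: vu.
Qed.

Lemma sum_orders_le (R : realType) u (B : R)
    (F : {set 'I_s} -> {ffun 'I_s -> 'I_alpha.+1} -> R) : 0 <= B ->
  (forall v beta, v \in powerset u -> beta \in orders alpha u v -> `|F v beta| <= B) ->
  `|\sum_(v in powerset u) (-1) ^+ (alpha.+1 * #|v|) * \sum_(beta in orders alpha u v) F v beta|
    <= (2 * alpha.+1)%:R ^+ #|u| * B.
Proof.
move=> B0 FB; apply: le_trans (ler_norm_sum _ _ _) _.
apply: (@le_trans _ _ (\sum_(v in powerset u) alpha.+1%:R ^+ #|u| * B)).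
  apply: ler_sum => v vu; rewrite normrM normrX normrN1 expr1n mul1r.
  apply: le_trans (ler_norm_sum _ _ _) _.
  apply: (@le_trans _ _ (\sum_(beta in orders alpha u v) B)).
    by apply: ler_sum => beta; exact: FB.
  rewrite sumr_const -[leLHS]mulr_natl ler_wpM2r// -natrX ler_nat.
  by apply: card_orders; rewrite -powersetE.
by rewrite sumr_const card_powerset -[leLHS]mulr_natl natrX natrM exprMn mulrA.
Qed.

End Count.

Theorem theorem1 (R : realType) (p alpha t : nat)
    (p_prime : prime p) (alpha_ge2 : (2 <= alpha)%N) :
  exists U : nat -> R,
    (forall k, (0 < k)%N -> 0 < U k) /\
    forall (s : nat) (q r : \bar R) (gamma : {set 'I_s} -> R)
           (C : gen_matrices p s) (m : nat),
      (0 < s)%N -> (1 <= q)%E -> (1 <= r)%E ->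
      (forall u, 0 <= gamma u) ->
      order_digital_sequence alpha t C ->
      bounded_precision alpha C ->
      (0 < m)%N -> (t < alpha * m)%N ->
      let N : R := (total_evaluations p alpha m)%:R in
      (ereal_sup [set (`|cube_int f - extrapolation C f alpha.-1 m|)%:E
                 | f in [set f | sobolev_space alpha gamma q r f /\
                                 sobolev_norm alpha gamma q r f <= 1]]
       <= (\sum_(u : {set 'I_s} | u != finset.set0)
             gamma u * U #|u| *
               (log_base p N ^+ (alpha * #|u|) / N ^+ alpha))%:E)%E.
Proof.
have [K [K0 HK]] := @richardson_kernel_bound R p alpha t p_prime alpha_ge2.
(* The first factor counts the pairs (v, beta): 2^|u| subsets and at most (alpha + 1)^|u|
   multi-indices for each. *)
exists (fun k => (2 * alpha.+1)%:R ^+ k * K k); split=> [k _|].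
  by rewrite mulr_gt0// exprn_gt0// ltr0n.
move=> s q r gamma C m _ q1 r1 g0 HC _ m0 tm; lazy zeta.
set N : R := (total_evaluations p alpha m)%:R.
apply: ge_ereal_sup => _ [f [[fd _ fE] fn] <-]; rewrite lee_fin.
have alpha0 : (0 < alpha)%N by exact: ltnW.
pose I u v beta := @kernel_term R s alpha f u v beta.
pose G u (x : vecR R s) := \sum_(v in powerset u) (-1) ^+ (alpha.+1 * #|v|) *
  \sum_(beta in orders alpha u v) I u v beta x.
have iI u v beta : cube_integrable (I u v beta) by exact: cube_integrable_kernel_term.
have iS u v : cube_integrable (fun x : vecR R s => \sum_(beta in orders alpha u v) I u v beta x).
  by have [] := cube_int_sum (index_enum _) (P := mem (orders alpha u v)) (fun beta _ => iI u v beta).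
have iZ u (v : {set 'I_s}) : cube_integrable (fun x : vecR R s => (-1) ^+ (alpha.+1 * #|v|) *
    \sum_(beta in orders alpha u v) I u v beta x) by exact: cube_integrableZ.
have iG u : cube_integrable (G u).
  by have [] := cube_int_sum (index_enum _) (P := mem (powerset u)) (fun v _ => iZ u v).
have eG u : quad_error C alpha.-1 m (G u) =
    \sum_(v in powerset u) (-1) ^+ (alpha.+1 * #|v|) *
      \sum_(beta in orders alpha u v) quad_error C alpha.-1 m (I u v beta).
  rewrite quad_error_sum => [|v _]; last exact: iZ.
  apply: eq_bigr => v _; rewrite quad_errorZ; last exact: iS.
  by congr (_ * _); rewrite quad_error_sum.
have [iSG _] := cube_int_sum (index_enum _) (P := predT) (fun u _ => iG u).
rewrite -/(quad_error C alpha.-1 m f) (@eq_quad_error _ _ _ _ _ _ f _ p_prime _ iSG); last 2 first.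
- by have [] := fd.
- by move=> x xc; rewrite fE//; apply: eq_bigr => u _; exact: component_kernel_term.
rewrite quad_error_sum// (bigD1 finset.set0)//= eG.
rewrite big1 ?add0r => [|v v0]; last first.
  by rewrite big1 ?mulr0// => beta _; exact: quad_error_kernel_term0.
apply: le_trans (ler_norm_sum _ _ _) _; apply: ler_sum => u u0; rewrite eG.
set L := _ / _; rewrite (_ : gamma u * _ * L = (2 * alpha.+1)%:R ^+ #|u| * (K #|u| * L * gamma u)).
  have KL v beta : v \in powerset u -> beta \in orders alpha u v ->
      `|quad_error C alpha.-1 m (I u v beta)| <= K #|u| * L * gamma u.
    move=> vu bu; apply: (quad_error_kernel_term fd p_prime alpha0 g0 q1 r1 fn u0 vu bu) => y.
    by apply: HK => //; rewrite -powersetE.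
  apply: sum_orders_le => //.
  (* Any admissible pair shows that the bound is nonnegative; here v is empty and beta equals alpha
     on [u]. *)
  apply: le_trans (normr_ge0 _) (KL finset.set0 [ffun j => if j \in u then ord_max else ord0] _ _).
    by rewrite powersetE finset.sub0set.
  rewrite inE; apply/forallP => j; rewrite inE ffunE /=.
  by case: (j \in u).
ring.
Qed.
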